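(* Let $\Bbbk$ be a field and let $k \in \mathbb{N}$ be a positive integer. Then there exists a graph $G$ such that $$\operatorname{reg}(S/J_G) = \deg(h_G) + k.$$
   Context: All graphs are finite, simple and undirected, with nonempty vertex set. For a graph $G$ with vertex set $[n]=\{1,\dots,n\}$ and edge set $E$, let $S=\Bbbk[x_1,\dots,x_n,y_1,\dots,y_n]$ be the standard graded polynomial ring over the field $\Bbbk$; the binomial edge ideal of $G$ is $J_G=\langle x_iy_j-y_ix_j : \{i,j\}\in E\rangle\subseteq S$. The graded Betti numbers are $\beta_{i,j}(S/J_G)=\dim_\Bbbk \operatorname{Tor}_i^S(S/J_G,\Bbbk)_j$, and the Castelnuovo--Mumford regularity is $\operatorname{reg}(S/J_G)=\max\{j-i : \beta_{i,j}(S/J_G)\neq 0\}$. The Hilbert series of the standard graded $\Bbbk$-algebra $S/J_G$ has the form $\frac{h_G(t)}{(1-t)^d}$, where $d$ is the Krull dimension of $S/J_G$ and $h_G(t)\in\mathbb{Z}[t]$; the polynomial $h_G$ is called the $h$-polynomial. *)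

(* Defs.v *)
From HB Require Import structures.
From mathcomp Require Import all_boot all_order all_algebra.
From mathcomp Require Import mpoly.

Set Implicit Arguments.
Unset Strict Implicit.
Unset Printing Implicit Defensive.

Import GRing.Theory.
Local Open Scope ring_scope.

Definition simple_graph (n : nat) (e : rel 'I_n) : Prop :=
  ssrbool.symmetric e /\ irreflexive e.

Section BinomialEdgeIdeal.

Variables (K : fieldType) (n : nat).

(* The 2n variables are numbered x_1, ..., x_n, y_1, ..., y_n. *)
Definition xvar (i : 'I_n) : {mpoly K[n + n]} := 'X_(lshift n i).
Definition yvar (i : 'I_n) : {mpoly K[n + n]} := 'X_(rshift n i).

Definition binomial_edge_ideal (e : rel 'I_n) (p : {mpoly K[n + n]}) : Prop :=
  exists c : 'I_n -> 'I_n -> {mpoly K[n + n]},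
    p = \sum_(i < n) \sum_(j < n | e i j)
          c i j * (xvar i * yvar j - yvar i * xvar j).

End BinomialEdgeIdeal.

Arguments binomial_edge_ideal K {n} e p.

(* Ideals of S = K[z_1, ..., z_N] are Prop-valued membership predicates, so
   that no decidability of membership is presupposed. *)
Section GradedInvariants.

Variables (K : fieldType) (N : nat).
Local Notation S := {mpoly K[N]}.

Definition prime_ideal (P : S -> Prop) : Prop :=
  [/\ P 0,
      forall a p q, P p -> P q -> P (a * p + q),
      ~ P 1
    & forall p q, P (p * q) -> P p \/ P q].

(* Primes of S / J are primes of S containing J;
   the chain P 0 < ... < P d has length d. *)
Definition prime_chain (J : S -> Prop) (d : nat) : Prop :=
  exists P : nat -> S -> Prop,
    (forall i, (i <= d)%N -> prime_ideal (P i) /\ forall p, J p -> P i p) /\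
    (forall i, (i < d)%N ->
       (forall p, P i p -> P i.+1 p) /\ exists2 p, P i.+1 p & ~ P i p).

Definition krull_dim (J : S -> Prop) (d : nat) : Prop :=
  prime_chain J d /\ forall d', prime_chain J d' -> (d' <= d)%N.

(* For a homogeneous ideal J, dim_K (S / J)_m = r: there are r forms of degree
   m whose classes form a basis of S_m / (J \cap S_m). *)
Definition quotient_dim (J : S -> Prop) (m r : nat) : Prop :=
  exists b : 'I_r -> S,
    [/\ forall i, b i \is m.-homog,
        forall p, p \is m.-homog ->
          exists c : 'I_r -> K, J (p - \sum_(i < r) c i *: b i)
      & forall c : 'I_r -> K, J (\sum_(i < r) c i *: b i) -> forall i, c i = 0].

(* (\sum_m H m t^m) * (1 - t)^d = h(t), coefficient by coefficient, where H is
   the Hilbert function and d the Krull dimension of S / J. *)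
Definition h_polynomial (J : S -> Prop) (h : {poly int}) : Prop :=
  exists (d : nat) (H : nat -> nat),
    [/\ krull_dim J d,
        forall m, quotient_dim J m (H m)
      & forall m,
          \sum_(i < m.+1) (H i)%:Z * ((1 - 'X : {poly int}) ^+ d)`_(m - i)%N
          = h`_m].

(* F_i = \bigoplus_a S(- gdeg i a), whose elements are row vectors; the maps
   gdiff i : F_(i+1) -> F_i and F_0 -> S / J (represented by gaug) are right
   multiplication by matrices. *)
Record graded_free_complex := GradedFreeComplex {
  grank : nat -> nat;
  gdeg  : forall i, 'I_(grank i) -> nat;
  gdiff : forall i, 'M[S]_(grank i.+1, grank i);
  gaug  : 'cV[S]_(grank 0)
}.

(* The boundary condition gdiff i.+1 *m gdiff i = 0 is contained in the two
   exactness clauses. *)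
Definition graded_free_resolution (J : S -> Prop) (F : graded_free_complex) :
    Prop :=
  [/\ forall c, gaug F c 0 \is (gdeg c).-homog,
      forall i (a : 'I_(grank F i.+1)) (c : 'I_(grank F i)),
        gdiff F i a c \is (gdeg a - gdeg c)%N.-homog /\
        ((gdeg a < gdeg c)%N -> gdiff F i a c = 0),
      exists v : 'rV[S]_(grank F 0), J (1 - (v *m gaug F) 0 0),
      forall v : 'rV[S]_(grank F 0),
        J ((v *m gaug F) 0 0) <-> exists w, v = w *m gdiff F 0
    & forall i (v : 'rV[S]_(grank F i.+1)),
        v *m gdiff F i = 0 <-> exists w, v = w *m gdiff F i.+1].

(* K = S / (z_1, ..., z_N), so F_i \otimes K = K^(grank i), with the
   differential given by the constant coefficients. *)
Definition tensor_diff (F : graded_free_complex) (i : nat) :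
    'M[K]_(grank F i.+1, grank F i) :=
  map_mx (mcoeff 0%MM) (gdiff F i).

(* The row spaces of the following matrices are the degree j parts of
   F_i \otimes K, of its cycles and of its boundaries. *)
Definition tensor_comp (F : graded_free_complex) (i j : nat) :
    'M[K]_(grank F i) :=
  diag_mx (\row_a (gdeg a == j)%:R).

Definition tensor_cycles (F : graded_free_complex) (i j : nat) :
    'M[K]_(grank F i) :=
  match i return 'M[K]_(grank F i) with
  | 0 => tensor_comp F 0 j
  | i'.+1 => (tensor_comp F i'.+1 j :&: kermx (tensor_diff F i'))%MS
  end.

Definition tensor_boundaries (F : graded_free_complex) (i j : nat) :
    'M[K]_(grank F i.+1, grank F i) :=
  tensor_comp F i.+1 j *m tensor_diff F i.

Definition tor_dim (F : graded_free_complex) (i j : nat) : nat :=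
  (\rank (tensor_cycles F i j) - \rank (tensor_boundaries F i j))%N.

(* beta i j = dim_K Tor_i^S(S / J, K)_j; as usual, Tor is computed from some
   graded free resolution of S / J, and does not depend on which. *)
Definition graded_betti (J : S -> Prop) (beta : nat -> nat -> nat) : Prop :=
  exists2 F, graded_free_resolution J F & forall i j, beta i j = tor_dim F i j.

(* r = max {j - i : beta i j != 0}; this maximum is nonnegative for J proper,
   since then beta 0 0 = 1. *)
Definition regularity (J : S -> Prop) (r : nat) : Prop :=
  exists beta : nat -> nat -> nat,
    [/\ graded_betti J beta,
        exists i, beta i (i + r)%N != 0%N
      & forall i j, beta i j != 0%N -> (j <= i + r)%N].

End GradedInvariants.

(* Main.v *)
(* The graph consists of k disjoint copies of three K_4's sharing a vertex. For
   such a vertex v the ideal J satisfies J : x_v = (J with the block of v made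
   complete), and (J + x_v) : y_v kills all the x of the block, while
   J + (x_v, y_v) leaves three disjoint triangles. Iterating these exact
   sequences over the blocks, until all components are cliques and the ideals
   are prime toric ideals, gives a resolution with regularity at most 3k and the
   Hilbert series (1 + 8t + 18t^2)^k / (1 - t)^(12k), so that deg h = 2k.
   The bound 3k is attained: restricted to one edge in each triangle, J becomes
   a complete intersection of 3k quadrics, whose last Koszul syzygy, in degrees
   (3k, 6k), survives in every resolution of S / J. *)

(* Three cliques on b + 1 vertices sharing a vertex have, over a common denominator, the numerator
   (1 + (b - 1) t)^3 + t (1 - t)^2 + t (1 - t) (1 + 3 b t). Its cubic coefficient is b^2 (b - 3),
   which is why copies of K_4 are taken: the degree drops to 2 while the three cliques still
   contribute 3 to the regularity. Instead of long exact sequences of Tor, explicit and possibly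
   non-minimal resolutions are built: for 0 -> (S/(I : f))(-e) -> S/I -> S/(I + (f)) -> 0, each term
   is resolved from the other two. All copies live in one ring from the start, so no tensor product
   of resolutions is formed. Each such sequence needs the colon ideal exactly. Among cliques it
   follows from primality; while other blocks are still cones the ideals are not prime, and the
   regularity of the centre variables has to be carried through the induction. The Krull dimension
   is bounded above by counting: a long chain of primes would produce more independent elements of
   bounded degree than the Hilbert function allows. An explicit chain attains the bound. *)
Require Import Defs.
From HB Require Import structures.
From mathcomp Require Import all_boot all_order all_algebra.
From mathcomp Require Import mpoly ring zify.
From Stdlib Require Import Classical.

Set Implicit Arguments.
Unset Strict Implicit.
Unset Printing Implicit Defensive.

Import GRing.Theory.
Local Open Scope ring_scope.

(** * Graded ideals and colons *)

Section GradedIdeals.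

Variables (K : fieldType) (N : nat).
Local Notation S := {mpoly K[N]}.
Implicit Types (p q f : S) (I J : S -> Prop).

(** The condition on a matrix entry of a degree 0 map from S(-a) to S(-b): a form of degree a - b,
    and 0 if a < b. Writing it as an addition avoids truncated subtraction, so composition and
    shifts need no side conditions. *)
Definition shift_homog (a b : nat) p : bool :=
  all (fun m => mdeg m + b == a)%N (msupp p).

Lemma shift_homogP a b p :
  reflect (forall m, m \in msupp p -> (mdeg m + b = a)%N) (shift_homog a b p).
Proof. by apply: (iffP allP) => h m /h /eqP. Qed.

Definition shift_proj (a b : nat) p : S :=
  if (b <= a)%N then pihomog mdeg (a - b) p else 0.

Lemma shift_homog0 a b : shift_homog a b 0.
Proof. by rewrite /shift_homog msupp0. Qed.

Lemma shift_homogD a b p q :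
  shift_homog a b p -> shift_homog a b q -> shift_homog a b (p + q).
Proof.
move=> /shift_homogP hp /shift_homogP hq; apply/shift_homogP => m /msuppD_le.
by rewrite mem_cat => /orP[/hp|/hq].
Qed.

Lemma shift_homogN a b p : shift_homog a b p -> shift_homog a b (- p).
Proof. by rewrite /shift_homog (perm_all _ (msuppN p)). Qed.

Lemma shift_homogB a b p q :
  shift_homog a b p -> shift_homog a b q -> shift_homog a b (p - q).
Proof. by move=> hp hq; apply: shift_homogD => //; apply: shift_homogN. Qed.

Lemma shift_homog_sum (T : Type) (r : seq T) (P : pred T) (F : T -> S) a b :
  (forall i, P i -> shift_homog a b (F i)) ->
  shift_homog a b (\sum_(i <- r | P i) F i).
Proof.
move=> h; elim/big_ind: _ => //; first exact: shift_homog0.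
by move=> x y; apply: shift_homogD.
Qed.

Lemma shift_homogM a b c p q :
  shift_homog a b p -> shift_homog b c q -> shift_homog a c (p * q).
Proof.
move=> /shift_homogP hp /shift_homogP hq; apply/shift_homogP => m /msuppM_le /allpairsP[[m1 m2] /= [/hp <- /hq <- ->]].
by rewrite mdegD addnA.
Qed.

Lemma shift_homog_add a b c p :
  shift_homog a b p -> shift_homog (a + c) (b + c) p.
Proof.
by move=> /shift_homogP hp; apply/shift_homogP => m /hp <-; rewrite addnA.
Qed.

Lemma shift_homog1 a : shift_homog a a 1.
Proof. by rewrite /shift_homog msupp1 /= mdeg0 eqxx. Qed.

Lemma shift_homogX a b i : a = b.+1 -> shift_homog a b 'X_i.
Proof. by move=> ->; rewrite /shift_homog msuppX /= mdeg1 eqxx. Qed.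

Lemma mcoeff_pihomog d p m :
  (pihomog mdeg d p)@_m = if mdeg m == d then p@_m else 0.
Proof.
rewrite pihomogE raddf_sum /=; case: ifP => hm.
  rewrite [in RHS](mpolyE p) raddf_sum /= [RHS](bigID (fun k => mdeg k == d)) /=.
  rewrite [X in _ = _ + X]big1 ?addr0 // => k hk.
  rewrite mcoeffZ mcoeffX; case: eqP => [ek|]; last by rewrite mulr0.
  by rewrite ek hm in hk.
rewrite big1 // => k hk; rewrite mcoeffZ mcoeffX; case: eqP => [ek|].
  by rewrite -ek hk in hm.
by rewrite mulr0.
Qed.

Lemma mcoeff_shift_proj a b p m :
  (shift_proj a b p)@_m = if (mdeg m + b == a)%N then p@_m else 0.
Proof.
rewrite /shift_proj; case: leqP => h.
  by rewrite mcoeff_pihomog; congr (if _ then _ else _); lia.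
by rewrite mcoeff0 ifF //; lia.
Qed.

Lemma shift_projP a b p : shift_homog a b (shift_proj a b p).
Proof.
apply/shift_homogP => m; rewrite mcoeff_msupp mcoeff_shift_proj.
by case: ifP => [/eqP|]; rewrite ?eqxx.
Qed.

Lemma shift_proj_id a b p : shift_homog a b p -> shift_proj a b p = p.
Proof.
move=> /shift_homogP hp; apply/mpolyP => m; rewrite mcoeff_shift_proj.
case: eqP => // ne; apply/esym/eqP; rewrite mcoeff_eq0.
by apply/negP => /hp.
Qed.

Lemma shift_proj_add a b c p : shift_proj (a + c) (b + c) p = shift_proj a b p.
Proof.
by apply/mpolyP => m; rewrite !mcoeff_shift_proj addnA eqn_add2r.
Qed.

(** Because taking a graded component commutes with multiplication by a form, any solution of a
    linear system with homogeneous data can be replaced by a homogeneous one. All degree bookkeeping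
    for lifts rests on this. *)
Lemma shift_projM a b c p q : shift_homog b c q ->
  shift_proj a c (p * q) = shift_proj a b p * q.
Proof.
move=> /shift_homogP hq; apply/mpolyP => m.
rewrite mcoeff_shift_proj !mcoeffM.
have key (k1 k2 : 'X_{1..N}) : m = (k1 + k2)%MM -> q@_k2 != 0 ->
    (mdeg m + c == a)%N = (mdeg k1 + b == a)%N.
  move=> -> nz; have /hq <- : k2 \in msupp q by rewrite mcoeff_msupp.
  by rewrite mdegD addnA.
case: ifP => hm.
  apply: eq_bigr => k /eqP ek; rewrite mcoeff_shift_proj.
  have [->|nz] := eqVneq q@_(val k.2) 0; first by rewrite !mulr0.
  by rewrite -(key _ _ ek nz) hm.
rewrite big1 // => k /eqP ek; rewrite mcoeff_shift_proj.
have [->|nz] := eqVneq q@_(val k.2) 0; first by rewrite !mulr0.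
by rewrite -(key _ _ ek nz) hm mul0r.
Qed.

Lemma shift_proj_is_zmod a b : {morph shift_proj a b : p q / p - q}.
Proof.
move=> p q; apply/mpolyP => m; rewrite mcoeffB !mcoeff_shift_proj.
by case: ifP; rewrite ?mcoeffB ?subr0.
Qed.

HB.instance Definition _ a b := GRing.isZmodMorphism.Build S S (shift_proj a b)
  (@shift_proj_is_zmod a b).

Lemma shift_homog_const a b p : a = b -> shift_homog a b p -> p = (p@_0%MM)%:MP.
Proof.
move=> eab /shift_homogP hp; apply/mpolyP => m; rewrite mcoeffC.
have [->|ne] := eqVneq m 0%MM; first by rewrite mulr1.
rewrite mulr0; apply/eqP; rewrite mcoeff_eq0; apply/negP => /hp h.
by move: ne; rewrite -mdeg_eq0; move: h; set u := mdeg _ => h; lia.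
Qed.

Lemma shift_homog_neq0 a b p : shift_homog a b p -> p@_0%MM != 0 -> a = b.
Proof.
by move=> /shift_homogP hp nz; rewrite -(hp 0%MM) ?mdeg0 // mcoeff_msupp.
Qed.

Lemma shift_homogC a c : shift_homog a a (c%:MP).
Proof.
by rewrite /shift_homog msuppC; case: ifP => //= _; rewrite mdeg0 eqxx.
Qed.

Definition homog_ideal I : Prop :=
  [/\ I 0, forall a p q, I p -> I q -> I (a * p + q)
    & forall a b p, I p -> I (shift_proj a b p)].

Section HomogIdeal.
Variable I : S -> Prop.
Hypothesis hI : homog_ideal I.

Lemma ideal0 : I 0. Proof. by case: hI. Qed.

Lemma idealMl a p : I p -> I (a * p).
Proof. by case: hI => h0 h _ hp; rewrite -[_ * _]addr0; apply: h. Qed.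

Lemma idealMr a p : I p -> I (p * a).
Proof. by rewrite mulrC; apply: idealMl. Qed.

Lemma idealD p q : I p -> I q -> I (p + q).
Proof. by case: hI => h0 h _ hp hq; rewrite -[p]mul1r; apply: h. Qed.

Lemma idealN p : I p -> I (- p).
Proof. by move=> hp; rewrite -mulN1r; apply: idealMl. Qed.

Lemma idealB p q : I p -> I q -> I (p - q).
Proof. by move=> hp hq; apply: idealD => //; apply: idealN. Qed.

Lemma idealZ c p : I p -> I (c *: p).
Proof. by move=> hp; rewrite -mul_mpolyC; apply: idealMl. Qed.

Lemma ideal_sum (T : Type) (r : seq T) (P : pred T) (F : T -> S) :
  (forall i, P i -> I (F i)) -> I (\sum_(i <- r | P i) F i).
Proof.
move=> h; elim/big_ind: _ => //; first exact: ideal0.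
by move=> x y; apply: idealD.
Qed.

Lemma ideal_proj a b p : I p -> I (shift_proj a b p).
Proof. by case: hI => _ _; apply. Qed.

Lemma idealBl p q : I q -> I (p - q) -> I p.
Proof. by move=> hq /(idealD hq); rewrite addrC subrK. Qed.

Lemma ideal_const c : ~ I 1 -> I c%:MP -> c = 0.
Proof.
move=> h1 hc; apply/eqP; apply/negP => /negP nz; case: h1.
have -> : 1 = (c^-1)%:MP * c%:MP :> S by rewrite -mpolyCM mulVf.
exact: idealMl.
Qed.

End HomogIdeal.

Definition ideal_add I f : S -> Prop := fun p => exists q, I (p - q * f).

(** With f of degree e this encodes the exact sequence 0 -> (S/J)(-e) -> S/I -> S/(I + (f)) -> 0,
    the only kind of exact sequence used below. As a relation it lets J be given by its own
    generators. *)
Definition is_colon I f J : Prop := forall p, J p <-> I (p * f).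

Lemma homog_ideal_add I f e : homog_ideal I -> shift_homog e 0 f ->
  homog_ideal (ideal_add I f).
Proof.
move=> hI hf; split.
- by exists 0; rewrite mul0r subr0; apply: ideal0.
- move=> a p q [p' hp] [q' hq]; exists (a * p' + q').
  have -> : a * p + q - (a * p' + q') * f = a * (p - p' * f) + (q - q' * f) by ring.
  by apply: idealD => //; apply: idealMl.
- move=> a b p [q hq]; exists (shift_proj a (e + b) q).
  rewrite -(@shift_projM a (e + b) b); last first.
    by rewrite -{2}[b]add0n; apply: shift_homog_add.
  by rewrite -raddfB; apply: ideal_proj.
Qed.

Lemma homog_ideal_colon I f e J : homog_ideal I -> shift_homog e 0 f ->
  is_colon I f J -> homog_ideal J.
Proof.
move=> hI hf hJ; split.
- by apply/hJ; rewrite mul0r; apply: ideal0.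
- move=> a p q /hJ hp /hJ hq; apply/hJ.
  by rewrite mulrDl -mulrA; apply: idealD => //; apply: idealMl.
- move=> a b p /hJ hp; apply/hJ; rewrite -(shift_proj_add a b e) -(@shift_projM _ _ b).
  + exact: ideal_proj.
  + by rewrite addnC; apply: (shift_homog_add b hf).
Qed.

End GradedIdeals.

(** * Graded resolutions and lifting of chain maps *)

Section Resolutions.

Variables (K : fieldType) (N : nat).
Local Notation S := {mpoly K[N]}.
Implicit Types (p q f : S) (I J : S -> Prop).

(* All terms of a finite complex of free modules are collected in one module,
   with basis 'I_n: basis vector [a] has homological degree [hd a] and internal
   degree [gd a], and D is the total differential. *)
Record graded_res n (hd gd : 'I_n -> nat) (D : 'M[S]_n) (g : 'cV[S]_n) I :
    Prop := GradedRes {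
  res_hd : forall a b, D a b != 0 -> hd a = (hd b).+1;
  res_gd : forall a b, shift_homog (gd a) (gd b) (D a b);
  res_hd0 : forall a, g a 0 != 0 -> hd a = 0%N;
  res_gd0 : forall a, shift_homog (gd a) 0 (g a 0);
  res_gen : exists v : 'rV[S]_n, I (1 - (v *m g) 0 0);
  res_exact : forall v : 'rV[S]_n,
    (v *m D = 0 /\ I ((v *m g) 0 0)) <-> exists w, v = w *m D
}.

Lemma mul_row_delta n m (i : 'I_n) (A : 'M[S]_(n, m)) :
  delta_mx (0 : 'I_1) i *m A = row i A.
Proof. by rewrite rowE. Qed.

Lemma res_DD n (hd gd : 'I_n -> nat) D g I :
  graded_res hd gd D g I -> D *m D = 0.
Proof.
move=> r; apply/row_matrixP => i; rewrite row0 row_mul.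
have [_] := res_exact r (row i D).
by case=> //; exists (delta_mx 0 i); rewrite mul_row_delta.
Qed.

Lemma res_Dg n (hd gd : 'I_n -> nat) D g I (w : 'rV[S]_n) :
  graded_res hd gd D g I -> I ((w *m D *m g) 0 0).
Proof. by move=> r; have [_] := res_exact r (w *m D); case=> //; exists w. Qed.

Lemma graded_res_ext n (hd gd : 'I_n -> nat) D g I J :
  (forall p, I p <-> J p) -> graded_res hd gd D g I -> graded_res hd gd D g J.
Proof.
move=> e [h1 h2 h3 h4 [v h5] h6]; split=> //; first by exists v; apply/e.
by move=> w; split=> [[a /e b]|/h6 [a /e b]] //; apply/h6.
Qed.

Section Lift.

Variables (n : nat) (hd gd : 'I_n -> nat) (D : 'M[S]_n) (g : 'cV[S]_n).
Variables (I : S -> Prop) (e : nat).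
Hypotheses (hI : homog_ideal I) (res : graded_res hd gd D g I).

Definition row_proj (d h : nat) (v : 'rV[S]_n) : 'rV[S]_n :=
  \row_b (if hd b == h then shift_proj d (gd b + e) (v 0 b) else 0).

Lemma row_proj_homog d h v b : shift_homog d (gd b + e) (row_proj d h v 0 b).
Proof.
by rewrite mxE; case: ifP => _; [apply: shift_projP | apply: shift_homog0].
Qed.

Lemma row_proj_hd d h v b : row_proj d h v 0 b != 0 -> hd b = h.
Proof. by rewrite mxE; case: ifP => [/eqP //|]; rewrite eqxx. Qed.

(** Exactness gives some preimage [w]; since [D] is homogeneous for both degrees, projecting [w] to
    homological degree [h.+1] and internal degree [d] keeps it a preimage. *)
Lemma lift_boundary d h (u : 'rV[S]_n) :
  (forall b, shift_homog d (gd b + e) (u 0 b)) ->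
  (forall b, u 0 b != 0 -> hd b = h) ->
  u *m D = 0 -> I ((u *m g) 0 0) ->
  exists w : 'rV[S]_n, [/\ forall b, shift_homog d (gd b + e) (w 0 b),
    forall b, w 0 b != 0 -> hd b = h.+1 & w *m D = u].
Proof.
move=> hu su uD ug; have [+ _] := res_exact res u.
case=> // w ew; exists (row_proj d h.+1 w).
split; [exact: row_proj_homog | exact: row_proj_hd |].
apply/rowP => c; rewrite [in RHS]ew !mxE.
have [hc|hc] := eqVneq (hd c) h; last first.
  have u0 : u 0 c = 0 by apply/eqP; apply: contraNT hc => /su ->.
  move: u0; rewrite ew mxE => ->; rewrite big1 // => b _; rewrite mxE.
  case: eqP => [eb|]; last by rewrite mul0r.
  have [->|nz] := eqVneq (D b c) 0; first by rewrite mulr0.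
  by move: hc; rewrite -eqSS -(res_hd res nz) eb eqxx.
have := shift_proj_id (hu c); rewrite {1 2}ew mxE => <-.
rewrite raddf_sum /=; apply: eq_bigr => b _.
rewrite (shift_projM _ _ (shift_homog_add e (res_gd res b c))) mxE.
have [->|nz] := eqVneq (D b c) 0; first by rewrite !mulr0.
by rewrite (res_hd res nz) hc eqxx.
Qed.

Lemma lift_generator d p : shift_homog d e p ->
  exists w : 'rV[S]_n, [/\ forall b, shift_homog d (gd b + e) (w 0 b),
    forall b, w 0 b != 0 -> hd b = 0%N & I ((w *m g) 0 0 - p)].
Proof.
move=> hp; have [v hv] := res_gen res; exists (row_proj d 0 (p *: v)).
split; [exact: row_proj_homog | exact: row_proj_hd |].
have -> : (row_proj d 0 (p *: v) *m g) 0 0 =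
    shift_proj d e ((p *: v *m g) 0 0).
  rewrite !mxE raddf_sum /=; apply: eq_bigr => b _.
  rewrite -{1}[e]add0n (shift_projM _ _ (shift_homog_add e (res_gd0 res b))) mxE.
  have [->|nz] := eqVneq (g b 0) 0; first by rewrite !mulr0.
  by rewrite (res_hd0 res nz) eqxx.
rewrite -[X in _ - X](shift_proj_id hp) -raddfB; apply: ideal_proj => //.
rewrite -scalemxAl mxE -[X in _ - X]mulr1 -mulrBr; apply: idealMl => //.
by rewrite -opprB; apply: idealN.
Qed.

Variables (m : nat) (hx gx : 'I_m -> nat) (X : 'M[S]_m) (c : 'cV[S]_m).
Variable h0 : nat.
Hypotheses (X_hd : forall a b, X a b != 0 -> hx a = (hx b).+1)
  (X_gd : forall a b, shift_homog (gx a) (gx b) (X a b))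
  (XX : X *m X = 0)
  (c_hd : forall a, c a 0 != 0 -> hx a = h0)
  (c_gd : forall a, shift_homog (gx a) e (c a 0))
  (Xc : forall a, I ((X *m c) a 0)).

(** The comparison theorem: rows of [M] are built by induction on homological degree. The complex
    [X] need not be exact. The offset [h0] is 0 for comparison maps and 1 for the connecting map of
    the horseshoe lemma; [e] is the internal twist. *)
Lemma lift_chain_map : exists M : 'M[S]_(m, n),
  [/\ forall a b, M a b != 0 -> hx a = (hd b + h0)%N,
      forall a b, shift_homog (gx a) (gd b + e) (M a b),
      M *m D = X *m M
    & forall a, I ((M *m g) a 0 - c a 0)].
Proof.
suff key k : exists M : 'M[S]_(m, n),
    [/\ forall a b, M a b != 0 -> hx a = (hd b + h0)%N,
      forall a b, shift_homog (gx a) (gd b + e) (M a b),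
      forall a, (hx a < k)%N -> row a (M *m D) = row a (X *m M)
    & forall a, (hx a < k)%N -> I ((M *m g) a 0 - c a 0)].
  have [M [h1 h2 h3 h4]] := key (\max_a hx a).+1.
  have lt a : (hx a < (\max_a hx a).+1)%N by rewrite ltnS; apply: leq_bigmax.
  by exists M; split=> // [|a]; [apply/row_matrixP => a; apply: h3 | apply: h4].
elim: k => [|k [M [M1 M2 M3 M4]]].
  exists 0; split=> // a b; first by rewrite mxE eqxx.
  by rewrite mxE; apply: shift_homog0.
have XM0 a : (hx a <= h0)%N -> row a (X *m M) = 0.
  move=> ha; apply/rowP => j; rewrite !mxE big1 // => b _.
  have [->|nz] := eqVneq (X a b) 0; first by rewrite mul0r.
  have [->|nz'] := eqVneq (M b j) 0; first by rewrite mulr0.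
  by move: ha; rewrite (X_hd nz) (M1 _ _ nz'); lia.
have prevk a (A B : 'M[S]_(m, n)) : (hx a <= k)%N ->
    (forall b, (hx b < k)%N -> row b A = row b B) ->
    row a (X *m A) = row a (X *m B).
  move=> ha eAB; apply/rowP => j; rewrite !mxE; apply: eq_bigr => b _.
  have [->|nz] := eqVneq (X a b) 0; first by rewrite !mul0r.
  have /eAB/rowP/(_ j) : (hx b < k)%N by move: ha; rewrite (X_hd nz).
  by rewrite !mxE => ->.
have rowex a : exists w : 'rV[S]_n,
  [/\ forall b, w 0 b != 0 -> hx a = (hd b + h0)%N,
      forall b, shift_homog (gx a) (gd b + e) (w 0 b),
      hx a = k -> w *m D = row a (X *m M) /\ I ((w *m g) 0 0 - c a 0)
    & hx a != k -> w = row a M].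
  have [hak|hak] := eqVneq (hx a) k; last first.
    exists (row a M); split=> [b|b|ha|//]; rewrite ?mxE; [exact: M1|exact: M2|].
    by rewrite ha eqxx in hak.
  (* Below degree [h0] the rows are zero, in degree [h0] they lift [c] through the augmentation [g],
     and above it they come from exactness. *)
  have [lt|gt|eq] := ltngtP k h0.
  - exists 0; split=> [b|b|_|].
    + by rewrite mxE eqxx.
    + by rewrite mxE; apply: shift_homog0.
    + rewrite !mul0mx XM0 ?hak ?(ltnW lt) //; split=> //.
      suff -> : c a 0 = 0 by rewrite mxE subr0; apply: ideal0.
      by apply/eqP; apply: contraTT lt => /c_hd; rewrite hak => ->; rewrite ltnn.
    + by [].
  - have uI : I ((row a (X *m M) *m g) 0 0).
      rewrite -row_mul -mulmxA mxE.
      have -> : (X *m (M *m g)) a 0 = (X *m (M *m g - c)) a 0 + (X *m c) a 0.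
        by rewrite mulmxBr !mxE subrK.
      apply: idealD => //; rewrite mxE; apply: ideal_sum => // b _.
      have [->|nz] := eqVneq (X a b) 0; first by rewrite mul0r; apply: ideal0.
      apply: idealMl => //; rewrite mxE [X in _ + X]mxE; apply: M4.
      by rewrite -hak (X_hd nz).
    have [] := @lift_boundary (gx a) (k - h0.+1) (row a (X *m M)) _ _ _ uI.
    + move=> b; rewrite !mxE; apply: shift_homog_sum => i _.
      exact: shift_homogM (X_gd _ _) (M2 _ _).
    + move=> b; rewrite !mxE => nz.
      have /existsP[i] : [exists i, X a i * M i b != 0].
        apply: contraNT nz; rewrite negb_exists => /forallP h.
        by rewrite big1 // => i _; apply/eqP; rewrite -[_ == _]negbK.
      rewrite mulf_eq0 negb_or => /andP[/X_hd + /M1].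
      by rewrite hak => -> ->; lia.
    + rewrite -row_mul -mulmxA (prevk a _ (X *m M)) ?hak //.
      by rewrite mulmxA XX mul0mx row0.
    + move=> w [w1 w2 w3]; exists w; split=> //.
      * by move=> b /w2 ->; rewrite hak; lia.
      * move=> _; split=> //.
        have -> : c a 0 = 0.
          by apply/eqP; apply: contraTT gt => /c_hd; rewrite hak => ->; rewrite ltnn.
        rewrite subr0 mxE big1; first exact: ideal0.
        move=> b _; have [->|/w2 hb] := eqVneq (w 0 b) 0; first by rewrite mul0r.
        have [->|/(res_hd0 res)] := eqVneq (g b 0) 0; first by rewrite mulr0.
        by rewrite hb.
  - have [w [w1 w2 w3]] := lift_generator (c_gd a).
    exists w; split=> //.
    + by move=> b /w2 ->; rewrite hak eq.
    + move=> _; split=> //; rewrite XM0 ?hak ?eq //.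
      apply/rowP => j; rewrite !mxE big1 // => b _.
      have [->|/w2 hb] := eqVneq (w 0 b) 0; first by rewrite mul0r.
      have [->|/(res_hd res)] := eqVneq (D b j) 0; first by rewrite mulr0.
      by rewrite hb.
have [W hW] := fin_all_exists rowex.
have rowW a : row a (\matrix_(i, j) W i 0 j) = W a.
  by apply/rowP => j; rewrite !mxE.
have rowM b : (hx b < k)%N -> row b (\matrix_(i, j) W i 0 j) = row b M.
  move=> hb; rewrite rowW; have [_ _ _ ->] := hW b; rewrite //.
  by move: hb; rewrite ltn_neqAle => /andP[].
exists (\matrix_(i, j) W i 0 j); split=> [a b|a b|a ha|a ha].
- by rewrite mxE; have [h _ _ _] := hW a; apply: h.
- by rewrite mxE; have [_ h _ _] := hW a; apply: h.
- rewrite (prevk a _ M) // row_mul rowW; have [_ _ h h'] := hW a.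
  have [/h[-> //]|ne] := eqVneq (hx a) k.
  by rewrite h' // -row_mul M3 //; move: ha; rewrite ltnS leq_eqVlt (negbTE ne).
- have -> : (\matrix_(i, j) W i 0 j *m g) a 0 = (W a *m g) 0 0.
    by rewrite -[in RHS]rowW -row_mul [RHS]mxE.
  have [_ _ h h'] := hW a.
  have [/h[//]|ne] := eqVneq (hx a) k.
  rewrite h' // -row_mul mxE; apply: M4.
  by move: ha; rewrite ltnS leq_eqVlt (negbTE ne).
Qed.

End Lift.

End Resolutions.

(** * Mapping cones and the horseshoe lemma *)

Section TwoOutOfThree.

Variables (K : fieldType) (N : nat).
Local Notation S := {mpoly K[N]}.
Implicit Types (p q f : S) (I J : S -> Prop).

Lemma mxDE m n (A B : 'M[S]_(m, n)) i j : (A + B) i j = A i j + B i j.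
Proof. by rewrite mxE. Qed.

Lemma mxNE m n (A : 'M[S]_(m, n)) i j : (- A) i j = - A i j.
Proof. by rewrite mxE. Qed.

Lemma mxBE m n (A B : 'M[S]_(m, n)) i j : (A - B) i j = A i j - B i j.
Proof. by rewrite mxDE mxNE. Qed.

Lemma mxZE m n p (A : 'M[S]_(m, n)) i j : (p *: A) i j = p * A i j.
Proof. by rewrite mxE. Qed.

Definition join n1 n2 (A : Type) (f1 : 'I_n1 -> A) (f2 : 'I_n2 -> A)
    (i : 'I_(n1 + n2)) : A :=
  match split i with inl a => f1 a | inr b => f2 b end.

Lemma join_l n1 n2 (A : Type) (f1 : 'I_n1 -> A) (f2 : 'I_n2 -> A) i :
  join f1 f2 (lshift n2 i) = f1 i.
Proof. by rewrite /join (unsplitK (inl i)). Qed.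

Lemma join_r n1 n2 (A : Type) (f1 : 'I_n1 -> A) (f2 : 'I_n2 -> A) i :
  join f1 f2 (rshift n1 i) = f2 i.
Proof. by rewrite /join (unsplitK (inr i)). Qed.

Definition joinE := (join_l, join_r).
Definition blockE := (block_mxEul, block_mxEur, block_mxEdl, block_mxEdr,
  col_mxEu, col_mxEd).

(** All terms of the complex share one module, so a vector generating S/I is first cut down to
    homological degree 0, where [D] vanishes and [g] loses nothing. *)
Lemma res_generator0 n (hd gd : 'I_n -> nat) (D : 'M[S]_n) g I q :
  homog_ideal I -> graded_res hd gd D g I ->
  exists w : 'rV[S]_n, w *m D = 0 /\ I ((w *m g) 0 0 - q).
Proof.
move=> hI r; have [v hv] := res_gen r.
exists (\row_b (if hd b == 0%N then q * v 0 b else 0)); split.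
  apply/rowP => c; rewrite !mxE big1 // => b _; rewrite mxE.
  case: eqP => [hb|]; last by rewrite mul0r.
  have [->|/(res_hd r)] := eqVneq (D b c) 0; first by rewrite mulr0.
  by rewrite hb.
have -> : (\row_b (if hd b == 0%N then q * v 0 b else 0) *m g) 0 0 =
    q * (v *m g) 0 0.
  rewrite !mxE mulr_sumr; apply: eq_bigr => b _; rewrite mxE.
  have [->|/(res_hd0 r) ->] := eqVneq (g b 0) 0; first by rewrite !mulr0.
  by rewrite eqxx mulrA.
rewrite -{2}[q]mulr1 -mulrBr -opprB mulrN; apply/(idealN hI)/(idealMl hI).
exact: hv.
Qed.

Section Cone.

Variables (n1 n2 : nat).
Variables (hd1 gd1 : 'I_n1 -> nat) (D1 : 'M[S]_n1) (g1 : 'cV[S]_n1).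
Variables (hd2 gd2 : 'I_n2 -> nat) (D2 : 'M[S]_n2) (g2 : 'cV[S]_n2).
Variables (I J : S -> Prop) (f : S) (e : nat).
Hypotheses (hI : homog_ideal I) (hf : shift_homog e 0 f) (hJ : is_colon I f J).

Let hJI : homog_ideal J := homog_ideal_colon hI hf hJ.

(** The mapping cone of a lift of multiplication by f from S/J to S/I. The map [M] is an argument
    because [matching_strand] needs the choice f times the identity, for which iterated cones form a
    Koszul complex. *)
Lemma cone_res_map (M : 'M[S]_(n2, n1)) :
  graded_res hd1 gd1 D1 g1 I -> graded_res hd2 gd2 D2 g2 J ->
  (forall a b, M a b != 0 -> hd2 a = hd1 b) ->
  (forall a b, shift_homog (gd2 a + e) (gd1 b) (M a b)) ->
  M *m D1 = D2 *m M ->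
  (forall a, I ((M *m g1) a 0 - (f *: g2) a 0)) ->
  graded_res (join hd1 (fun b => (hd2 b).+1)) (join gd1 (fun b => gd2 b + e)%N)
    (block_mx D1 0 M (- D2)) (col_mx g1 0) (ideal_add I f).
Proof.
move=> r1 r2 M1 M2 M3 M4.
have Mg (w : 'rV[S]_n2) : I ((w *m M *m g1) 0 0 - (w *m g2) 0 0 * f).
  have -> : (w *m M *m g1) 0 0 - (w *m g2) 0 0 * f =
      (w *m (M *m g1 - f *: g2)) 0 0.
    by rewrite mulmxBr -scalemxAr mulmxA mxBE mxZE [f * _]mulrC.
  rewrite mxE; apply: ideal_sum => // a _; apply: idealMl => //.
  by have := M4 a; rewrite -mxBE.
split.
- move=> a b; case: (split_ordP a) => a' ->; case: (split_ordP b) => b' ->;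
    rewrite !joinE !blockE.
  + exact: (res_hd r1).
  + by rewrite mxE eqxx.
  + by move=> /M1 ->.
  + by rewrite mxE oppr_eq0 => /(res_hd r2) ->.
- move=> a b; case: (split_ordP a) => a' ->; case: (split_ordP b) => b' ->;
    rewrite !joinE !blockE.
  + exact: (res_gd r1).
  + by rewrite mxE; apply: shift_homog0.
  + exact: M2.
  + by rewrite mxE; apply/shift_homogN/shift_homog_add/(res_gd r2).
- move=> a; case: (split_ordP a) => a' ->; rewrite !joinE !blockE.
  + exact: (res_hd0 r1).
  + by rewrite mxE eqxx.
- move=> a; case: (split_ordP a) => a' ->; rewrite !joinE !blockE.
  + exact: (res_gd0 r1).
  + by rewrite mxE; apply: shift_homog0.
- have [v hv] := res_gen r1; exists (row_mx v 0), 0.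
  by rewrite mul_row_col mulmx0 addr0 mul0r subr0.
- move=> v; rewrite -[v]hsubmxK; set v1 := lsubmx v; set v2 := rsubmx v.
  rewrite mul_row_block mul_row_col !mulmx0 addr0 add0r mulmxN.
  split.
  + rewrite -[X in _ = X]row_mx0 => -[/eq_row_mx[e1 e2] [q hq]].
    move/eqP: e2; rewrite oppr_eq0 => /eqP e2.
    have e1' : v1 *m D1 = - (v2 *m M) by apply/eqP; rewrite -addr_eq0 e1.
    have [w2 hw2] : exists w, v2 = w *m D2.
      apply/(res_exact r2); split=> //; apply/hJ.
      have h := Mg v2; have h' := res_Dg v1 r1.
      rewrite e1' mulNmx mxNE in h'.
      by have := idealN hI (idealD hI h h'); congr I; ring.
    (* The preimage [w2] may be changed by a cycle. With [w0], the vector [w2'] gets augmentation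
       [q] modulo J, which puts [v1 - w2' *m M] in the kernel of the augmentation to S/I. *)
    have [w0 [w0D hw0]] := res_generator0 (q + (w2 *m g2) 0 0) hJI r2.
    pose w2' := w0 - w2.
    have ew2 : v2 = - (w2' *m D2) by rewrite mulmxBl w0D sub0r opprK.
    have [w1 hw1] : exists w, v1 - w2' *m M = w *m D1.
      apply/(res_exact r1); split.
        by rewrite mulmxBl e1' -mulmxA M3 mulmxA ew2 mulNmx opprK subrr.
      rewrite mulmxBl mxBE.
      have h := Mg w2'; move/hJ: hw0 => h0.
      have h1 : I ((w2' *m g2) 0 0 * f - q * f).
        have := h0; congr I; rewrite /w2' mulmxBl.
        rewrite mxBE; ring.
      have := idealB hI hq (idealD hI h h1); congr I.
      move: ((v1 *m g1) 0 0) ((w2' *m M *m g1) 0 0) ((w2' *m g2) 0 0) => x y z.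
      by ring.
    exists (row_mx w1 w2'); rewrite mul_row_block mulmx0 add0r mulmxN -ew2.
    by rewrite -hw1 subrK.
  + case=> w; rewrite -[w]hsubmxK; set w1 := lsubmx w; set w2 := rsubmx w.
    rewrite mul_row_block mulmx0 add0r mulmxN => /eq_row_mx[-> ->]; split.
      rewrite -row_mx0; congr row_mx.
        rewrite mulmxDl -!mulmxA (res_DD r1) mulmx0 add0r M3 mulNmx mulmxA.
        by rewrite subrr.
      by rewrite mulNmx opprK -mulmxA (res_DD r2) mulmx0.
    exists ((w2 *m g2) 0 0); rewrite mulmxDl mxDE -addrA.
    by apply: idealD => //; exact: (res_Dg w1 r1).
Qed.

Lemma cone_res :
  graded_res hd1 gd1 D1 g1 I -> graded_res hd2 gd2 D2 g2 J ->
  exists D g, graded_res (join hd1 (fun b => (hd2 b).+1))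
    (join gd1 (fun b => gd2 b + e)%N) D g (ideal_add I f).
Proof.
move=> r1 r2.
have [M [M1 M2 M3 M4]] : exists M : 'M[S]_(n2, n1),
  [/\ forall a b, M a b != 0 -> hd2 a = (hd1 b + 0)%N,
      forall a b, shift_homog (gd2 a + e) (gd1 b + 0) (M a b),
      M *m D1 = D2 *m M
    & forall a, I ((M *m g1) a 0 - (f *: g2) a 0)].
  apply: (lift_chain_map hI r1) => [a b|a b||a|a|a].
  - exact: (res_hd r2).
  - exact/shift_homog_add/(res_gd r2).
  - exact: res_DD r2.
  - rewrite mxE mulf_eq0 negb_or => /andP[_]; exact: (res_hd0 r2).
  - rewrite mxE mulrC; apply: (@shift_homogM _ _ _ e).
      exact: (shift_homog_add e (res_gd0 r2 a)).
    exact: hf.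
  - rewrite -scalemxAr mxE mulrC; apply/hJ.
    have := res_Dg (delta_mx 0 a) r2.
    by rewrite -mulmxA mul_row_delta mxE.
exists (block_mx D1 0 M (- D2)), (col_mx g1 0).
apply: cone_res_map => // a b; first by move/M1; rewrite addn0.
by have := M2 a b; rewrite addn0.
Qed.

End Cone.

Section Horseshoe.

Variables (n1 n2 : nat).
Variables (hd1 gd1 : 'I_n1 -> nat) (D1 : 'M[S]_n1) (g1 : 'cV[S]_n1).
Variables (hd2 gd2 : 'I_n2 -> nat) (D2 : 'M[S]_n2) (g2 : 'cV[S]_n2).
Variables (I J : S -> Prop) (f : S) (e : nat).
Hypotheses (hI : homog_ideal I) (hf : shift_homog e 0 f) (hJ : is_colon I f J).

Let hJI : homog_ideal J := homog_ideal_colon hI hf hJ.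

(** Since (I + (f))/I is isomorphic to (S/J)(-e), a column with values in I + (f) is f times a
    column with values in S/J. Projecting the quotients to the expected degree makes them
    homogeneous. *)
Lemma colon_coordinates n (hd gd : 'I_n -> nat) (c : 'cV[S]_n) h :
  (forall a, shift_homog (gd a) 0 (c a 0)) ->
  (forall a, c a 0 != 0 -> hd a = h) ->
  (forall a, ideal_add I f (c a 0)) ->
  exists q : 'cV[S]_n, [/\ forall a, shift_homog (gd a) e (q a 0),
    forall a, q a 0 != 0 -> hd a = h
    & forall w : 'rV[S]_n, I ((w *m c) 0 0 - (w *m q) 0 0 * f)].
Proof.
move=> cg ch cI.
have /fin_all_exists[q hq] a : exists q, [/\ shift_homog (gd a) e q,
    q != 0 -> hd a = h & I (c a 0 - q * f)].
  have [c0|nz] := eqVneq (c a 0) 0.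
    exists 0; split; [exact: shift_homog0 | by rewrite eqxx |].
    by rewrite mul0r subr0 c0; apply: ideal0.
  have [q hq] := cI a; exists (shift_proj (gd a) e q).
  split; [exact: shift_projP | by move=> _; apply: ch |].
  rewrite -(shift_projM _ _ hf) -(shift_proj_id (cg a)) -raddfB.
  exact: ideal_proj.
exists (\col_a q a); split=> [a|a|w].
- by rewrite mxE; have [h1 _ _] := hq a.
- by rewrite mxE; have [_ h1 _] := hq a.
- rewrite !mxE mulr_suml -sumrB; apply: ideal_sum => // a _.
  by rewrite mxE -mulrA -mulrBr; apply: idealMl => //; have [] := hq a.
Qed.

(** Boundaries [D2 *m g2] vanish only modulo I + (f), so modulo I they equal [q] times f. The column
    [q] is a cocycle with values in S/J, and its lift [M] of homological degree -1 is the
    off-diagonal block of the differential for the middle term. *)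
Lemma horseshoe_res :
  graded_res hd1 gd1 D1 g1 J -> graded_res hd2 gd2 D2 g2 (ideal_add I f) ->
  exists D g, graded_res (join hd1 hd2) (join (fun b => gd1 b + e)%N gd2) D g I.
Proof.
move=> r1 r2.
have Dg a : (D2 *m g2) a 0 = (delta_mx (0 : 'I_1) a *m D2 *m g2) 0 0.
  by rewrite -mulmxA mul_row_delta [RHS]mxE.
have [q [q1 q2 q3]] : exists q : 'cV[S]_n2,
    [/\ forall a, shift_homog (gd2 a) e (q a 0),
    forall a, q a 0 != 0 -> hd2 a = 1%N
    & forall w : 'rV[S]_n2, I ((w *m (D2 *m g2)) 0 0 - (w *m q) 0 0 * f)].
  apply: (@colon_coordinates _ _ gd2 (D2 *m g2) 1) => a.
  - rewrite mxE; apply: shift_homog_sum => b _.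
    exact: shift_homogM (res_gd r2 a b) (res_gd0 r2 b).
  - rewrite mxE; apply: contraNeq => ha; apply/eqP/big1 => b _.
    have [->|h1] := eqVneq (D2 a b) 0; first by rewrite mul0r.
    have [->|h2] := eqVneq (g2 b 0) 0; first by rewrite mulr0.
    by move: ha; rewrite (res_hd r2 h1) (res_hd0 r2 h2).
  - by rewrite Dg; apply: (res_Dg _ r2).
have [M [M1 M2 M3 M4]] : exists M : 'M[S]_(n2, n1),
  [/\ forall a b, M a b != 0 -> hd2 a = (hd1 b + 1)%N,
      forall a b, shift_homog (gd2 a) (gd1 b + e) (M a b),
      M *m D1 = (- D2) *m M
    & forall a, J ((M *m g1) a 0 - (- q) a 0)].
  apply: (lift_chain_map hJI r1) => [a b|a b||a|a|a].
  - by rewrite mxE oppr_eq0; apply: (res_hd r2).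
  - by rewrite mxE; apply/shift_homogN/(res_gd r2).
  - by rewrite mulNmx mulmxN opprK (res_DD r2).
  - by rewrite mxE oppr_eq0; apply: q2.
  - by rewrite mxE; apply: shift_homogN.
  - rewrite mulNmx mulmxN opprK; apply/hJ.
    have := q3 (row a D2); rewrite mulmxA -row_mul (res_DD r2) row0 mul0mx.
    rewrite -row_mul [X in _ - X * _]mxE [X in X - _]mxE sub0r => h.
    by have := idealN hI h; rewrite opprK.
have fZ (w : 'rV[S]_n1) : (w *m (f *: g1)) 0 0 = f * (w *m g1) 0 0.
  by rewrite -scalemxAr mxZE.
have Mg (w : 'rV[S]_n2) :
    I ((w *m M *m (f *: g1)) 0 0 + (w *m D2 *m g2) 0 0).
  have : J ((w *m M *m g1) 0 0 + (w *m q) 0 0).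
    have -> : (w *m M *m g1) 0 0 + (w *m q) 0 0 = (w *m (M *m g1 - - q)) 0 0.
      by rewrite opprK mulmxDr mulmxA mxDE.
    rewrite mxE; apply: ideal_sum => // a _; apply: idealMl => //.
    by have := M4 a; rewrite -mxBE.
  move=> /hJ h; have := idealD hI h (q3 w); congr I.
  rewrite -scalemxAr mxZE mulmxA; ring.
exists (block_mx D1 0 M D2), (col_mx (f *: g1) g2); split.
- move=> a b; case: (split_ordP a) => a' ->; case: (split_ordP b) => b' ->;
    rewrite !joinE !blockE.
  + exact: (res_hd r1).
  + by rewrite mxE eqxx.
  + by move=> /M1 ->; rewrite addn1.
  + exact: (res_hd r2).
- move=> a b; case: (split_ordP a) => a' ->; case: (split_ordP b) => b' ->;
    rewrite !joinE !blockE.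
  + exact/shift_homog_add/(res_gd r1).
  + by rewrite mxE; apply: shift_homog0.
  + exact: M2.
  + exact: (res_gd r2).
- move=> a; case: (split_ordP a) => a' ->; rewrite !joinE !blockE.
  + by rewrite mxE mulf_eq0 negb_or => /andP[_]; apply: (res_hd0 r1).
  + exact: (res_hd0 r2).
- move=> a; case: (split_ordP a) => a' ->; rewrite !joinE !blockE.
  + rewrite mxE mulrC; apply: (@shift_homogM _ _ _ e) => //.
    exact: (shift_homog_add e (res_gd0 r1 a')).
  + exact: (res_gd0 r2).
- have [v [p hp]] := res_gen r2.
  have [w [_ /hJ hw]] := res_generator0 p hJI r1.
  exists (row_mx w v); rewrite mul_row_col -scalemxAr mxDE mxZE.
  have := idealB hI hp hw; congr I; ring.
- move=> v; rewrite -[v]hsubmxK; set v1 := lsubmx v; set v2 := rsubmx v.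
  rewrite mul_row_block mul_row_col mulmx0 add0r.
  split.
  + rewrite -[X in _ = X]row_mx0 => -[/eq_row_mx[e1 e2] hv].
    rewrite mxDE in hv.
    have [w2 hw2] : exists w, v2 = w *m D2.
      apply/(res_exact r2); split=> //; exists (- (v1 *m g1) 0 0).
      move: hv; congr I; rewrite -scalemxAr mxZE; ring.
    have [w1 hw1] : exists w, v1 - w2 *m M = w *m D1.
      apply/(res_exact r1); split.
        by rewrite mulmxBl -mulmxA M3 mulNmx mulmxN opprK mulmxA -hw2.
      apply/hJ; have h := Mg w2; rewrite -hw2 in h.
      have := idealB hI hv h; congr I.
      rewrite !fZ mulmxBl mxBE.
      move: ((v1 *m g1) 0 0) ((v2 *m g2) 0 0) ((w2 *m M *m g1) 0 0) => x y z.
      by ring.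
    by exists (row_mx w1 w2); rewrite mul_row_block mulmx0 add0r -hw2 -hw1 subrK.
  + case=> w; rewrite -[w]hsubmxK; set w1 := lsubmx w; set w2 := rsubmx w.
    rewrite mul_row_block mulmx0 add0r => /eq_row_mx[-> ->]; split.
      rewrite -row_mx0; congr row_mx.
        rewrite mulmxDl -!mulmxA (res_DD r1) mulmx0 add0r M3 mulNmx mulmxN.
        by rewrite addNr.
      by rewrite -mulmxA (res_DD r2) mulmx0.
    rewrite mulmxDl -addrA !mxDE; apply: idealD => //.
    rewrite -scalemxAr mxZE mulrC; apply/hJ; exact: (res_Dg w1 r1).
Qed.

End Horseshoe.

End TwoOutOfThree.

(** * Minimal resolutions *)

Section Selection.

Variables (R : comNzRingType) (n : nat) (A : {set 'I_n}).

(** Restriction of a matrix to the rows or columns in A, and extension by zero, become products with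
    this matrix and its transpose, so that passing to a subset of a basis is plain matrix
    algebra. *)
Definition selmx : 'M[R]_(#|A|, n) := \matrix_(i, j) (enum_val i == j)%:R.

Lemma sel_mulE m (B : 'M[R]_(n, m)) i j : (selmx *m B) i j = B (enum_val i) j.
Proof.
rewrite mxE (bigD1 (enum_val i)) //= mxE eqxx mul1r big1 ?addr0 // => k ne.
by rewrite mxE eq_sym (negbTE ne) mul0r.
Qed.

Lemma mul_selTE m (B : 'M[R]_(m, n)) i j : (B *m selmx^T) i j = B i (enum_val j).
Proof. by rewrite -[B *m _]trmxK trmx_mul trmxK mxE sel_mulE mxE. Qed.

Lemma mul_selE m (B : 'M[R]_(m, #|A|)) i j : j \notin A -> (B *m selmx) i j = 0.
Proof.
move=> hj; rewrite mxE big1 // => k _; rewrite mxE.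
case: eqP => [ek|]; last by rewrite mulr0.
by move: hj; rewrite -ek enum_valP.
Qed.

Lemma selK m (B : 'M[R]_(m, #|A|)) : B *m selmx *m selmx^T = B.
Proof.
apply/matrixP => i j; rewrite mul_selTE mxE (bigD1 j) //= mxE eqxx mulr1.
rewrite big1 ?addr0 // => k ne; rewrite mxE (inj_eq enum_val_inj) (negbTE ne).
by rewrite mulr0.
Qed.

Lemma selTK m (B : 'M[R]_(m, n)) : (forall i j, j \notin A -> B i j = 0) ->
  B *m selmx^T *m selmx = B.
Proof.
move=> hB; apply/matrixP => i j; have [hj|hj] := boolP (j \in A); last first.
  by rewrite mul_selE // hB.
have [k ->] : exists k : 'I_#|A|, j = enum_val k.
  by exists (enum_rank_in hj j); rewrite enum_rankK_in.
by rewrite -mul_selTE selK mul_selTE.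
Qed.

Lemma mul_selT_eq0 m (B : 'M[R]_(m, n)) : B *m selmx^T = 0 ->
  forall i j, j \in A -> B i j = 0.
Proof.
move=> hB i j hj; have [k ->] : exists k : 'I_#|A|, j = enum_val k.
  by exists (enum_rank_in hj j); rewrite enum_rankK_in.
by rewrite -mul_selTE hB mxE.
Qed.

End Selection.

Section Minimal.

Variables (K : fieldType) (N : nat).
Local Notation S := {mpoly K[N]}.
Implicit Types (p q f : S) (I J : S -> Prop).

Lemma mcoeff0M p q : (p * q)@_0%MM = p@_0%MM * q@_0%MM.
Proof. exact: rmorphM. Qed.

Definition minimal n (D : 'M[S]_n) : Prop := forall a b, (D a b)@_0%MM = 0.

Lemma row_sum_deltaE n (v : 'rV[S]_n) o : (forall b, b != o -> v 0 b = 0) ->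
  v = v 0 o *: delta_mx 0 o.
Proof.
move=> hv; apply/rowP => b; rewrite !mxE eqxx /=.
by have [->|/hv ->] := eqVneq b o; rewrite ?mulr1 ?mulr0.
Qed.

Section Prune.

Variables (n : nat) (hd gd : 'I_n -> nat) (D : 'M[S]_n) (g : 'cV[S]_n).
Variables (I : S -> Prop) (a0 b0 : 'I_n).
Hypotheses (hI : homog_ideal I) (res : graded_res hd gd D g I)
  (Dnz : (D a0 b0)@_0%MM != 0).

Local Notation A := (~: [set a0; b0]).
Local Notation E := (selmx S A).

(** Gaussian elimination at a unit entry: row [a0] and column [b0] of [L *m D] vanish, [L *m D]
    being [D] minus a rank one correction, and the two basis vectors can be deleted together. *)
Lemma prune_res : exists D' g', graded_res (fun i : 'I_#|A| => hd (enum_val i))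
  (fun i : 'I_#|A| => gd (enum_val i)) D' g' I.
Proof.
have DD := res_DD res.
have gdab : gd a0 = gd b0 by apply: shift_homog_neq0 (res_gd res a0 b0) Dnz.
have ab0 : D a0 b0 != 0 by apply: contraNneq Dnz => ->; rewrite mcoeff0.
have hdab := res_hd res ab0.
have knz := Dnz; pose k := (D a0 b0)@_0%MM; rewrite -/k in knz.
have Dab : D a0 b0 = k%:MP by exact: shift_homog_const gdab (res_gd res _ _).
pose ki : S := (k^-1)%:MP.
have kiM : ki * D a0 b0 = 1 by rewrite Dab -mpolyCM mulVf.
have neab : a0 != b0 by apply: contra_eq_neq hdab => ->; rewrite ltn_eqF.
have ga0 : g a0 0 = 0.
  by apply/eqP; apply: contraTT isT => /(res_hd0 res); rewrite hdab.
have D0 c : hd c != (hd c).+1 by rewrite ltn_eqF.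
have Daa : D a0 a0 = 0.
  by apply/eqP; apply: contraTT (D0 a0) => /(res_hd res) {1}->; rewrite eqxx.
have Dbb : D b0 b0 = 0.
  by apply/eqP; apply: contraTT (D0 b0) => /(res_hd res) {1}->; rewrite eqxx.
pose u := col b0 D; pose r := row a0 D.
have Mu m (B : 'M[S]_(m, n)) : B *m u = col b0 (B *m D) by rewrite /u !colE mulmxA.
have Du : D *m u = 0 by rewrite Mu DD; apply/colP => i; rewrite !mxE.
have rD : r *m D = 0 by rewrite /r -row_mul DD row0.
pose L := 1%:M - ki *: (u *m delta_mx 0 a0).
have LD : L *m D = D - ki *: (u *m r).
  by rewrite mulmxBl mul1mx -scalemxAl -mulmxA mul_row_delta.
have LDE a b : (L *m D) a b = D a b - ki * (D a b0 * D a0 b).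
  by rewrite LD mxBE mxZE [in X in _ - X]mxE big_ord1 !mxE.
have LDb a : (L *m D) a b0 = 0.
  by rewrite LDE mulrCA kiM mulr1 subrr.
have LDa b : (L *m D) a0 b = 0.
  by rewrite LDE mulrA kiM mul1r subrr.
have inA c : (c \notin A) = (c == a0) || (c == b0).
  by rewrite !inE negbK.
have dE c : c \notin A -> (delta_mx (0 : 'I_1) c : 'rV[S]_n) *m E^T = 0.
  move=> hc; apply/rowP => i; rewrite mul_selTE !mxE.
  have [ei|] := eqVneq (enum_val i) c; last by rewrite andbF.
  by rewrite -ei enum_valP in hc.
have wu (w : 'rV[S]_n) : w *m u = ((w *m D) 0 b0)%:M.
  by rewrite Mu [col _ _]mx11_scalar mxE.
have LDdecomp (x : 'rV[S]_n) : x 0 b0 = 0 -> x *m E^T *m E = x - x 0 a0 *: delta_mx 0 a0.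
  move=> xb; rewrite -[RHS](selTK (A := A)).
    congr mulmx; rewrite mulmxBl -scalemxAl dE ?scaler0 ?subr0 //.
    by rewrite inA eqxx.
  move=> i j; rewrite ord1 inA !mxE eqxx /= => /orP[]/eqP ->.
    by rewrite eqxx mulr1 subrr.
  by rewrite eq_sym (negbTE neab) mulr0 subr0.
have delA m (B : 'M[S]_(n, m)) : (delta_mx (0 : 'I_1) a0 : 'rV[S]_n) *m B = row a0 B.
  by rewrite rowE.
have LDa0 : row a0 (L *m D) = 0 by apply/rowP => j; rewrite mxE LDa mxE.
have ga00 : row a0 g = 0 by apply/rowP => j; rewrite ord1 !mxE ga0.
have stepx (x : 'rV[S]_n) : x 0 b0 = 0 ->
    x *m E^T *m (E *m (L *m D) *m E^T) = x *m (L *m D) *m E^T.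
  move=> xb; rewrite mulmxA; congr mulmx; rewrite mulmxA (LDdecomp x xb) mulmxBl.
  by rewrite -scalemxAl delA LDa0 scaler0 subr0.
(* The coordinate at [b0] can be cleared with a multiple of row [a0] of [D]: this is a cycle whose
   augmentation lies in I. *)
have fixb (w : 'rV[S]_n) : exists2 w' : 'rV[S]_n, w' 0 b0 = 0 &
    w' *m D = w *m D /\ (w' *m g - w *m g) 0 0 = - (w 0 b0 * ki * (r *m g) 0 0).
  exists (w - (w 0 b0 * ki) *: r).
    by rewrite mxBE mxZE [r _ _]mxE -mulrA kiM mulr1 subrr.
  split; first by rewrite mulmxBl -scalemxAl rD scaler0 subr0.
  by rewrite mulmxBl addrAC subrr add0r -scalemxAl mxNE mxZE.
exists (E *m (L *m D) *m E^T), (E *m g); split.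
- move=> a b; rewrite mul_selTE sel_mulE LDE => nz.
  have [h|h] := eqVneq (D (enum_val a) (enum_val b)) 0; last exact: (res_hd res).
  move: nz; rewrite h sub0r oppr_eq0 !mulf_eq0 !negb_or => /and3P[_].
  by move=> /(res_hd res) -> /(res_hd res); rewrite hdab => -[->].
- move=> a b; rewrite mul_selTE sel_mulE LDE; apply: shift_homogB.
    exact: (res_gd res).
  apply: (@shift_homogM _ _ _ (gd (enum_val a))); first exact: shift_homogC.
  by apply: shift_homogM (res_gd res _ _) _; rewrite -gdab; exact: (res_gd res).
- by move=> a; rewrite sel_mulE; apply: (res_hd0 res).
- by move=> a; rewrite sel_mulE; apply: (res_gd0 res).
- have [v hv] := res_gen res; have [w wb [_ wg]] := fixb v.
  exists (w *m E^T); rewrite mulmxA (LDdecomp w wb) mulmxBl -scalemxAl delA ga00.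
  rewrite scaler0 subr0.
  have h : I ((r *m g) 0 0) by rewrite /r -(delA _ D); apply: (res_Dg _ res).
  move: wg; rewrite mxBE => /eqP; rewrite subr_eq => /eqP ->.
  rewrite opprD opprK addrCA; apply: idealD => //; exact: idealMl.
- move=> v'; split.
  + move=> [vD vg]; set v := v' *m E.
    have vb : v 0 b0 = 0 by rewrite mul_selE // inA eqxx orbT.
    have va : v 0 a0 = 0 by rewrite mul_selE // inA eqxx.
    have vK : v *m E^T = v' by exact: selK.
    pose s := (v *m (L *m D)) 0 a0.
    have es : v *m (L *m D) = s *: delta_mx 0 a0.
      apply: row_sum_deltaE => c hc.
      have [->|hc'] := eqVneq c b0.
        by rewrite mxE big1 // => i _; rewrite LDb mulr0.
      apply: (mul_selT_eq0 (A := A)); last by rewrite -[_ \in _]negbK inA negb_or hc.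
      by rewrite -vD /v !mulmxA.
    have vL : v *m L = v - ki *: (v *m u *m delta_mx 0 a0).
      by rewrite mulmxBr mulmx1 -scalemxAr mulmxA.
    (* Deleting column [a0] hides the coordinate [s] of [v *m (L *m D)]. It vanishes because
       [D *m u = 0] while the entry of [u] at [a0] is a unit. *)
    have s0 : s = 0.
      have : (v *m (L *m D)) *m u = 0 by rewrite -!mulmxA Du !mulmx0.
      rewrite es -scalemxAl -rowE => /rowP/(_ 0); rewrite mxZE !mxE => h.
      by rewrite -[s]mulr1 -kiM mulrCA h mulr0.
    have [w hw] : exists w, v *m L = w *m D.
      apply/(res_exact res); split; first by rewrite -mulmxA es s0 scale0r.
      rewrite vL mulmxBl mxBE -scalemxAl mxZE -[_ *m delta_mx _ _ *m g]mulmxA.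
      rewrite delA ga00 mulmx0.
      rewrite [X in _ * X]mxE mulr0 subr0.
      by rewrite /v -mulmxA.
    have [w' wb [wD _]] := fixb w; rewrite -wD in hw.
    exists (w' *m E^T); rewrite stepx // LD mulmxBr -scalemxAr mulmxA wu -hw.
    have -> : (v *m L) 0 b0 = 0.
      rewrite vL mxBE vb sub0r mxZE mxE big_ord1 mxE [delta_mx _ _ _ _]mxE.
      by rewrite eqxx eq_sym (negbTE neab) !mulr0 oppr0.
    rewrite raddf0 mul0mx scaler0 subr0 vL mulmxBl -scalemxAl.
    rewrite -[_ *m delta_mx _ _ *m _]mulmxA dE ?mulmx0.
      by rewrite scaler0 subr0.
    by rewrite inA eqxx.
  + move=> [w' ->]; set w := w' *m E; set x := w *m (L *m D).
    have -> : w' *m (E *m (L *m D) *m E^T) = x *m E^T.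
      by rewrite /x /w !mulmxA.
    have xb : x 0 b0 = 0 by rewrite mxE big1 // => i _; rewrite LDb mulr0.
    have xD : x *m D = 0 by rewrite /x -!mulmxA DD !mulmx0.
    split.
      rewrite stepx // mulmxA.
      have -> : x *m L = x.
        rewrite mulmxBr mulmx1 -scalemxAr mulmxA wu xD mxE raddf0 mul0mx.
        by rewrite scaler0 subr0.
      by rewrite xD mul0mx.
    rewrite !mulmxA LDdecomp // mulmxBl -scalemxAl delA ga00 scaler0 subr0.
    by rewrite /x mulmxA; apply: (res_Dg (w *m L) res).
Qed.

End Prune.

(** The index map [i] records that every pair of degrees of the minimal resolution already occurs in
    the given one, so bounds on [gd] minus [hd] are inherited. *)
Lemma minimal_res n (hd gd : 'I_n -> nat) (D : 'M[S]_n) g I :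
  homog_ideal I -> graded_res hd gd D g I ->
  exists n' (i : 'I_n' -> 'I_n) D' g',
    graded_res (hd \o i) (gd \o i) D' g' I /\ minimal D'.
Proof.
move=> hI; elim/ltn_ind: n => n IH in hd gd D g * => r.
have [/forallP hm|] := boolP [forall a, forall b, (D a b)@_0%MM == 0].
  by exists n, id, D, g; split=> // a b; apply/eqP/(forallP (hm a)).
rewrite negb_forall => /existsP[a0]; rewrite negb_forall => /existsP[b0 nz].
have [D' [g' r']] := prune_res hI r nz.
have lt : (#|~: [set a0; b0]| < n)%N.
  rewrite -[X in (_ < X)%N]card_ord -(cardsC [set a0; b0]) -addn1 addnC leq_add2r.
  by rewrite card_gt0; apply/set0Pn; exists a0; rewrite !inE eqxx.
have [n'' [i [D'' [g'' [r'' m'']]]]] := IH _ lt _ _ _ _ r'.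
by exists n'', (enum_val \o i), D'', g''.
Qed.

(** The shape of a minimal resolution of a nonzero cyclic module: a single generator [o] in degree
    0. The inequality between the degrees makes the truncated predecessors in [cocone_res] genuine
    ones. *)
Definition normal_res n (hd gd : 'I_n -> nat) (D : 'M[S]_n) (g : 'cV[S]_n) I o :=
  [/\ graded_res hd gd D g I, (forall a, (hd a == 0%N) = (a == o)), g o 0 = 1,
    gd o = 0%N & forall a, (hd a <= gd a)%N].

Lemma ideal_coeff0 I p : homog_ideal I -> ~ I 1 -> I p -> p@_0%MM = 0.
Proof.
move=> hI h1 hp; apply: (ideal_const hI h1).
rewrite (_ : _%:MP = shift_proj 0 0 p); first exact: ideal_proj.
rewrite [RHS](shift_homog_const (erefl 0%N) (shift_projP 0 0 p)).
by rewrite mcoeff_shift_proj mdeg0.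
Qed.

(** Boundaries have no constant terms. Some coordinate of [g] has one because I is proper; a second
    basis vector in degree 0, corrected by a multiple of [o], would be a boundary with constant
    coefficient 1. Each nonzero entry of [D] has positive degree, whence [hd a <= gd a]. *)
Lemma minimal_normal n (hd gd : 'I_n -> nat) (D : 'M[S]_n) g I :
  homog_ideal I -> ~ I 1 -> graded_res hd gd D g I -> minimal D ->
  exists o g', normal_res hd gd D g' I o.
Proof.
move=> hI h1 r hm.
have wD0 (w : 'rV[S]_n) a : ((w *m D) 0 a)@_0%MM = 0.
  by rewrite mxE raddf_sum big1 // => b _; rewrite /= mcoeff0M hm mulr0.
have [v hv] := res_gen r.
have [o ho] : exists o, (g o 0)@_0%MM != 0.
  apply/existsP; apply: contraT; rewrite negb_exists => /forallP h.
  have := ideal_coeff0 hI h1 hv.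
  rewrite mcoeffB mcoeff1 eqxx mxE raddf_sum big1 ?subr0 => [/eqP|a _].
    by rewrite oner_eq0.
  by rewrite /= mcoeff0M; have := h a; rewrite negbK => /eqP ->; rewrite mulr0.
have gdo := shift_homog_neq0 (res_gd0 r o) ho.
have hdo : hd o = 0%N.
  by apply: (res_hd0 r); apply: contraNneq ho => ->; rewrite mcoeff0.
have go := shift_homog_const gdo (res_gd0 r o).
pose c := (g o 0)@_0%MM; rewrite -/c in ho go.
have row0D a : hd a = 0%N -> row a D = 0.
  move=> ha; apply/rowP => b; rewrite !mxE; apply/eqP; apply: contraTT isT.
  by move=> /(res_hd r); rewrite ha.
have hcc : (c^-1)%:MP * c%:MP = 1 :> S by rewrite -mpolyCM mulVf.
have uniq_o a : (hd a == 0%N) = (a == o).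
  apply/eqP/eqP => [ha|-> //]; apply/eqP; apply: contraT => ne.
  have [w hw] : exists w : 'rV[S]_n, delta_mx 0 a - (g a 0 * (c^-1)%:MP) *: delta_mx 0 o = w *m D.
    apply/(res_exact r); split.
      by rewrite mulmxBl -scalemxAl !mul_row_delta !row0D // scaler0 subr0.
    rewrite mulmxBl -scalemxAl !mul_row_delta mxBE mxZE !mxE go -mulrA hcc mulr1.
    by rewrite subrr; apply: ideal0.
  have := wD0 w a; rewrite -hw mxBE mxZE !mxE !eqxx (negbTE ne) mulr0 subr0.
  by rewrite mcoeff1 eqxx => /eqP; rewrite oner_eq0.
have hdgd a : (hd a <= gd a)%N.
  move: {2}(hd a) (leqnn (hd a)) => m; elim: m => [|m IHm] in a * => ha.
    by move: ha; rewrite leqn0 => /eqP ->.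
  case ha': (hd a) => [//|h].
  have /existsP[b nz] : [exists b, D a b != 0].
    apply: contraT; rewrite negb_exists => /forallP hb.
    have [w hw] : exists w : 'rV[S]_n, delta_mx 0 a = w *m D.
      apply/(res_exact r); rewrite !mul_row_delta mxE; split.
        by apply/rowP => b; rewrite !mxE; apply/eqP; rewrite -[_ == _]negbK.
      suff -> : g a 0 = 0 by apply: ideal0.
      by apply/eqP; apply: contraTT isT => /(res_hd0 r); rewrite ha'.
    have := wD0 w a; rewrite -hw mxE !eqxx mcoeff1 eqxx => /eqP.
    by rewrite oner_eq0.
  have hb : hd b = h by have := res_hd r nz; rewrite ha' => -[].
  have : (hd b <= gd b)%N by apply: IHm; rewrite hb -ltnS -ha'.
  rewrite hb => /leq_ltn_trans; apply; rewrite ltnNge.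
  apply: contra nz => le; apply/eqP/mpolyP => m'; rewrite mcoeff0.
  apply/eqP; rewrite mcoeff_eq0; apply/negP => hm'.
  have /shift_homogP/(_ _ hm') em := res_gd r a b.
  have m0 : m' = 0%MM.
    by apply/eqP; rewrite -mdeg_eq0; move: le; rewrite -em; case: (mdeg m') => // d; lia.
  by move: hm'; rewrite m0 mcoeff_msupp hm eqxx.
exists o, ((c^-1)%:MP *: g); split=> //; last by rewrite mxZE go.
split; [exact: res_hd r | exact: res_gd r | | | |].
- by move=> a; rewrite mxZE mulf_eq0 negb_or => /andP[_]; apply: (res_hd0 r).
- move=> a; rewrite mxZE; apply: shift_homogM (res_gd0 r a); exact: shift_homogC.
- exists (c%:MP *: v); rewrite -scalemxAl -scalemxAr scalerA mulrC hcc scale1r.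
  exact: hv.
- move=> w; rewrite -(res_exact r w) -scalemxAr mxZE.
  split=> -[e1 e2]; split=> //; last exact: idealMl.
  have -> : (w *m g) 0 0 = c%:MP * ((c^-1)%:MP * (w *m g) 0 0).
    by rewrite mulrA [c%:MP * _]mulrC hcc mul1r.
  exact: idealMl.
Qed.

End Minimal.

(** * The resolution of a colon ideal from that of a quotient *)

Section Cocone.

Variables (K : fieldType) (N : nat).
Local Notation S := {mpoly K[N]}.

Variables (n1 n2 : nat).
Variables (hd1 gd1 : 'I_n1 -> nat) (D1 : 'M[S]_n1) (g1 : 'cV[S]_n1) (o1 : 'I_n1).
Variables (hd2 gd2 : 'I_n2 -> nat) (D2 : 'M[S]_n2) (g2 : 'cV[S]_n2) (o2 : 'I_n2).
Variables (I J : S -> Prop) (f : S).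
Hypotheses (hI : homog_ideal I) (hf : shift_homog 1 0 f) (hJ : is_colon I f J).
Hypothesis (proper : ~ ideal_add I f 1).

Let hJI : homog_ideal J := homog_ideal_colon hI hf hJ.
Let hIf : homog_ideal (ideal_add I f) := homog_ideal_add hI hf.

Local Notation A1 := [set~ o1].
Local Notation A2 := [set~ o2].
Local Notation E1 := (selmx S A1).
Local Notation E2 := (selmx S A2).

Lemma shift_homog_pred a b p : (0 < a)%N -> (0 < b)%N ->
  shift_homog a b p -> shift_homog a.-1 b.-1 (p : S).
Proof.
move=> ha hb /shift_homogP h; apply/shift_homogP => m /h.
by case: a b ha hb {h} => [//|a] [//|b] _ _ /=; rewrite addnS => -[].
Qed.

Lemma selTKE n (o : 'I_n) (v : 'rV[S]_n) : v 0 o = 0 ->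
  v *m (selmx S [set~ o])^T *m selmx S [set~ o] = v.
Proof.
move=> hv; rewrite selTK // => i j.
by rewrite !inE negbK ord1 => /eqP ->.
Qed.

Lemma delta_selT n (o : 'I_n) :
  (delta_mx (0 : 'I_1) o : 'rV[S]_n) *m (selmx S [set~ o])^T = 0.
Proof.
apply/rowP => i; rewrite mul_selTE !mxE.
have [ei|] := eqVneq (enum_val i) o; last by rewrite andbF.
by have := enum_valP i; rewrite ei !inE eqxx.
Qed.

Lemma off_o n (o : 'I_n) (v : 'rV[S]_n) : v *m (selmx S [set~ o])^T = 0 ->
  v = v 0 o *: delta_mx 0 o.
Proof.
move=> h; apply: row_sum_deltaE => b hb; apply: (mul_selT_eq0 h).
by rewrite !inE.
Qed.

Lemma selT_fix n (o : 'I_n) (v : 'rV[S]_n) :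
  exists2 w : 'rV[S]_n, w 0 o = 0 &
    w *m (selmx S [set~ o])^T = v *m (selmx S [set~ o])^T /\
    v = w + v 0 o *: delta_mx 0 o.
Proof.
exists (v - v 0 o *: delta_mx 0 o); last split; last by rewrite subrK.
  by rewrite !mxE !eqxx mulr1 subrr.
by rewrite mulmxBl -scalemxAl delta_selT scaler0 subr0.
Qed.

(** The kernel term of the exact sequence is resolved by the cone of the comparison map [M] from the
    resolution of S/I to that of S/(I + (f)), shifted down by one. The map [M] sends [o1] to [o2]
    with coefficient 1, so this pair cancels, and nothing remains in homological degree -1. Internal
    degrees drop by 1, the degree of f. *)
Lemma cocone_res :
  normal_res hd1 gd1 D1 g1 I o1 ->
  normal_res hd2 gd2 D2 g2 (ideal_add I f) o2 ->
  exists D g, graded_res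
    (join (fun i : 'I_#|A1| => hd1 (enum_val i))
          (fun i : 'I_#|A2| => (hd2 (enum_val i)).-1))
    (join (fun i : 'I_#|A1| => (gd1 (enum_val i)).-1)
          (fun i : 'I_#|A2| => (gd2 (enum_val i)).-1)) D g J.
Proof.
move=> [r1 u1 g1o gd1o le1] [r2 u2 g2o gd2o le2].
have g1E a : a != o1 -> g1 a 0 = 0.
  by move=> ne; apply/eqP; apply: contraNT ne => /(res_hd0 r1)/eqP; rewrite u1.
have g2E a : a != o2 -> g2 a 0 = 0.
  by move=> ne; apply/eqP; apply: contraNT ne => /(res_hd0 r2)/eqP; rewrite u2.
have vg n (o : 'I_n) (g : 'cV[S]_n) (v : 'rV[S]_n) :
    (forall a, a != o -> g a 0 = 0) -> g o 0 = 1 -> (v *m g) 0 0 = v 0 o.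
  move=> gE go; rewrite mxE (bigD1 o) //= go mulr1 big1 ?addr0 // => a /gE ->.
  by rewrite mulr0.
have vg1 (v : 'rV[S]_n1) : (v *m g1) 0 0 = v 0 o1 by exact: vg.
have vg2 (v : 'rV[S]_n2) : (v *m g2) 0 0 = v 0 o2 by exact: vg.
have hd1o : hd1 o1 = 0%N by apply/eqP; rewrite u1.
have hd2o : hd2 o2 = 0%N by apply/eqP; rewrite u2.
have D1o b : D1 o1 b = 0.
  by apply/eqP; apply: contraT => /(res_hd r1); rewrite hd1o.
have D2o b : D2 o2 b = 0.
  by apply/eqP; apply: contraT => /(res_hd r2); rewrite hd2o.
have dD1 : (delta_mx 0 o1 : 'rV[S]_n1) *m D1 = 0.
  by rewrite mul_row_delta; apply/rowP => b; rewrite !mxE D1o.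
have dD2 : (delta_mx 0 o2 : 'rV[S]_n2) *m D2 = 0.
  by rewrite mul_row_delta; apply/rowP => b; rewrite !mxE D2o.
have [M [M1 M2 M3 M4]] : exists M : 'M[S]_(n1, n2),
  [/\ forall a b, M a b != 0 -> hd1 a = (hd2 b + 0)%N,
      forall a b, shift_homog (gd1 a) (gd2 b + 0) (M a b),
      M *m D2 = (- D1) *m M
    & forall a, ideal_add I f ((M *m g2) a 0 - g1 a 0)].
  apply: (lift_chain_map hIf r2) => [a b|a b||a|a|a].
  - by rewrite mxE oppr_eq0; apply: (res_hd r1).
  - by rewrite mxE; apply/shift_homogN/(res_gd r1).
  - by rewrite mulNmx mulmxN opprK (res_DD r1).
  - exact: (res_hd0 r1).
  - exact: (res_gd0 r1).
  - rewrite mulNmx mxNE; apply: idealN => //; exists 0; rewrite mul0r subr0.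
    by have := res_Dg (delta_mx 0 a) r1; rewrite -mulmxA mul_row_delta mxE.
have M1' a b : M a b != 0 -> hd1 a = hd2 b by move/M1; rewrite addn0.
(* This entry has degree 0, so it is a constant; it is 1 modulo the proper ideal I + (f). *)
have Moo : M o1 o2 = 1.
  have hM : shift_homog 0 0 (M o1 o2) by have := M2 o1 o2; rewrite gd1o gd2o.
  have eM := shift_homog_const (erefl 0%N) hM.
  have := M4 o1; rewrite g1o.
  have -> : (M *m g2) o1 0 = M o1 o2.
    by have := vg2 (row o1 M); rewrite -row_mul [LHS]mxE [RHS]mxE.
  by rewrite eM -mpolyC1 -mpolyCB => /(ideal_const hIf proper)/eqP; rewrite subr_eq0 => /eqP ->.
have dM : (delta_mx 0 o1 : 'rV[S]_n1) *m M = delta_mx 0 o2.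
  rewrite mul_row_delta (@row_sum_deltaE _ _ _ (row o1 M) o2) => [|b hb].
    by rewrite mxE Moo scale1r.
  rewrite mxE; apply/eqP; apply: contraT => /M1' /esym/eqP.
  by rewrite hd1o u2 (negbTE hb).
have Mo2 (v : 'rV[S]_n1) : (v *m M) 0 o2 = v 0 o1.
  rewrite mxE (bigD1 o1) //= Moo mulr1 big1 ?addr0 // => a ne.
  have [->|/M1'/eqP] := eqVneq (M a o2) 0; first by rewrite mulr0.
  by rewrite hd2o u1 (negbTE ne).
have [q [q1 q2 q3]] : exists q : 'cV[S]_n2,
    [/\ forall a, shift_homog (gd2 a) 1 (q a 0),
    forall a, q a 0 != 0 -> hd2 a = 1%N
    & forall w : 'rV[S]_n2, I ((w *m (D2 *m g2)) 0 0 - (w *m q) 0 0 * f)].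
  apply: (@colon_coordinates _ _ I f 1 hI hf n2 hd2 gd2 (D2 *m g2) 1) => a.
  - rewrite mxE; apply: shift_homog_sum => b _.
    exact: shift_homogM (res_gd r2 a b) (res_gd0 r2 b).
  - rewrite mxE; apply: contraNeq => ha; apply/eqP/big1 => b _.
    have [->|h1] := eqVneq (D2 a b) 0; first by rewrite mul0r.
    have [->|h2] := eqVneq (g2 b 0) 0; first by rewrite mulr0.
    by move: ha; rewrite (res_hd r2 h1) (res_hd0 r2 h2).
  - by have := res_Dg (delta_mx 0 a) r2; rewrite -mulmxA mul_row_delta mxE.
have q3' (w : 'rV[S]_n2) : I ((w *m D2) 0 o2 - (w *m q) 0 0 * f).
  by have := q3 w; rewrite mulmxA vg2.
have qo : q o2 0 = 0.
  by apply/eqP; apply: contraT => /q2; rewrite hd2o.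
have dq : (delta_mx 0 o2 : 'rV[S]_n2) *m q = 0.
  by rewrite mul_row_delta; apply/rowP => i; rewrite ord1 !mxE qo.
have neq1 (a : 'I_#|A1|) : enum_val a != o1 by have := enum_valP a; rewrite !inE.
have neq2 (a : 'I_#|A2|) : enum_val a != o2 by have := enum_valP a; rewrite !inE.
have pos1 (a : 'I_#|A1|) : (0 < hd1 (enum_val a))%N by rewrite lt0n u1.
have pos2 (a : 'I_#|A2|) : (0 < hd2 (enum_val a))%N by rewrite lt0n u2.
have pog1 (a : 'I_#|A1|) : (0 < gd1 (enum_val a))%N by apply: leq_trans (le1 _).
have pog2 (a : 'I_#|A2|) : (0 < gd2 (enum_val a))%N by apply: leq_trans (le2 _).
exists (block_mx (E1 *m D1 *m E1^T) (E1 *m M *m E2^T) 0 (E2 *m D2 *m E2^T)),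
  (col_mx 0 (E2 *m q)); split.
- move=> a b; case: (split_ordP a) => a' ->; case: (split_ordP b) => b' ->;
    rewrite !joinE !blockE.
  + by rewrite mul_selTE sel_mulE => /(res_hd r1).
  + by rewrite mul_selTE sel_mulE => /M1' ->; rewrite prednK.
  + by rewrite mxE eqxx.
  + by rewrite mul_selTE sel_mulE => /(res_hd r2) ->; rewrite prednK.
- move=> a b; case: (split_ordP a) => a' ->; case: (split_ordP b) => b' ->;
    rewrite !joinE !blockE.
  + by rewrite mul_selTE sel_mulE; apply: shift_homog_pred (res_gd r1 _ _).
  + rewrite mul_selTE sel_mulE; apply: shift_homog_pred => //.
    by have := M2 (enum_val a') (enum_val b'); rewrite addn0.
  + by rewrite mxE; apply: shift_homog0.
  + by rewrite mul_selTE sel_mulE; apply: shift_homog_pred (res_gd r2 _ _).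
- move=> a; case: (split_ordP a) => a' ->; rewrite !joinE !blockE.
  + by rewrite mxE eqxx.
  + by rewrite sel_mulE => /q2 ->.
- move=> a; case: (split_ordP a) => a' ->; rewrite !joinE !blockE.
  + by rewrite mxE; apply: shift_homog0.
  + rewrite sel_mulE.
    by have := @shift_homog_pred _ 1 _ (pog2 a') (ltn0Sn 0) (q1 (enum_val a')).
(* As f lies in I + (f), f times the generator [o2] is a boundary of some [w]; then [w *m q] is 1
   modulo J. *)
- have [w hw] : exists w : 'rV[S]_n2, f *: delta_mx 0 o2 = w *m D2.
    apply/(res_exact r2); rewrite -scalemxAl dD2 scaler0; split=> //.
    rewrite vg2 !mxE !eqxx mulr1; exists 1.
    by rewrite mul1r subrr; apply: ideal0.
  have [w' wo [_ ew]] := selT_fix o2 w.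
  exists (row_mx 0 (w' *m E2^T)); rewrite mul_row_col mul0mx add0r mulmxA selTKE //.
  have hwo : (w *m D2) 0 o2 = f by rewrite -hw !mxE !eqxx mulr1.
  apply/hJ; have := q3' w.
  by rewrite hwo mulrBl mul1r [in w *m q]ew mulmxDl -scalemxAl dq scaler0 addr0.
- move=> v; rewrite -[v]hsubmxK; set v1 := lsubmx v; set v2 := rsubmx v.
  rewrite mul_row_block mul_row_col !mulmx0 add0r addr0 !mulmxA.
  split.
  + rewrite -[X in _ = X]row_mx0 => -[/eq_row_mx[]].
    set t := v1 *m E1; set w := v2 *m E2 => e1 e2 hw.
    have to : t 0 o1 = 0 by rewrite mul_selE // !inE eqxx.
    have wo : w 0 o2 = 0 by rewrite mul_selE // !inE eqxx.
    have tK : t *m E1^T = v1 by exact: selK.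
    have wK : w *m E2^T = v2 by exact: selK.
    move: t w to wo tK wK e1 e2 hw => t w to wo tK wK e1 e2 hw.
    have tD := off_o e1.
    have twD : t *m M + w *m D2 = (w *m D2) 0 o2 *: delta_mx 0 o2.
      have := @off_o _ o2 (t *m M + w *m D2).
      by rewrite mulmxDl e2 mxDE Mo2 to add0r => ->.
    set i := (w *m D2) 0 o2 in twD.
    have iI : I i.
      move/hJ: hw => h; have := idealD hI (q3' w) h.
      by rewrite subrK.
    have s0 : t *m D1 = 0.
      have : t *m D1 *m M = - (t *m M *m D2) by rewrite -!mulmxA M3 mulNmx mulmxN opprK.
      have -> : t *m M = i *: delta_mx 0 o2 - w *m D2 by rewrite -twD addrK.
      rewrite mulmxBl -(mulmxA w) (res_DD r2) mulmx0 -scalemxAl dD2 scaler0 subr0 oppr0.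
      rewrite tD -scalemxAl dM => /rowP/(_ o2); rewrite !mxE !eqxx mulr1 => ->.
      by rewrite scale0r.
    have [y hy] : exists y, t = y *m D1.
      by apply/(res_exact r1); rewrite vg1 to; split=> //; apply: ideal0.
    (* The dropped coordinate [i] at [o2] lies in I, so [i] times [o1] is a boundary. Correcting the
       preimage [y] by [z] makes [w - x *m M] a cycle. *)
    have [z hz] : exists z : 'rV[S]_n1, i *: delta_mx 0 o1 = z *m D1.
      apply/(res_exact r1); rewrite -scalemxAl dD1 scaler0 vg1 !mxE !eqxx mulr1.
      by split.
    pose x0 := y - z; pose x := x0 - x0 0 o1 *: delta_mx 0 o1.
    have xo : x 0 o1 = 0 by rewrite !mxE !eqxx mulr1 subrr.
    have xD : x *m D1 = t - i *: delta_mx 0 o1.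
      by rewrite mulmxBl -scalemxAl dD1 scaler0 subr0 mulmxBl -hy -hz.
    have [p hp] : exists p, w - x *m M = p *m D2.
      apply/(res_exact r2); split.
        rewrite mulmxBl -mulmxA M3 mulNmx mulmxN opprK mulmxA xD mulmxBl.
        by rewrite -scalemxAl dM addrA [w *m D2 + _]addrC twD subrr.
      rewrite vg2 mxBE wo Mo2 xo subrr.
      by exists 0; rewrite mul0r subr0; apply: ideal0.
    have [p' po [_ ep]] := selT_fix o2 p.
    exists (row_mx (x *m E1^T) (p' *m E2^T)); rewrite mul_row_block mulmx0 addr0.
    rewrite !mulmxA !selTKE // xD -(mulmxDl (x *m M) (p' *m D2)).
    have -> : p' *m D2 = w - x *m M.
      by rewrite hp ep mulmxDl -scalemxAl dD2 scaler0 addr0.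
    by rewrite [x *m M + _]addrC subrK wK mulmxBl -scalemxAl delta_selT scaler0 subr0 tK.
  + case=> u; rewrite -[u]hsubmxK; set t' := lsubmx u; set x' := rsubmx u.
    rewrite mul_row_block mulmx0 addr0 !mulmxA => /eq_row_mx[-> ->].
    move: (t' *m E1) (x' *m E2) => t x; rewrite -(mulmxDl (t *m M) (x *m D2)).
    move: v v1 v2 => _ _ _.
    have [v vo [<- ev]] := selT_fix o1 (t *m D1).
    have [w wo [<- ew]] := selT_fix o2 (t *m M + x *m D2).
    have vD : v *m D1 = 0.
      have : t *m D1 *m D1 = 0 by rewrite -mulmxA (res_DD r1) mulmx0.
      by rewrite [t *m D1]ev mulmxDl -scalemxAl dD1 scaler0 addr0.
    have hvM : v *m M = t *m D1 *m M - (t *m D1) 0 o1 *: delta_mx 0 o2.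
      by rewrite [in t *m D1 *m M]ev mulmxDl -scalemxAl dM addrK.
    have hwD : w *m D2 = - (t *m D1 *m M).
      have : (t *m M + x *m D2) *m D2 = - (t *m D1 *m M).
        by rewrite mulmxDl -!mulmxA (res_DD r2) mulmx0 addr0 M3 mulNmx mulmxN mulmxA.
      by rewrite [t *m M + _]ew mulmxDl -scalemxAl dD2 scaler0 addr0.
    split.
      rewrite -[RHS]row_mx0; congr row_mx.
        by rewrite selTKE // vD mul0mx.
      rewrite !selTKE // -(mulmxDl (v *m M) (w *m D2)) hvM hwD.
      by rewrite addrAC subrr add0r mulNmx -scalemxAl delta_selT scaler0 oppr0.
    rewrite selTKE //; apply/hJ.
    have -> : w *m q = (t *m M + x *m D2) *m q.
      by rewrite [in RHS]ew mulmxDl -scalemxAl dq scaler0 addr0.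
    have h := q3' (t *m M + x *m D2).
    apply: (idealBl hI (q := (((t *m M + x *m D2)) *m D2) 0 o2)); last first.
      by rewrite -opprB; apply: idealN.
    rewrite mulmxDl -!mulmxA (res_DD r2) mulmx0 addr0 M3 mulNmx mulmxN mulmxA.
    rewrite mxNE Mo2; apply: idealN => //.
    by rewrite -vg1; apply: (res_Dg _ r1).
Qed.

End Cocone.

(** * Hilbert functions *)

Section HilbertFunction.

Variables (K : fieldType) (N : nat).
Local Notation S := {mpoly K[N]}.
Implicit Types (p q f : S) (I J : S -> Prop).

Lemma homogE m p : (p \is m.-homog) = shift_homog m 0 p.
Proof.
by rewrite dhomogE /shift_homog; apply: eq_all => k; rewrite /= addn0.
Qed.

Definition mod_span (X : finType) (b : X -> S) I p : Prop :=
  exists c : X -> K, I (p - \sum_x c x *: b x).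

Definition mod_free (X : finType) (b : X -> S) I : Prop :=
  forall c : X -> K, I (\sum_x c x *: b x) -> forall x, c x = 0.

Section Span.

Variable I : S -> Prop.
Hypothesis hI : homog_ideal I.

Lemma mod_span_lin (X : finType) (b : X -> S) a p q :
  mod_span b I p -> mod_span b I q -> mod_span b I (a *: p + q).
Proof.
move=> [c hc] [d hd]; exists (fun x => a * c x + d x).
have -> : a *: p + q - \sum_x (a * c x + d x) *: b x =
    a *: (p - \sum_x c x *: b x) + (q - \sum_x d x *: b x).
  rewrite scalerBr scaler_sumr [RHS]addrACA -opprD -big_split /=.
  by congr (_ - _); apply: eq_bigr => x _; rewrite scalerDl scalerA.
by apply: idealD => //; apply: idealZ.
Qed.

Lemma mod_span0 (X : finType) (b : X -> S) p : I p -> mod_span b I p.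
Proof.
by move=> hp; exists (fun=> 0); rewrite big1 ?subr0 // => x _; rewrite scale0r.
Qed.

Lemma mod_span_sum (X : finType) (b : X -> S) (T : Type) (r : seq T) (P : pred T)
    (c : T -> K) (F : T -> S) :
  (forall i, P i -> mod_span b I (F i)) ->
  mod_span b I (\sum_(i <- r | P i) c i *: F i).
Proof.
move=> h; elim: r => [|i r IH].
  by rewrite big_nil; apply: mod_span0; apply: ideal0.
by rewrite big_cons; case: ifP => // hi; apply: mod_span_lin => //; apply: h.
Qed.

Lemma mod_span_id (X : finType) (b : X -> S) x : mod_span b I (b x).
Proof.
exists (fun y => (y == x)%:R); rewrite (bigD1 x) //= eqxx scale1r big1 ?addr0.
  by rewrite subrr; apply: ideal0.
by move=> y ne; rewrite (negbTE ne) scale0r.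
Qed.

(** With more free than spanning elements, the matrix of coefficients has a nonzero left kernel
    vector, which is a relation among the [b x] modulo I. *)
Lemma mod_free_le_span (X Q : finType) (b : X -> S) (s : Q -> S) :
  mod_free b I -> (forall x, mod_span s I (b x)) -> (#|X| <= #|Q|)%N.
Proof.
move=> fb /fin_all_exists[c hc]; rewrite leqNgt; apply/negP => lt.
pose C := \matrix_(i < #|X|, j < #|Q|) c (enum_val i) (enum_val j).
have : kermx C != 0.
  rewrite -mxrank_eq0 mxrank_ker subn_eq0 -ltnNge.
  exact: leq_ltn_trans (rank_leq_col _) lt.
case/rowV0Pn => v /sub_kermxP vC nz; case/negP: nz; apply/eqP/rowP => i.
rewrite [RHS]mxE -[i]enum_valK.
apply: (fb (fun x => v 0 (enum_rank x))).
have -> : \sum_x v 0 (enum_rank x) *: b x =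
    \sum_x v 0 (enum_rank x) *: (b x - \sum_q c x q *: s q).
  rewrite -[LHS]subr0 [RHS](eq_bigr (fun x => v 0 (enum_rank x) *: b x -
      v 0 (enum_rank x) *: \sum_q c x q *: s q)); last first.
    by move=> x _; rewrite scalerBr.
  rewrite sumrB; congr (_ - _).
  rewrite (eq_bigr (fun x => \sum_q (v 0 (enum_rank x) * c x q) *: s q)); last first.
    by move=> x _; rewrite scaler_sumr; apply: eq_bigr => q _; rewrite scalerA.
  rewrite exchange_big big1 //= => q _; rewrite -scaler_suml.
  have /rowP/(_ (enum_rank q)) := vC; rewrite !mxE => h.
  rewrite (_ : \sum_(x : X) _ = 0) ?scale0r //.
  rewrite (reindex (@enum_val X X)) /=; last first.
    by apply: onW_bij; apply: enum_val_bij.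
  rewrite -[RHS]h; apply: eq_bigr => k _; rewrite mxE enum_valK.
  by rewrite enum_rankK.
by apply: ideal_sum => // x _; apply: idealZ.
Qed.

Lemma sum_ord_addn1 r (F : 'I_(r + 1) -> S) :
  \sum_i F i = \sum_(i < r) F (lshift 1 i) + F (rshift r 0).
Proof. by rewrite big_split_ord /= big_ord1. Qed.

(** Greedy choice of a basis. Whether the next element is already spanned modulo I is decided by
    excluded middle, as membership in I is a bare predicate. *)
Lemma mod_basis_exists (s : nat -> S) n :
  exists r (b : 'I_r -> S), [/\ forall i, exists2 j, (j < n)%N & b i = s j,
    mod_free b I & forall j, (j < n)%N -> mod_span b I (s j)].
Proof.
elim: n => [|n [r [b [b1 b2 b3]]]].
  by exists 0%N, (fun=> 0); split=> // [[]|c _ []].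
have [hs|hs] := classic (mod_span b I (s n)).
  exists r, b; split=> // [i|j].
    by have [j lt ->] := b1 i; exists j => //; apply: ltnW.
  by rewrite ltnS leq_eqVlt => /orP[/eqP ->|/b3].
exists (r + 1)%N, (join b (fun _ : 'I_1 => s n)); split=> [i|c|j].
- case: (split_ordP i) => i' ->; rewrite joinE; last by exists n.
  by have [j lt ->] := b1 i'; exists j => //; apply: ltnW.
- rewrite sum_ord_addn1 joinE => hc.
  have c0 : c (rshift r 0) = 0.
    apply/eqP; apply/negP => /negP nz; case: hs.
    exists (fun i => - (c (rshift r 0))^-1 * c (lshift 1 i)).
    have := idealZ hI (c (rshift r 0))^-1 hc.
    rewrite scalerDr scalerA mulVf // scale1r addrC scaler_sumr; congr (I (_ + _)).
    rewrite -sumrN; apply: eq_bigr => i _.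
    by rewrite joinE scalerA mulNr scaleNr opprK.
  move: hc; rewrite c0 scale0r addr0 => hc i.
  case: (split_ordP i) => i' ->; last by rewrite ord1.
  apply: (b2 (fun i => c (lshift 1 i))); move: hc; congr I.
  by apply: eq_bigr => k _; rewrite joinE.
- have ext p : mod_span b I p -> mod_span (join b (fun _ : 'I_1 => s n)) I p.
    move=> [c hc]; exists (join c (fun=> 0)).
    rewrite sum_ord_addn1 joinE scale0r addr0; move: hc; congr (I (_ - _)).
    by apply: eq_bigr => k _; rewrite !joinE.
  rewrite ltnS leq_eqVlt => /orP[/eqP ->|/b3/ext //].
  by have := mod_span_id (join b (fun _ : 'I_1 => s n)) (rshift r 0); rewrite joinE.
Qed.

End Span.

Definition monomials m : seq 'X_{1..N} :=
  [seq val k | k <- enum {: 'X_{1..N < m.+1}} & mdeg (val k) == m].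

Lemma mem_monomials m k : (k \in monomials m) = (mdeg k == m).
Proof.
apply/mapP/idP => [[k']|/eqP hk].
  by rewrite mem_filter => /andP[h _] ->.
have lt : (mdeg k < m.+1)%N by rewrite hk.
by exists (BMultinom lt) => //; rewrite mem_filter mem_enum /= hk eqxx.
Qed.

Lemma monomials_uniq m : uniq (monomials m).
Proof.
rewrite map_inj_uniq => [|x y /= h]; last exact/val_inj.
exact: (filter_uniq _ (enum_uniq _)).
Qed.

Lemma homog_monomials m p : p \is m.-homog ->
  p = \sum_(k <- monomials m) p@_k *: 'X_[k].
Proof.
move=> hp; apply/mpolyP => k; rewrite raddf_sum /=.
have [hk|hk] := boolP (k \in monomials m); last first.
  rewrite big_seq big1 => [|j hj].
    by apply: (dhomog_nemf_coeff hp); rewrite -mem_monomials.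
  by rewrite mcoeffZ mcoeffX; case: eqP hj hk => [-> ->|]; rewrite ?mulr0.
rewrite (bigD1_seq k) ?monomials_uniq //= mcoeffZ mcoeffX eqxx mulr1.
by rewrite big1 ?addr0 // => j ne; rewrite mcoeffZ mcoeffX (negbTE ne) mulr0.
Qed.

Lemma quotient_dim_exists I m : homog_ideal I -> exists r, quotient_dim I m r.
Proof.
move=> hI.
have [r [b [b1 b2 b3]]] :=
  mod_basis_exists hI (fun j => 'X_[nth 0%MM (monomials m) j]) (size (monomials m)).
exists r, b; split=> // [i|p hp].
  have [j lt ->] := b1 i; rewrite dhomogX.
  by have := mem_nth 0%MM lt; rewrite mem_monomials.
rewrite (homog_monomials hp) (big_nth 0%MM) big_mkord.
by apply: mod_span_sum => // i _; apply: b3.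
Qed.

Lemma quotient_dim_uniq I m r r' : homog_ideal I ->
  quotient_dim I m r -> quotient_dim I m r' -> r = r'.
Proof.
move=> hI [b [b1 b2 b3]] [b' [b1' b2' b3']]; apply/eqP; rewrite eqn_leq.
rewrite -[X in (X <= _)%N]card_ord -[X in (_ <= X)%N]card_ord.
rewrite -[X in _ && (X <= _)%N]card_ord -[X in _ && (_ <= X)%N]card_ord.
apply/andP; split.
  by apply: (mod_free_le_span hI b3) => x; apply: b2'.
by apply: (mod_free_le_span hI b3') => x; apply: b2.
Qed.

Lemma quotient_dim_mono m :
  quotient_dim (fun p : S => p = 0) m (size (monomials m)).
Proof.
exists (fun i => 'X_[nth 0%MM (monomials m) i]); split=> [i|p hp|c].
- by rewrite dhomogX; have := mem_nth 0%MM (ltn_ord i); rewrite mem_monomials.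
- exists (fun i => p@_(nth 0%MM (monomials m) i)).
  by rewrite {1}(homog_monomials hp) (big_nth 0%MM) big_mkord subrr.
- move=> hc i; have := congr1 (mcoeff (nth 0%MM (monomials m) i)) hc.
  rewrite mcoeff0 raddf_sum (bigD1 i) //= mcoeffZ mcoeffX eqxx mulr1.
  rewrite big1 ?addr0 // => j ne; rewrite mcoeffZ mcoeffX nth_uniq ?monomials_uniq //.
  by rewrite (inj_eq val_inj) (negbTE ne) mulr0.
Qed.

Section Additivity.

Variables (I J : S -> Prop) (f : S) (e : nat).
Hypotheses (hI : homog_ideal I) (hf : shift_homog e 0 f) (hJ : is_colon I f J).

(** A basis of the middle term of the exact sequence: representatives of a basis modulo I + (f),
    together with f times a basis modulo J. *)
Lemma quotient_dim_add m r1 r2 : (e <= m)%N ->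
  quotient_dim (ideal_add I f) m r1 -> quotient_dim J (m - e) r2 ->
  quotient_dim I m (r1 + r2).
Proof.
move=> le [b1 [h1 s1 f1]] [b2 [h2 s2 f2]].
have hfm : shift_homog m (m - e) f.
  by have := shift_homog_add (m - e) hf; rewrite subnKC // add0n.
exists (join b1 (fun i => b2 i * f)); split.
- move=> i; case: (split_ordP i) => i' ->; rewrite joinE //.
  rewrite homogE mulrC; apply: shift_homogM hfm _.
  by rewrite -homogE.
- move=> p hp; have [c [q hq]] := s1 p hp.
  have hq' : I (p - \sum_(i < r1) c i *: b1 i - shift_proj m e q * f).
    have := ideal_proj hI m 0 hq; rewrite raddfB /= (shift_projM _ _ hf).
    rewrite shift_proj_id // -homogE rpredB // rpred_sum // => i _.
    exact: rpredZ.
  have [|d hd] := s2 (shift_proj m e q).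
    have -> : shift_proj m e q = shift_proj (m - e) 0 q.
      by rewrite -(shift_proj_add (m - e) 0 e) subnK // add0n.
    by rewrite homogE; apply: shift_projP.
  exists (join c d); rewrite big_split_ord /=; move/hJ: hd => hd.
  have := idealD hI hq' hd; congr I.
  rewrite mulrBl addrA subrK mulr_suml opprD addrA; congr (_ - _ - _).
    by apply: eq_bigr => i _; rewrite !joinE.
  by apply: eq_bigr => i _; rewrite !joinE scalerAl.
- move=> c; rewrite big_split_ord /= => hc.
  have eq1 : \sum_(i < r1) c (lshift r2 i) *: join b1 (fun i => b2 i * f) (lshift r2 i) =
      \sum_(i < r1) c (lshift r2 i) *: b1 i.
    by apply: eq_bigr => i _; rewrite joinE.
  have eq2 : \sum_(i < r2) c (rshift r1 i) *: join b1 (fun i => b2 i * f) (rshift r1 i) =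
      (\sum_(i < r2) c (rshift r1 i) *: b2 i) * f.
    by rewrite mulr_suml; apply: eq_bigr => i _; rewrite joinE scalerAl.
  rewrite eq1 eq2 in hc.
  have c1 i : c (lshift r2 i) = 0.
    apply: (f1 (fun i => c (lshift r2 i))).
    by exists (- \sum_(i < r2) c (rshift r1 i) *: b2 i); rewrite mulNr opprK.
  move: hc; rewrite big1 ?add0r => [/hJ/f2 c2 i|i _]; last by rewrite c1 scale0r.
  by case: (split_ordP i) => i' ->.
Qed.

Lemma quotient_dim_low m r : (m < e)%N ->
  quotient_dim (ideal_add I f) m r -> quotient_dim I m r.
Proof.
move=> lt [b [h s fr]].
have low p : p \is m.-homog -> ideal_add I f p -> I p.
  move=> hp [q hq]; have := ideal_proj hI m 0 hq.
  rewrite raddfB /= (shift_projM _ _ hf) shift_proj_id -?homogE //.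
  by rewrite /shift_proj leqNgt lt mul0r subr0.
have bh c : \sum_(i < r) c i *: b i \is m.-homog.
  by apply: rpred_sum => i _; apply: rpredZ.
exists b; split=> // [p hp|c hc].
  have [c hc] := s p hp; exists c; apply: low => //.
  by rewrite rpredB.
by apply: fr; exists 0; rewrite mul0r subr0.
Qed.

End Additivity.

End HilbertFunction.

Section Convolution.

Implicit Types (a : nat -> int) (p q : {poly int}).

(** The coefficient of t^m in the power series of [a] times [p]. Truncating the series to a
    polynomial, as in [convE], makes the ring laws of polynomials available. *)
Definition conv a p m : int := \sum_(i < m.+1) a i * p`_(m - i)%N.

Lemma convE a p m M : (m < M)%N -> conv a p m = ((\poly_(i < M) a i) * p)`_m.
Proof.
move=> lt; rewrite coefM; apply: eq_bigr => i _; rewrite coef_poly.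
by rewrite (leq_trans (ltn_ord i) lt).
Qed.

Lemma eq_conv a b p m : a =1 b -> conv a p m = conv b p m.
Proof. by move=> e; apply: eq_bigr => i _; rewrite e. Qed.

Lemma convD a p q m : conv a (p + q) m = conv a p m + conv a q m.
Proof. by rewrite !(@convE _ _ m m.+1) // mulrDr coefD. Qed.

Lemma convB a p q m : conv a (p - q) m = conv a p m - conv a q m.
Proof. by rewrite !(@convE _ _ m m.+1) // mulrBr coefB. Qed.

Lemma conv1 a m : conv a 1 m = a m.
Proof. by rewrite (@convE _ _ m m.+1) // mulr1 coef_poly leqnn. Qed.

Lemma convM a p q m : conv a (p * q) m = conv (conv a p) q m.
Proof.
rewrite (@convE _ _ m m.+1) // mulrA coefM; apply: eq_bigr => i _.
by rewrite (@convE a p i m.+1).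
Qed.

Lemma convXn a p e m :
  conv a ('X^e * p) m = if (e <= m)%N then conv a p (m - e) else 0.
Proof.
rewrite (@convE _ _ m m.+1) // mulrCA mulrC coefMXn ltnNge.
by case: leqP => //= le; rewrite (@convE _ _ _ m.+1) // ltnS leq_subr.
Qed.

End Convolution.

(** * Regularity bounds and Hilbert numerators along exact sequences *)

Section Good.

Variables (K : fieldType) (N : nat).
Local Notation S := {mpoly K[N]}.
Implicit Types (p q f : S) (I J : S -> Prop) (kap : {poly int}).

(* The Hilbert series of S / I is that of S times kap. *)
Definition hilbert_num I kap : Prop :=
  exists2 H : nat -> nat, forall m, quotient_dim I m (H m)
    & forall m, (H m)%:Z = conv (fun i => (size (monomials N i))%:Z) kap m.

(** The resolution need not be minimal: by [minimal_res] the bound passes to a minimal one. *)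
Definition reg_le I r : Prop :=
  exists n (hd gd : 'I_n -> nat) D g,
    graded_res hd gd D g I /\ forall a, (gd a <= hd a + r)%N.

Definition good I r kap : Prop := reg_le I r /\ hilbert_num I kap.

Lemma good_ext I J r kap : (forall p, I p <-> J p) -> good I r kap -> good J r kap.
Proof.
move=> e [[n [hd [gd [D [g [h1 h2]]]]]] [H h3 h4]]; split.
  by exists n, hd, gd, D, g; split=> //; apply: graded_res_ext h1.
exists H => // m; have [b [b1 b2 b3]] := h3 m; exists b; split=> //.
  by move=> p /b2[c /e hc]; exists c.
by move=> c /e/b3.
Qed.

Lemma good_weaken I r r' kap : (r <= r')%N -> good I r kap -> good I r' kap.
Proof.
move=> le [[n [hd [gd [D [g [h1 h2]]]]]] h]; split=> //.
exists n, hd, gd, D, g; split=> // a; apply: leq_trans (h2 a) _.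
by rewrite leq_add2l.
Qed.

Lemma good_zero : good (fun p : S => p = 0) 0 1.
Proof.
split; last first.
  exists (fun m => size (monomials N m)); first exact: quotient_dim_mono.
  by move=> m; rewrite conv1.
exists 1%N, (fun=> 0%N), (fun=> 0%N), 0, (const_mx 1); split=> //; split.
- by move=> a b; rewrite mxE eqxx.
- by move=> a b; rewrite mxE; apply: shift_homog0.
- by [].
- by move=> a; rewrite mxE; apply: shift_homog1.
- by exists (const_mx 1); rewrite mxE big_ord1 !mxE mulr1 subrr.
- move=> v; rewrite mulmx0; split=> [[_]|[w ->]]; last first.
    by rewrite mulmx0 mul0mx mxE.
  rewrite mxE big_ord1 [const_mx _ _ _]mxE mulr1 => v0; exists 0.
  by rewrite mulmx0; apply/rowP => i; rewrite ord1 v0 mxE.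
Qed.

Section AddForm.

Variables (I J : S -> Prop) (f : S) (e : nat).
Hypotheses (hI : homog_ideal I) (hf : shift_homog e 0 f) (hJ : is_colon I f J).

Let hJI : homog_ideal J := homog_ideal_colon hI hf hJ.
Let hIf : homog_ideal (ideal_add I f) := homog_ideal_add hI hf.

(** The resolution of S/J enters the cone one homological degree higher and [e] internal degrees
    higher, which changes its bound by [e] minus 1. *)
Lemma good_cone r r' kap kap' : (0 < e)%N -> good I r kap -> good J r' kap' ->
  good (ideal_add I f) (maxn r (r' + e).-1) (kap - 'X^e * kap').
Proof.
move=> e0 [[n1 [hd1 [gd1 [D1 [g1 [h1 l1]]]]]] [H H1 H2]].
move=> [[n2 [hd2 [gd2 [D2 [g2 [h2 l2]]]]]] [H' H1' H2']]; split.
  have [D [g hr]] := cone_res hI hf hJ h1 h2.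
  exists (n1 + n2)%N; do 2!eexists; exists D, g; split; first exact: hr.
  move=> a; case: (split_ordP a) => a' ->; rewrite !joinE.
    by apply: leq_trans (l1 _) _; rewrite leq_add2l leq_maxl.
  by move: (l2 a') (leq_maxr r (r' + e).-1); lia.
exists (fun m => H m - (if e <= m then H' (m - e) else 0))%N => m.
  have [s hs] := quotient_dim_exists m hIf.
  suff -> : (H m - (if e <= m then H' (m - e) else 0))%N = s by [].
  case: leqP => le.
    by rewrite (quotient_dim_uniq hI (H1 m) (quotient_dim_add hI hf hJ le hs (H1' _))) addnK.
  by rewrite (quotient_dim_uniq hI (H1 m) (quotient_dim_low hI hf le hs)) subn0.
rewrite convB convXn -H2; case: leqP => le; last by rewrite subn0 subr0.
rewrite -H2' subzn //.
have [s hs] := quotient_dim_exists m hIf.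
by rewrite (quotient_dim_uniq hI (H1 m) (quotient_dim_add hI hf hJ le hs (H1' _))) leq_addl.
Qed.

Lemma good_horseshoe r r' kap kap' :
  good (ideal_add I f) r kap -> good J r' kap' ->
  good I (maxn r (r' + e)) (kap + 'X^e * kap').
Proof.
move=> [[n1 [hd1 [gd1 [D1 [g1 [h1 l1]]]]]] [H H1 H2]].
move=> [[n2 [hd2 [gd2 [D2 [g2 [h2 l2]]]]]] [H' H1' H2']]; split.
  have [D [g hr]] := horseshoe_res hI hf hJ h2 h1.
  exists (n2 + n1)%N; do 2!eexists; exists D, g; split; first exact: hr.
  move=> a; case: (split_ordP a) => a' ->; rewrite !joinE.
    by move: (l2 a') (leq_maxr r (r' + e)); lia.
  by apply: leq_trans (l1 _) _; rewrite leq_add2l leq_maxl.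
exists (fun m => H m + (if e <= m then H' (m - e) else 0))%N => m.
  case: leqP => le; first exact: quotient_dim_add hI hf hJ _ _ _ le (H1 m) (H1' _).
  by rewrite addn0; apply: (quotient_dim_low hI hf le).
by rewrite convD convXn -H2 PoszD; case: leqP => le; rewrite ?H2'.
Qed.

End AddForm.

(** In [cocone_res] basis vectors from S/I lose an internal degree only, which gives [r.-1]; those
    from S/(I + (f)) lose one of each kind, which keeps [r']. The gain of 1 on the first side is
    what stops the regularity of cliques from growing. *)
Lemma good_cocone I J f r r' kap kap' kapJ : homog_ideal I ->
  shift_homog 1 0 f -> is_colon I f J -> ~ ideal_add I f 1 ->
  kap - kap' = 'X * kapJ -> good I r kap -> good (ideal_add I f) r' kap' ->
  good J (maxn r.-1 r') kapJ.
Proof.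
move=> hI hf hJ h1 ek [[n1 [hd1 [gd1 [D1 [g1 [r1 l1]]]]]] [H H1 H2]].
move=> [[n2 [hd2 [gd2 [D2 [g2 [r2 l2]]]]]] [H' H1' H2']].
have hJI := homog_ideal_colon hI hf hJ; have hIf := homog_ideal_add hI hf.
have h1' : ~ I 1 by move=> h; apply: h1; exists 0; rewrite mul0r subr0.
split.
  have [m1 [i1 [B1 [b1 [s1 min1]]]]] := minimal_res hI r1.
  have [o1 [c1 N1]] := minimal_normal hI h1' s1 min1.
  have [m2 [i2 [B2 [b2 [s2 min2]]]]] := minimal_res hIf r2.
  have [o2 [c2 N2]] := minimal_normal hIf h1 s2 min2.
  have [D [g hr]] := cocone_res hI hf hJ h1 N1 N2.
  do 3!eexists; exists D, g; split; first exact: hr.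
  have [_ u2 _ _ le2] := N2; have [_ u1 _ _ le1] := N1.
  move=> a; case: (split_ordP a) => a' ->; rewrite !joinE.
    have l := l1 (i1 (enum_val a')); rewrite /=.
    move: l (leq_maxl r.-1 r'); lia.
  have l := l2 (i2 (enum_val a')); rewrite /=.
  have := enum_valP a'; rewrite !inE -u2 /=.
  move: l (leq_maxr r.-1 r'); lia.
exists (fun m => H m.+1 - H' m.+1)%N => m.
  have [s hs] := quotient_dim_exists m hJI.
  have hs' : quotient_dim J (m.+1 - 1) s by rewrite subn1.
  by rewrite (quotient_dim_uniq hI (H1 m.+1) (quotient_dim_add hI hf hJ (ltn0Sn m) (H1' _) hs')) addKn.
have [s hs] := quotient_dim_exists m hJI.
have hs' : quotient_dim J (m.+1 - 1) s by rewrite subn1.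
rewrite -subzn ?H2 ?H2'; last first.
  by rewrite (quotient_dim_uniq hI (H1 m.+1) (quotient_dim_add hI hf hJ (ltn0Sn m) (H1' _) hs')) leq_addr.
by rewrite -convB ek -['X]expr1 convXn subn1.
Qed.

End Good.

(** * Edge ideals of cliques are prime *)

Section GeneratedIdeals.

Variables (K : fieldType) (N : nat).
Local Notation S := {mpoly K[N]}.
Implicit Types (p q f g : S) (G H : S -> Prop).

Inductive ideal_gen G : S -> Prop :=
| ideal_gen0 : ideal_gen G 0
| ideal_gen_add a g p : G g -> ideal_gen G p -> ideal_gen G (a * g + p).

Lemma ideal_gen_lin G a p q :
  ideal_gen G p -> ideal_gen G q -> ideal_gen G (a * p + q).
Proof.
move=> hp hq; elim: hp => [|b g p' hg _ IH]; first by rewrite mulr0 add0r.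
by rewrite mulrDr mulrA -addrA; apply: ideal_gen_add.
Qed.

Lemma ideal_gen_id G g : G g -> ideal_gen G g.
Proof.
by move=> hg; have := ideal_gen_add 1 hg (ideal_gen0 G); rewrite mul1r addr0.
Qed.

Lemma homog_ideal_gen G : (forall g, G g -> exists d, shift_homog d 0 g) ->
  homog_ideal (ideal_gen G).
Proof.
move=> hG; split; [exact: ideal_gen0 | exact: ideal_gen_lin |].
move=> a b p; elim=> [|c g q hg _ IH].
  by rewrite raddf0; apply: ideal_gen0.
have [d hd] := hG g hg; rewrite raddfD /= (@shift_projM _ _ _ (d + b) b).
  exact: ideal_gen_add.
by rewrite -{2}[b]add0n; apply: shift_homog_add.
Qed.

Lemma ideal_gen_min G (I : S -> Prop) p : homog_ideal I ->
  (forall g, G g -> I g) -> ideal_gen G p -> I p.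
Proof.
move=> hI hG; elim=> [|a g q hg _ hq]; first exact: ideal0.
by apply: idealD => //; apply: idealMl => //; apply: hG.
Qed.

End GeneratedIdeals.

Section GraphIdeals.

Variables (K : fieldType) (n : nat).
Local Notation S := {mpoly K[n + n]}.
Implicit Types (p q f : S) (e : rel 'I_n) (kx ky : pred 'I_n) (i j : 'I_n).
Local Notation x i := (xvar K i).
Local Notation y i := (yvar K i).

Definition edge_minor (i j : 'I_n) : S := x i * y j - y i * x j.

(** Killed variables are part of the data so that adding a variable, and every colon met below,
    stays inside one family of ideals. *)
Definition graph_gens e kx ky : S -> Prop := fun g =>
  [\/ exists i j, e i j /\ g = edge_minor i j, exists2 i, kx i & g = x i
    | exists2 i, ky i & g = y i].

Definition graph_ideal e kx ky : S -> Prop := ideal_gen (graph_gens e kx ky).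

Lemma xvar_homog i : shift_homog 1 0 (x i).
Proof. exact: shift_homogX. Qed.

Lemma yvar_homog i : shift_homog 1 0 (y i).
Proof. exact: shift_homogX. Qed.

Lemma edge_minor_homog i j : shift_homog 2 0 (edge_minor i j).
Proof.
by apply: shift_homogB; apply: (@shift_homogM _ _ _ 1); apply: shift_homogX.
Qed.

Lemma graph_ideal_homog e kx ky : homog_ideal (graph_ideal e kx ky).
Proof.
apply: homog_ideal_gen => g [[i [j [_ ->]]]|[i _ ->]|[i _ ->]].
- by exists 2; apply: edge_minor_homog.
- by exists 1%N; apply: xvar_homog.
- by exists 1%N; apply: yvar_homog.
Qed.

Lemma graph_edge e kx ky i j : e i j -> graph_ideal e kx ky (edge_minor i j).
Proof. by move=> h; apply: ideal_gen_id; constructor 1; exists i, j. Qed.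

Lemma graph_x e kx ky i : kx i -> graph_ideal e kx ky (x i).
Proof. by move=> h; apply: ideal_gen_id; constructor 2; exists i. Qed.

Lemma graph_y e kx ky i : ky i -> graph_ideal e kx ky (y i).
Proof. by move=> h; apply: ideal_gen_id; constructor 3; exists i. Qed.

Lemma graph_ideal_min e kx ky (I : S -> Prop) p : homog_ideal I ->
  (forall i j, e i j -> I (edge_minor i j)) -> (forall i, kx i -> I (x i)) ->
  (forall i, ky i -> I (y i)) -> graph_ideal e kx ky p -> I p.
Proof.
move=> hI h1 h2 h3; apply: ideal_gen_min => // g.
by case=> [[i [j [hij ->]]]|[i hi ->]|[i hi ->]]; [apply: h1|apply: h2|apply: h3].
Qed.

Lemma edge_minor_sym i j : edge_minor i j = - edge_minor j i.
Proof. by rewrite /edge_minor; ring. Qed.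

Lemma edge_minor_diag i : edge_minor i i = 0.
Proof. by rewrite /edge_minor mulrC subrr. Qed.

Section Prime.

Variables (e : rel 'I_n) (kx ky : pred 'I_n).

Local Notation P := {mpoly K[n + n + n]}.

Definition svar (i : 'I_n) : 'I_(n + n + n) := lshift n (lshift n i).
Definition tvar (i : 'I_n) : 'I_(n + n + n) := lshift n (rshift n i).
Definition uvar (i : 'I_n) : 'I_(n + n + n) := rshift (n + n) i.

(** A canonical representative of the clique of i. The relation need not be reflexive, and a vertex
    related to nothing represents itself. *)
Definition class_of i : 'I_n := odflt i [pick j | e i j].

Definition killed (v : 'I_(n + n)) : bool := join kx ky v.

Definition param_mon (v : 'I_(n + n)) : 'X_{1..n + n + n} :=
  join (fun i => U_(svar (class_of i)) + U_(uvar i))%MM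
       (fun i => U_(tvar (class_of i)) + U_(uvar i))%MM v.

Definition param_var (v : 'I_(n + n)) : P :=
  if killed v then 0 else 'X_[param_mon v].

(* x_i |-> s_c u_i and y_i |-> t_c u_i, with c the class of i; killed variables
   go to 0. *)
Definition param : S -> P := mmap (@mpolyC _ K) param_var.

HB.instance Definition _ := GRing.RMorphism.on param.

Definition param_exp (m : 'X_{1..n + n}) : 'X_{1..n + n + n} :=
  (\sum_v param_mon v *+ m v)%MM.

Definition alive (m : 'X_{1..n + n}) : bool :=
  [forall v, killed v ==> (m v == 0%N)].

Lemma param_x i : param (x i) = if kx i then 0 else 'X_(svar (class_of i)) * 'X_(uvar i).
Proof.
rewrite /param /xvar mmapX mmap1U /param_var /killed /param_mon !joinE.
by rewrite mpolyXD.
Qed.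

Lemma param_y i : param (y i) = if ky i then 0 else 'X_(tvar (class_of i)) * 'X_(uvar i).
Proof.
rewrite /param /yvar mmapX mmap1U /param_var /killed /param_mon !joinE.
by rewrite mpolyXD.
Qed.

Lemma param_X m : param 'X_[m] = if alive m then 'X_[param_exp m] else 0.
Proof.
rewrite /param mmapX /mmap1; case: ifP => [/forallP h|/negbT].
  rewrite -mprodXnE; apply: eq_bigr => v _; rewrite /param_var.
  by have := h v; case: ifP => //= _ /eqP ->; rewrite !expr0.
rewrite negb_forall => /existsP[v]; rewrite negb_imply => /andP[hv nz].
by rewrite (bigD1 v) //= /param_var hv expr0n (negbTE nz) mul0r.
Qed.

Lemma param_expD m1 m2 : param_exp (m1 + m2) = (param_exp m1 + param_exp m2)%MM.
Proof.
rewrite /param_exp -big_split /=; apply: eq_bigr => v _.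
by apply/mnmP => i; rewrite !(mnmDE, mulmnE) mulnDr.
Qed.

Lemma param_expU v : param_exp U_(v) = param_mon v.
Proof.
rewrite /param_exp (bigD1 v) //= mnm1E eqxx mulm1n big1 ?addm0 // => w ne.
by rewrite mnm1E eq_sym (negbTE ne) mulm0n.
Qed.

Lemma param_exp_u m i : param_exp m (uvar i) = (m (lshift n i) + m (rshift n i))%N.
Proof.
rewrite mnm_sumE big_split_ord /=; congr (_ + _)%N; rewrite (bigD1 i) //= big1.
- by rewrite addn0 mulmnE /param_mon joinE mnmDE !mnm1E eq_lrshift eqxx mul1n.
- move=> j ne; rewrite mulmnE /param_mon joinE mnmDE !mnm1E eq_lrshift.
  by rewrite eq_rshift (negbTE ne).
- by rewrite addn0 mulmnE /param_mon joinE mnmDE !mnm1E eq_lrshift eqxx mul1n.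
- move=> j ne; rewrite mulmnE /param_mon joinE mnmDE !mnm1E eq_lrshift.
  by rewrite eq_rshift (negbTE ne).
Qed.

Lemma param_exp_s m c : param_exp m (svar c) =
  (\sum_(i | class_of i == c) m (lshift n i))%N.
Proof.
rewrite mnm_sumE big_split_ord /= [X in (_ + X)%N]big1 ?addn0.
  rewrite [RHS]big_mkcond; apply: eq_bigr => i _.
  rewrite mulmnE /param_mon joinE mnmDE !mnm1E eq_rlshift addn0 !eq_lshift.
  by case: eqP; rewrite ?mul1n ?mul0n.
move=> i _; rewrite mulmnE /param_mon joinE mnmDE !mnm1E eq_rlshift eq_lshift.
by rewrite eq_rlshift.
Qed.

(** The condition [e_kill] says that the two terms of an edge binomial are killed together;
    otherwise [param] would send the binomial to a nonzero monomial. *)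
Hypotheses (e_sym : ssrbool.symmetric e) (e_trans : transitive e)
  (e_kill : forall i j, e i j -> kx i || ky j = ky i || kx j).

Lemma class_of_rel i j : e i j -> class_of i = class_of j.
Proof.
move=> eij; rewrite /class_of.
have eij' : e i =1 e j.
  by move=> k; apply/idP/idP => h; [apply: e_trans h; rewrite e_sym | apply: e_trans h].
rewrite (eq_pick eij').
by case: pickP => //= /(_ i); rewrite e_sym eij.
Qed.

Lemma rel_class_of i j : class_of i = class_of j -> i = j \/ e i j.
Proof.
rewrite /class_of; case: pickP => [k hk|_] /=; case: pickP => [k' hk'|_] /= ek.
- by right; rewrite -ek e_sym in hk'; apply: e_trans hk'.
- by right; rewrite -ek.
- by right; rewrite ek e_sym.
- by left.
Qed.

Lemma graph_ideal_param p : graph_ideal e kx ky p -> param p = 0.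
Proof.
elim=> [|a g q hg _ IH]; first exact: rmorph0.
rewrite rmorphD rmorphM /= IH addr0.
suff -> : param g = 0 by rewrite mulr0.
case: hg => [[i [j [eij ->]]]|[i hi ->]|[i hi ->]].
- rewrite /edge_minor rmorphB !rmorphM /= !param_x !param_y (class_of_rel eij).
  by have := e_kill eij; case: (kx i); case: (ky i); case: (kx j); case: (ky j) => //= _;
    rewrite ?mulr0 ?mul0r ?subrr //; ring.
- by rewrite param_x hi.
- by rewrite param_y hi.
Qed.

(** Equal images mean equal degrees in each pair x_i, y_i and equal x-degree on each class. If m has
    too many x_i, some j in the class of i has too few x_j; exchanging x_i y_j for y_i x_j changes m
    by a multiple of an edge binomial and lowers the total excess. *)
Lemma param_exp_eq m m' : param_exp m = param_exp m' ->
  graph_ideal e kx ky ('X_[m] - 'X_[m']).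
Proof.
have [d] := ubnP (\sum_i (m (lshift n i) - m' (lshift n i)))%N.
elim: d => // d IH in m *; rewrite ltnS => hd emm.
have eu i : (m (lshift n i) + m (rshift n i) = m' (lshift n i) + m' (rshift n i))%N.
  by rewrite -!param_exp_u emm.
have es c : (\sum_(i | class_of i == c) m (lshift n i) =
             \sum_(i | class_of i == c) m' (lshift n i))%N.
  by rewrite -!param_exp_s emm.
have strict (a b : 'I_n -> nat) i : (a i < b i)%N ->
    (forall j, class_of j = class_of i -> a j <= b j)%N ->
    (\sum_(j | class_of j == class_of i) a j <
     \sum_(j | class_of j == class_of i) b j)%N.
  move=> lt le; rewrite (bigD1 i) //= [X in (_ < X)%N](bigD1 i) //=.
  rewrite -addSn leq_add // leq_sum // => j /andP[/eqP hj _]; exact: le.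
have [/existsP[i lti]|] := boolP [exists i, m' (lshift n i) < m (lshift n i)]%N; last first.
  rewrite negb_exists => /forallP h.
  have le i : (m (lshift n i) <= m' (lshift n i))%N by rewrite leqNgt h.
  have eqx i : m (lshift n i) = m' (lshift n i).
    apply/eqP; rewrite eqn_leq le leqNgt; apply/negP => lt.
    have := strict (fun i => m (lshift n i)) (fun i => m' (lshift n i)) i lt (fun j _ => le j).
    by rewrite es ltnn.
  have -> : m = m'.
    apply/mnmP => v; case: (split_ordP v) => i ->; first exact: eqx.
    by have := eu i; rewrite eqx => /addnI.
  by rewrite subrr; apply: ideal_gen0.
have /existsP[j /andP[/eqP cj ltj]] :
    [exists j, (class_of j == class_of i) && (m (lshift n j) < m' (lshift n j))%N].
  apply: contraT; rewrite negb_exists => /forallP h.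
  have := strict (fun i => m' (lshift n i)) (fun i => m (lshift n i)) i lti.
  rewrite es ltnn => ->// k hk; have := h k; rewrite hk eqxx /= -leqNgt.
  by [].
have neij : i != j by apply: contraTneq lti => ->; rewrite -leqNgt ltnW.
have eij : e i j by case: (rel_class_of (esym cj)) neij => // ->; rewrite eqxx.
pose xi := lshift n i; pose yj := rshift n j; pose xj := lshift n j; pose yi := rshift n i.
pose m0 := (m - U_(xi) - U_(yj))%MM.
have em : m = (m0 + U_(yj) + U_(xi))%MM.
  apply/mnmP => v; rewrite !mnmDE !mnmBE !mnm1E.
  have := eu j; rewrite -/xi -/yj -/xj => hj.
  have [<-|nv] := eqVneq xi v.
    by rewrite /yj eq_rlshift; move: lti; rewrite -/xi; lia.
  have [<-|nv'] := eqVneq yj v; last by lia.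
  by move: ltj hj; rewrite -/xj; lia.
pose m1 := (m0 + U_(xj) + U_(yi))%MM.
have em1 : param_exp m1 = param_exp m.
  rewrite em /m1 !param_expD !param_expU /param_mon !joinE cj.
  by apply/mnmP => v; rewrite !mnmDE; lia.
have -> : 'X_[m] - 'X_[m'] = 'X_[m0] * edge_minor i j + ('X_[m1] - 'X_[m']) :> S.
  rewrite {1}em /m1 !mpolyXD /edge_minor /xvar /yvar -/xi -/xj -/yi -/yj; ring.
apply: ideal_gen_add; first by constructor 1; exists i, j.
apply: IH; last by rewrite em1.
apply: leq_trans hd; rewrite (bigD1 i) //= [X in (_ < X)%N](bigD1 i) //=.
rewrite -addSn leq_add //.
  rewrite /m1 /m0 !mnmDE !mnmBE !mnm1E -/xi -/xj -/yi -/yj.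
  rewrite /xi /xj /yi /yj eqxx !eq_rlshift eq_lshift eq_sym (negbTE neij).
  by move: lti; lia.
apply: leq_sum => k nk.
rewrite /m1 /m0 !mnmDE !mnmBE !mnm1E /xi /xj /yi /yj !eq_rlshift !eq_lshift.
rewrite [i == k]eq_sym (negbTE nk).
by have [<-|_] := eqVneq j k; move: ltj; lia.
Qed.

Lemma mcoeff_neq m (p : S) (k : K) q : q = p - k *: 'X_[m] -> k = p@_m ->
  forall m', m' \in msupp q -> m' \in msupp p /\ m' != m.
Proof.
move=> -> -> m'; rewrite !mcoeff_msupp mcoeffB mcoeffZ mcoeffX.
have [->|ne] := eqVneq m m'; first by rewrite mulr1 subrr eqxx.
by rewrite mulr0 subr0 eq_sym.
Qed.

(** Induction on the number of monomials. A monomial with a killed variable is in the ideal. Any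
    other one must have its image cancelled by some other monomial of p with the same image, and
    [param_exp_eq] lets the first be replaced by the second. *)
Lemma param_graph_ideal p : param p = 0 -> graph_ideal e kx ky p.
Proof.
have hI := graph_ideal_homog e kx ky.
have [d] := ubnP (size (msupp p)).
elim: d => // d IH in p *; rewrite ltnS => hd hp.
case es : (msupp p) => [|m s].
  by rewrite (msuppnil0 es); apply: ideal_gen0.
have mp : m \in msupp p by rewrite es mem_head.
have step r : (forall m', m' \in msupp (p - r) -> m' \in msupp p /\ m' != m) ->
    param r = 0 -> graph_ideal e kx ky r -> graph_ideal e kx ky p.
  move=> hsub pr hr; rewrite -(subrK r p); apply: idealD => //; apply: IH.
    apply: leq_trans hd; rewrite es ltnS; apply: uniq_leq_size => // m' /hsub[].
    by rewrite es inE => /orP[/eqP ->|//]; rewrite eqxx.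
  by rewrite rmorphB /= hp pr subrr.
have [al|al] := boolP (alive m); last first.
  apply: (step (p@_m *: 'X_[m])) => [|| ].
  - exact: mcoeff_neq.
  - by rewrite -mul_mpolyC rmorphM /= param_X (negbTE al) mulr0.
  - move: al; rewrite negb_forall => /existsP[v]; rewrite negb_imply => /andP[kv nz].
    have -> : m = (m - U_(v) + U_(v))%MM.
      by rewrite submK // lep1mP.
    rewrite mpolyXD scalerAl; apply: idealMl => //.
    move: kv; rewrite /killed; case: (split_ordP v) => i ->; rewrite joinE => ki.
      exact: graph_x.
    exact: graph_y.
have [m' [m'p m'm alm' em']] : exists m',
    [/\ m' \in msupp p, m' != m, alive m' & param_exp m' = param_exp m].
  apply: NNPP => none.
  have := congr1 (mcoeff (param_exp m)) hp; rewrite mcoeff0.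
  rewrite [p in param p]mpolyE rmorph_sum raddf_sum /= (bigD1_seq m) //=.
  rewrite -mul_mpolyC rmorphM /= param_X al {1}/param mmapC mcoeffCM mcoeffX eqxx mulr1.
  rewrite big_seq_cond big1 => [|m' /andP[m'p ne]].
    by rewrite addr0 => /eqP; rewrite mcoeff_eq0 mp.
  rewrite -mul_mpolyC rmorphM /= param_X {1}/param mmapC mcoeffCM.
  case: ifP => al'; last by rewrite mcoeff0 mulr0.
  rewrite mcoeffX; case: eqP => [ee|]; last by rewrite mulr0.
  by case: none; exists m'.
apply: (step (p@_m *: ('X_[m] - 'X_[m']))).
- move=> k; rewrite !mcoeff_msupp mcoeffB mcoeffZ mcoeffB !mcoeffX.
  have [<-|ne] := eqVneq m k; first by rewrite (negbTE m'm) subr0 mulr1 subrr eqxx.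
  rewrite sub0r; have [<- _|ne'] := eqVneq m' k; first by rewrite -mcoeff_msupp.
  by rewrite oppr0 mulr0 subr0 eq_sym.
- by rewrite -mul_mpolyC rmorphM rmorphB /= !param_X al alm' em' subrr mulr0.
- by apply: idealZ => //; apply: param_exp_eq.
Qed.

Lemma graph_idealE p : graph_ideal e kx ky p <-> param p = 0.
Proof. by split; [apply: graph_ideal_param | apply: param_graph_ideal]. Qed.

(** The ideal is the kernel of a map to a domain, so whatever survives the map is a
    nonzerodivisor. *)
Lemma graph_colon f : param f != 0 ->
  is_colon (graph_ideal e kx ky) f (graph_ideal e kx ky).
Proof.
move=> hf p; rewrite !graph_idealE rmorphM /=; split=> [->|/eqP].
  by rewrite mul0r.
by rewrite mulf_eq0 (negbTE hf) orbF => /eqP.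
Qed.

Lemma graph_prime : prime_ideal (graph_ideal e kx ky).
Proof.
have hI := graph_ideal_homog e kx ky; split.
- exact: ideal0.
- by move=> a p q hp hq; apply: idealD => //; apply: idealMl.
- by move/graph_idealE; rewrite rmorph1 => /eqP; rewrite oner_eq0.
- move=> p q /graph_idealE; rewrite rmorphM => /eqP.
  by rewrite mulf_eq0 => /orP[] /eqP h; [left | right]; apply/graph_idealE.
Qed.

Lemma mpolyX_neq0 m (k : 'X_{1..m}) : 'X_[K, k] != 0.
Proof. by rewrite -msupp_eq0 msuppX. Qed.

Lemma param_x_neq0 i : ~~ kx i -> param (x i) != 0.
Proof. by move=> h; rewrite param_x (negbTE h) -mpolyXD mpolyX_neq0. Qed.

Lemma param_y_neq0 i : ~~ ky i -> param (y i) != 0.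
Proof. by move=> h; rewrite param_y (negbTE h) -mpolyXD mpolyX_neq0. Qed.

Lemma param_edge_neq0 i j : i != j -> ~~ e i j -> ~~ kx i -> ~~ ky j ->
  param (edge_minor i j) != 0.
Proof.
move=> ne neij ki kj; rewrite /edge_minor rmorphB !rmorphM /= !param_x !param_y.
rewrite (negbTE ki) (negbTE kj) -!mpolyXD.
have [|_] := boolP (ky i); first by rewrite mul0r subr0 mpolyX_neq0.
have [|_] := boolP (kx j); first by rewrite mulr0 subr0 mpolyX_neq0.
rewrite -mpolyXD; apply/eqP => /(congr1 (mcoeff
  (U_(svar (class_of i)) + U_(uvar i) + (U_(tvar (class_of j)) + U_(uvar j)))%MM)).
rewrite mcoeffB mcoeff0 !mcoeffX eqxx; case: eqP => [h|_]; last first.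
  by rewrite subr0 => /eqP; rewrite oner_eq0.
have := congr1 (fun m : 'X_{1.. _} => m (svar (class_of i))) h.
rewrite !mnmDE !mnm1E !eq_rlshift eqxx !eq_lshift eq_rlshift.
case: eqP => // /esym/rel_class_of[eq|eij]; first by rewrite eq eqxx in ne.
by rewrite eij in neij.
Qed.

End Prime.

End GraphIdeals.

(** * Adding cliques and killing variables *)

Section Cliques.

Variables (K : fieldType) (n : nat).
Local Notation S := {mpoly K[n + n]}.
Implicit Types (p q f : S) (e : rel 'I_n) (kx ky : pred 'I_n) (i j : 'I_n).
Implicit Types (C : seq 'I_n) (kap : {poly int}).
Local Notation x i := (xvar K i).
Local Notation y i := (yvar K i).
Local Notation "[ 'f' i j ]" := (edge_minor K i j) (at level 0, i, j at level 0).
Local Notation GI := (@graph_ideal K n).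

(* Under these conditions the ideal is prime. *)
Definition cliques_with_kills e kx ky : Prop :=
  [/\ ssrbool.symmetric e, transitive e
    & forall i j, e i j -> kx i || ky j = ky i || kx j].

Definition isolated e i : Prop := forall j, ~~ e i j.

Definition add_clique e C : rel 'I_n := fun i j => e i j || (i \in C) && (j \in C).

Definition kill kx C : pred 'I_n := fun i => kx i || (i \in C).

Lemma graph_ideal_eq e e' kx kx' ky ky' p :
  e =2 e' -> kx =1 kx' -> ky =1 ky' -> GI e kx ky p <-> GI e' kx' ky' p.
Proof.
move=> h1 h2 h3; split; apply: graph_ideal_min; try exact: graph_ideal_homog.
- by move=> i j; rewrite h1; apply: graph_edge.
- by move=> i; rewrite h2; apply: graph_x.
- by move=> i; rewrite h3; apply: graph_y.
- by move=> i j; rewrite -h1; apply: graph_edge.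
- by move=> i; rewrite -h2; apply: graph_x.
- by move=> i; rewrite -h3; apply: graph_y.
Qed.

Lemma graph_ideal_empty e kx ky p : (forall i j, ~~ e i j) ->
  (forall i, ~~ kx i) -> (forall i, ~~ ky i) -> p = 0 <-> GI e kx ky p.
Proof.
move=> he hx hy; split=> [->|]; first exact: (ideal0 (graph_ideal_homog K _ _ _)).
have h0 : homog_ideal (fun p : S => p = 0).
  split=> [//|a q q' -> ->|a b q ->]; first by rewrite mulr0 addr0.
  by rewrite raddf0.
apply: (graph_ideal_min h0) => [i j|i|i].
- by rewrite (negbTE (he i j)).
- by rewrite (negbTE (hx i)).
- by rewrite (negbTE (hy i)).
Qed.

Lemma ideal_addW (I : S -> Prop) f p : I p -> ideal_add I f p.
Proof. by move=> h; exists 0; rewrite mul0r subr0. Qed.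

Lemma ideal_add_self (I : S -> Prop) f : homog_ideal I -> ideal_add I f f.
Proof. by move=> hI; exists 1; rewrite mul1r subrr; apply: ideal0. Qed.

Lemma ideal_add_min (I J : S -> Prop) f p : homog_ideal J ->
  (forall q, I q -> J q) -> J f -> ideal_add I f p -> J p.
Proof.
move=> hJ h hf [q /h hq]; rewrite -(subrK (q * f) p); apply: idealD => //.
exact: idealMl.
Qed.

Lemma graph_add_x e kx ky i p :
  ideal_add (GI e kx ky) (x i) p <-> GI e (kill kx [:: i]) ky p.
Proof.
split.
  apply: ideal_add_min; first exact: graph_ideal_homog.
    move=> q; apply: graph_ideal_min; first exact: graph_ideal_homog.
    - exact: graph_edge.
    - by move=> j h; apply: graph_x; rewrite /kill h.
    - exact: graph_y.
  by apply: graph_x; rewrite /kill mem_head orbT.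
have hI := graph_ideal_homog K e kx ky.
apply: graph_ideal_min; first exact: homog_ideal_add hI (xvar_homog K i).
- by move=> a b h; apply/ideal_addW/graph_edge.
- move=> j /orP[h|]; first by apply/ideal_addW/graph_x.
  by rewrite inE => /eqP ->; apply: ideal_add_self.
- by move=> j h; apply/ideal_addW/graph_y.
Qed.

Lemma graph_add_y e kx ky i p :
  ideal_add (GI e kx ky) (y i) p <-> GI e kx (kill ky [:: i]) p.
Proof.
split.
  apply: ideal_add_min; first exact: graph_ideal_homog.
    move=> q; apply: graph_ideal_min; first exact: graph_ideal_homog.
    - exact: graph_edge.
    - exact: graph_x.
    - by move=> j h; apply: graph_y; rewrite /kill h.
  by apply: graph_y; rewrite /kill mem_head orbT.
have hI := graph_ideal_homog K e kx ky.
apply: graph_ideal_min; first exact: homog_ideal_add hI (yvar_homog K i).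
- by move=> a b h; apply/ideal_addW/graph_edge.
- by move=> j h; apply/ideal_addW/graph_x.
- move=> j /orP[h|]; first by apply/ideal_addW/graph_y.
  by rewrite inE => /eqP ->; apply: ideal_add_self.
Qed.

(** Here x_i is a nonzerodivisor of degree 1: the cone of the resolution with itself keeps the
    regularity bound and multiplies the series by 1 - t. *)
Lemma good_kill_x1 e kx ky i r kap : cliques_with_kills e kx ky -> ~~ kx i ->
  good (GI e kx ky) r kap -> good (GI e (kill kx [:: i]) ky) r (kap * (1 - 'X)).
Proof.
move=> [h1 h2 h3] hi hg.
have hI := graph_ideal_homog K e kx ky.
have hc := graph_colon h1 h2 h3 (param_x_neq0 K e ky hi).
have := good_cone hI (xvar_homog K i) hc isT hg hg.
rewrite addn1 maxnn expr1 => g; apply: good_ext (graph_add_x e kx ky i) _.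
by rewrite mulrBr mulr1 [kap * _]mulrC.
Qed.

Lemma good_kill_y1 e kx ky i r kap : cliques_with_kills e kx ky -> ~~ ky i ->
  good (GI e kx ky) r kap -> good (GI e kx (kill ky [:: i])) r (kap * (1 - 'X)).
Proof.
move=> [h1 h2 h3] hi hg.
have hI := graph_ideal_homog K e kx ky.
have hc := graph_colon h1 h2 h3 (param_y_neq0 K e kx hi).
have := good_cone hI (yvar_homog K i) hc isT hg hg.
rewrite addn1 maxnn expr1 => g; apply: good_ext (graph_add_y e kx ky i) _.
by rewrite mulrBr mulr1 [kap * _]mulrC.
Qed.

(** Used with all variables killed: the quotient is then K, and the numerator yields the Hilbert
    series of S itself in [conv_monomials]. *)
Lemma good_isolated C D : uniq C -> uniq D ->
  good (GI (fun _ _ => false) (mem C) (mem D)) 0 ((1 - 'X) ^+ (size C + size D)).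
Proof.
have cfg kx ky : cliques_with_kills (fun _ _ => false) kx ky by split.
move=> uC; elim: D => [|j D IH] /= => [_|/andP[jD uD]].
  elim: C uC => [_|i C IH /= /andP[iC uC]].
    by apply: good_ext (good_zero K _) => p; apply: graph_ideal_empty.
  have := good_kill_x1 (cfg _ _) iC (IH uC).
  rewrite -exprSr; apply: good_ext => p; apply: graph_ideal_eq => // i'.
  by rewrite /kill /= !inE orbC.
have := good_kill_y1 (cfg _ _) jD (IH uD).
rewrite -exprSr addnS; apply: good_ext => p; apply: graph_ideal_eq => // i'.
by rewrite /kill /= !inE orbC.
Qed.

Lemma kill_x_config e kx ky C : cliques_with_kills e kx ky ->
  {in C, forall i, isolated e i} -> cliques_with_kills e (kill kx C) ky.
Proof.
move=> [h1 h2 h3] hC; split=> // i j eij; rewrite /kill.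
have iC : i \in C = false by apply: contraTF eij => /hC/(_ j).
have jC : j \in C = false by apply: contraTF eij => /hC/(_ i); rewrite h1.
by rewrite iC jC !orbF; apply: h3.
Qed.

Lemma kill_y_config e kx ky C : cliques_with_kills e kx ky ->
  {in C, forall i, isolated e i} -> cliques_with_kills e kx (kill ky C).
Proof.
move=> [h1 h2 h3] hC; split=> // i j eij; rewrite /kill.
have iC : i \in C = false by apply: contraTF eij => /hC/(_ j).
have jC : j \in C = false by apply: contraTF eij => /hC/(_ i); rewrite h1.
by rewrite iC jC !orbF; apply: h3.
Qed.

Lemma good_kill_x e kx ky C r kap : cliques_with_kills e kx ky -> uniq C ->
  {in C, forall i, isolated e i} -> {in C, forall i, ~~ kx i} ->
  good (GI e kx ky) r kap ->
  good (GI e (kill kx C) ky) r (kap * (1 - 'X) ^+ size C).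
Proof.
elim: C kx kap => [|i C IH] kx kap hcfg.
  move=> _ _ _; rewrite expr0 mulr1; apply: good_ext => p.
  by apply: graph_ideal_eq => // j; rewrite /kill orbF.
move=> /= /andP[iC uC] iso hk hg.
have iso' : {in [:: i], forall j, isolated e j}.
  by move=> j; rewrite inE => /eqP ->; apply: iso; rewrite mem_head.
have hg' := good_kill_x1 hcfg (hk i (mem_head _ _)) hg.
have := IH _ _ (kill_x_config hcfg iso') uC _ _ hg'.
rewrite exprS -mulrA => g; apply: good_ext (g _ _) => [p|j jC|j jC].
- by apply: graph_ideal_eq => // j; rewrite /kill !inE orbA.
- by apply: iso; rewrite inE jC orbT.
- rewrite /kill !inE negb_or hk ?inE ?jC ?orbT //=.
  by apply: contraNneq iC => <-.
Qed.

Lemma add_clique_config e kx ky C : cliques_with_kills e kx ky ->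
  {in C, forall i, isolated e i} -> {in C, forall i, ~~ kx i && ~~ ky i} ->
  cliques_with_kills (add_clique e C) kx ky.
Proof.
move=> [h1 h2 h3] hC hk; split=> [i j|j i l|i j].
- by rewrite /add_clique h1 [(j \in C) && _]andbC.
- rewrite /add_clique => /orP[eij|/andP[iC jC]] /orP[ejl|/andP[jC' lC]].
  + by rewrite (h2 _ _ _ eij ejl).
  + by have := hC j jC' i; rewrite h1 eij.
  + by have := hC j jC l; rewrite ejl.
  + by rewrite iC lC orbT.
- rewrite /add_clique => /orP[/h3 //|/andP[/hk/andP[/negbTE -> /negbTE ->]]].
  by move=> /hk/andP[/negbTE -> /negbTE ->].
Qed.

Lemma clique_sub_kill e kx ky C D a p : {subset C <= D} -> a \in D ->
  GI (add_clique e C) (kill kx [:: a]) ky p -> GI e (kill kx D) ky p.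
Proof.
move=> sub aD; have hX := graph_ideal_homog K e (kill kx D) ky.
apply: (graph_ideal_min hX) => [i j /orP[|/andP[iC jC]]|i|i].
- exact: graph_edge.
- rewrite /edge_minor; apply: (idealB hX).
    by apply: (idealMr hX); apply: graph_x; rewrite /kill sub ?orbT.
  by apply: (idealMl hX); apply: graph_x; rewrite /kill sub ?orbT.
- move=> /orP[ki|]; first by apply: graph_x; rewrite /kill ki.
  by rewrite inE => /eqP ->; apply: graph_x; rewrite /kill aD orbT.
- exact: graph_y.
Qed.

(** The numerator over (1 - t)^(2m) for the 2-minors of a generic 2 x m matrix, whose quotient has
    dimension m + 1 and h-polynomial 1 + (m - 1) t. *)
Definition clique_num m : {poly int} := (1 - 'X) ^+ m.-1 * (1 + 'X *+ m.-1).

(** The bookkeeping of numerators in [good_clique], with [z] for t, [w] for the power of 1 - t and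
    [m] for the multiple of t, so that [ring] meets no symbolic exponent. *)
Lemma clique_num_rec (R : comNzRingType) (k w m z : R) :
  k * (w * (1 + m)) - z ^+ 2 * (k * (w * (1 + m))) -
    (k * (w * (1 + m)) * (1 - z) - z ^+ 2 * (k * ((1 - z) * w))) =
  z * (k * ((1 - z) * w * (1 + (z + m)))).
Proof. ring. Qed.

(** Induction on the clique, adding a vertex z to C' containing a. Let I be the ideal [J1] of C'
    plus the single minor of a and z. Then the new ideal is I : x_a, and I + (x_a) is again a cone
    over ideals with killed variables. The bounds are r + 2 for I and r + 1 for I + (x_a), so
    [good_cocone] returns r + 1 whatever the size. *)
Lemma good_clique e kx ky C r kap : cliques_with_kills e kx ky -> uniq C ->
  (0 < size C)%N -> {in C, forall i, isolated e i} ->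
  {in C, forall i, ~~ kx i && ~~ ky i} -> good (GI e kx ky) r kap ->
  good (GI (add_clique e C) kx ky) r.+1 (kap * clique_num (size C)).
Proof.
case: C => // a l; elim/last_ind: l => [|l z IH] hcfg uC _ iso hk hg.
  rewrite /clique_num /= expr0 mulr0n addr0 !mulr1.
  apply: good_weaken (leqnSn r) _; apply: good_ext hg => p.
  split; apply: graph_ideal_min; try exact: graph_ideal_homog;
    try exact: graph_x; try exact: graph_y.
    by move=> i j h; apply: graph_edge; rewrite /add_clique h.
  move=> i j /orP[|]; first exact: graph_edge.
  rewrite !inE => /andP[/eqP -> /eqP ->]; rewrite edge_minor_diag.
  exact: (ideal0 (graph_ideal_homog K _ _ _)).
set C' := a :: l; set C := a :: rcons l z in uC iso hk *.
have CE i : (i \in C) = (i == z) || (i \in C').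
  by rewrite !inE mem_rcons inE orbCA.
have sub i : i \in C' -> i \in C by rewrite CE => ->; rewrite orbT.
have aC' : a \in C' by rewrite mem_head.
have aC : a \in C by exact: sub.
have zC : z \in C by rewrite CE eqxx.
have [zC' uC'] : z \notin C' /\ uniq C'.
  move: uC; rewrite /C /= rcons_uniq mem_rcons inE negb_or.
  move=> /andP[/andP[az al] /andP[zl ul]].
  by rewrite inE negb_or eq_sym az zl al ul.
have neaz : a != z by apply: contraNneq zC' => <-.
have iso' : {in C', forall i, isolated e i} by move=> i /sub/iso.
have hk' : {in C', forall i, ~~ kx i && ~~ ky i} by move=> i /sub/hk.
have {IH} g1 := IH hcfg uC' isT iso' hk' hg.
set J1 := GI (add_clique e C') kx ky in g1.
have hJ1 : homog_ideal J1 := graph_ideal_homog K _ _ _.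
have cfg1 : cliques_with_kills (add_clique e C') kx ky by exact: add_clique_config.
have [s1 t1 k1] := cfg1.
have /andP[kxa kya] := hk a aC; have /andP[kxz kyz] := hk z zC.
have colf : is_colon J1 [f a z] J1.
  apply: graph_colon => //; apply: param_edge_neq0 => //.
  by rewrite /add_clique negb_or iso //= negb_and zC' orbT.
have gI := good_cone hJ1 (edge_minor_homog K a z) colf isT g1 g1.
set I := ideal_add J1 [f a z] in gI.
have hI : homog_ideal I := homog_ideal_add hJ1 (edge_minor_homog K a z).
have gY := good_kill_x1 cfg1 kxa g1.
set Y := GI _ _ _ in gY.
have hY : homog_ideal Y := graph_ideal_homog K _ _ _.
have kx' : {in C', forall i, ~~ kx i} by move=> i /hk'/andP[].
have gX := good_kill_x hcfg uC' iso' kx' hg.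
set X := GI e (kill kx C') ky in gX.
have cfgX : cliques_with_kills e (kill kx C') ky by exact: kill_x_config.
have [sX tX kX] := cfgX.
have hX : homog_ideal X := graph_ideal_homog K _ _ _.
have hzy : shift_homog 2 0 (x z * y a).
  by apply: (@shift_homogM _ _ _ 1); apply: shift_homogX.
(* Modulo x_a the minor of i and a is x_i y_a, so x_z y_a carries every x_i of C' into [Y].
   Conversely [X] contains [Y], is prime and does not contain x_z y_a. *)
have colX : is_colon Y (x z * y a) X.
  move=> p; split.
    have hcol : homog_ideal (fun p => Y (p * (x z * y a))).
      by apply: (homog_ideal_colon hY hzy) => q; split.
    apply: (graph_ideal_min hcol) => [i j eij|i|i ki].
    - by apply: (idealMr hY); apply: graph_edge; rewrite /add_clique eij.
    - move=> /orP[ki|iC]; first by apply: (idealMr hY); apply: graph_x; rewrite /kill ki.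
      have -> : x i * (x z * y a) = x z * [f i a] + x z * y i * x a.
        by rewrite /edge_minor; ring.
      apply: (idealD hY); apply: (idealMl hY).
        by apply: graph_edge; rewrite /add_clique iC aC' orbT.
      by apply: graph_x; rewrite /kill mem_head orbT.
    - by apply: (idealMr hY); apply: graph_y.
  move=> /(clique_sub_kill (fun i h => h) aC') hp.
  have nz : param e (kill kx C') ky (x z * y a) != 0.
    rewrite rmorphM mulf_neq0 //.
      by apply: param_x_neq0; rewrite /kill negb_or kxz.
    exact: param_y_neq0.
  exact/(graph_colon sX tX kX nz).
have gIA := good_cone hY hzy colX isT gY gX.
(* Modulo x_a the minor of a and z is x_z y_a up to sign. *)
have eqIA p : ideal_add Y (x z * y a) p <-> ideal_add I (x a) p.
  split=> [[q /graph_add_x[q' hq]]|[q [q' hq]]].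
    exists (q' + y z * q), (- q); move: hq; congr J1; rewrite /edge_minor; ring.
  exists (- q'); apply/graph_add_x; exists (q + y z * q').
  move: hq; congr J1; rewrite /edge_minor; ring.
have {gIA} gIA := good_ext eqIA gIA.
have hgen i j : add_clique e C' i j -> I [f i j].
  by move=> h; apply/ideal_addW/graph_edge.
have hIf : I [f a z] by exact: ideal_add_self.
have cfg : cliques_with_kills (add_clique e C) kx ky by exact: add_clique_config.
have [sC tC kC] := cfg.
set J := GI (add_clique e C) kx ky.
have hJ : homog_ideal J := graph_ideal_homog K _ _ _.
(* The three-term relation among minors of a 2 x 3 matrix brings every new minor into I after
   multiplication by x_a. *)
have key i : i \in C' -> I ([f i z] * x a).
  move=> iC; have -> : [f i z] * x a = x i * [f a z] + x z * [f i a].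
    by rewrite /edge_minor; ring.
  apply: (idealD hI); apply: (idealMl hI) => //; apply: hgen.
  by rewrite /add_clique iC aC' orbT.
have colJ : is_colon I (x a) J.
  move=> p; split.
    have hcol : homog_ideal (fun p => I (p * x a)).
      by apply: (homog_ideal_colon hI (xvar_homog K a)) => q; split.
    apply: (graph_ideal_min hcol) => [i j /orP[eij|/andP[]]|i ki|i ki].
    - by apply: (idealMr hI); apply: hgen; rewrite /add_clique eij.
    - rewrite !CE => /orP[/eqP ->|iC] /orP[/eqP ->|jC].
      + by rewrite edge_minor_diag mul0r; apply: (ideal0 hI).
      + by rewrite edge_minor_sym mulNr; apply: (idealN hI); apply: key.
      + exact: key.
      + by apply: (idealMr hI); apply: hgen; rewrite /add_clique iC jC orbT.
    - by apply: (idealMr hI); apply/ideal_addW/graph_x.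
    - by apply: (idealMr hI); apply/ideal_addW/graph_y.
  move=> hp; apply/(graph_colon sC tC kC (param_x_neq0 K _ ky kxa)).
  apply: ideal_add_min hp => //.
    move=> q; apply: (graph_ideal_min hJ) => [i j /orP[eij|/andP[iC jC]]|i|i].
    - by apply: graph_edge; rewrite /add_clique eij.
    - by apply: graph_edge; rewrite /add_clique !sub // orbT.
    - exact: graph_x.
    - exact: graph_y.
  by apply: graph_edge; rewrite /add_clique aC zC orbT.
(* Killing x on the whole clique gives a prime ideal that contains I + (x_a). *)
have proper : ~ ideal_add I (x a) 1.
  move/eqIA => h.
  have kxC : {in C, forall i, ~~ kx i} by move=> i /hk/andP[].
  have [s2 t2 k2] : cliques_with_kills e (kill kx C) ky by exact: kill_x_config.
  have h2 := graph_ideal_homog K e (kill kx C) ky.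
  have [_ _ h1 _] := graph_prime K s2 t2 k2; apply: h1.
  apply: (ideal_add_min h2) h => [q|].
    exact: clique_sub_kill.
  by apply: (idealMr h2); apply: graph_x; rewrite /kill zC orbT.
have szC : size C = (size l).+2 by rewrite /= size_rcons.
have szC' : size C' = (size l).+1 by [].
have hkap : kap * clique_num (size C') - 'X^2 * (kap * clique_num (size C')) -
    (kap * clique_num (size C') * (1 - 'X) - 'X^2 * (kap * (1 - 'X) ^+ size C')) =
    'X * (kap * clique_num (size C)).
  rewrite szC szC' /clique_num /= [(1 - 'X) ^+ _.+1]exprS mulrS.
  exact: clique_num_rec.
have := good_cocone hI (xvar_homog K a) colJ proper hkap gI gIA.
by apply: good_weaken; clear; lia.
Qed.

End Cliques.

(** * Regularity and Hilbert series of the graph *)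

Section Blocks.

Variables (K : fieldType) (k : nat).
Local Notation n := (10 * k)%N.
Local Notation S := {mpoly K[n + n]}.
Implicit Types (p q f : S) (i j : 'I_n) (m : nat).
Local Notation x i := (xvar K i).
Local Notation y i := (yvar K i).
Local Notation GI := (@graph_ideal K n).

(* Vertex 10 m + a is vertex a of block m. In a block of the graph, vertex 0 is
   joined to the three triangles {1,2,3}, {4,5,6}, {7,8,9}; the other states
   are those met when the variables of vertex 0 are split off. *)
Inductive block_state :=
  NoEdge | ConeBlock | CompleteBlock | ZeroX | TriangleBlock.

Definition is_cone s := if s is ConeBlock then true else false.

Definition block_of i : nat := i %/ 10.
Definition place i : nat := i %% 10.

Definition same_triangle (a b : nat) : bool :=
  [&& a != 0, b != 0 & (a - 1) %/ 3 == (b - 1) %/ 3]%N.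

Definition state_rel s (a b : nat) : bool :=
  match s with
  | NoEdge | ZeroX => false
  | ConeBlock => [|| a == 0, b == 0 | same_triangle a b]%N
  | CompleteBlock => true
  | TriangleBlock => same_triangle a b
  end.

Definition state_kx s (a : nat) : bool :=
  match s with ZeroX => true | TriangleBlock => a == 0%N | _ => false end.

Definition state_ky s (a : nat) : bool :=
  match s with TriangleBlock => a == 0%N | _ => false end.

Implicit Types (s : block_state) (st : nat -> block_state).

Definition edges_of st : rel 'I_n := fun i j =>
  (block_of i == block_of j) && state_rel (st (block_of i)) (place i) (place j).
Definition kx_of st : pred 'I_n := fun i => state_kx (st (block_of i)) (place i).
Definition ky_of st : pred 'I_n := fun i => state_ky (st (block_of i)) (place i).

Definition state_ideal st : S -> Prop := GI (edges_of st) (kx_of st) (ky_of st).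

Definition update st m s : nat -> block_state := fun l => if l == m then s else st l.

Definition state_reg s : nat :=
  match s with
  | NoEdge | ZeroX => 0
  | CompleteBlock => 1
  | ConeBlock | TriangleBlock => 3
  end.

Definition triangle_num : {poly int} :=
  (1 - 'X) * (1 - 'X) * clique_num 3 * clique_num 3 * clique_num 3.

Definition state_num s : {poly int} :=
  match s with
  | NoEdge => 1
  | ZeroX => (1 - 'X) ^+ 10
  | CompleteBlock => clique_num 10
  | TriangleBlock => triangle_num
  | ConeBlock =>
      triangle_num + 'X^1 * (1 - 'X) ^+ 10 + 'X^1 * clique_num 10
  end.

Lemma place_lt i : (place i < 10)%N.
Proof. exact: ltn_pmod. Qed.

Lemma block_lt i : (block_of i < k)%N.
Proof. by rewrite ltn_divLR // [X in (_ < X)%N]mulnC. Qed.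

Lemma same_triangle_sym a b : same_triangle a b = same_triangle b a.
Proof. by rewrite /same_triangle [X in _ = [&& _, _ & X]]eq_sym andbCA. Qed.

Lemma same_triangle_trans a b c :
  same_triangle a b -> same_triangle b c -> same_triangle a c.
Proof.
move=> /and3P[ha _ /eqP h1] /and3P[_ hc /eqP h2].
by rewrite /same_triangle ha hc h1 h2 eqxx.
Qed.

Lemma state_config st : (forall m, ~~ is_cone (st m)) ->
  cliques_with_kills (edges_of st) (kx_of st) (ky_of st).
Proof.
move=> hst; split=> [i j|j i l|i j]; rewrite /edges_of /kx_of /ky_of.
- rewrite eq_sym; case: eqP => //= <-.
  by case: (st _) (hst (block_of j)) => //= _; rewrite same_triangle_sym.
- move=> /andP[/eqP e1 h1] /andP[/eqP e2]; rewrite e1 e2 eqxx /= in h1 *; move=> h2.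
  case: (st _) (hst (block_of l)) h1 h2 => //= _; exact: same_triangle_trans.
- move=> /andP[/eqP ->]; case: (st _) (hst (block_of j)) => //= _.
Qed.

Definition place_range m a b : seq 'I_n :=
  pmap (insub : nat -> option 'I_n) (iota (10 * m + a) b).

Lemma mem_place_range m a b i : (a + b <= 10)%N ->
  (i \in place_range m a b) = (block_of i == m) && (a <= place i < a + b)%N.
Proof.
move=> h; rewrite mem_pmap_sub mem_iota /block_of /place /=.
move: (divn_eq i 10) (ltn_pmod i (isT : (0 < 10)%N)).
move: (i %/ 10)%N (i %% 10)%N => q c; move: (nat_of_ord i) => w -> hc.
apply/idP/idP => [/andP[h1 h2]|/andP[/eqP -> /andP[h1 h2]]]; last lia.
have -> : q = m by lia.
by rewrite eqxx /=; lia.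
Qed.

Lemma place_range_uniq m a b : uniq (place_range m a b).
Proof. exact/pmap_sub_uniq/iota_uniq. Qed.

Lemma size_place_range m a b : (m < k)%N -> (a + b <= 10)%N ->
  size (place_range m a b) = b.
Proof.
move=> hm h; rewrite size_pmap_sub.
rewrite (eq_in_count (a2 := predT)) ?count_predT ?size_iota // => c.
by rewrite mem_iota /=; lia.
Qed.

(** Reduces the comparison of relations inside one block to evaluation over all pairs of places. *)
Lemma check_below N (P : nat -> nat -> bool) :
  all (fun a => all (P a) (iota 0 N)) (iota 0 N) ->
  forall a b, (a < N)%N -> (b < N)%N -> P a b.
Proof.
move=> /allP h a b ha hb; have ha' : a \in iota 0 N by rewrite mem_iota.
by have /allP := h a ha'; apply; rewrite mem_iota.
Qed.

Section Step.

Variables (st : nat -> block_state) (m : nat) (r : nat) (kap : {poly int}).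
Hypotheses (hst : forall l, ~~ is_cone (st l)) (stm : st m = NoEdge) (hm : (m < k)%N).
Hypothesis hg : good (state_ideal st) r kap.

Let cfg := state_config hst.

Lemma range_isolated a b : (a + b <= 10)%N ->
  {in place_range m a b, forall i, isolated (edges_of st) i}.
Proof.
move=> h i; rewrite mem_place_range // => /andP[/eqP bi _] j.
by rewrite /edges_of bi stm andbF.
Qed.

Lemma range_not_killed a b : (a + b <= 10)%N ->
  {in place_range m a b, forall i, ~~ kx_of st i && ~~ ky_of st i}.
Proof.
move=> h i; rewrite mem_place_range // => /andP[/eqP bi _].
by rewrite /kx_of /ky_of bi stm.
Qed.

Lemma range_not_killed_x a b : (a + b <= 10)%N ->
  {in place_range m a b, forall i, ~~ kx_of st i}.
Proof. by move=> h i /(range_not_killed h)/andP[]. Qed.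

Lemma good_step_complete : good (state_ideal (update st m CompleteBlock)) r.+1
  (kap * clique_num 10).
Proof.
have := good_clique cfg (place_range_uniq m 0%N 10%N) _ (range_isolated _)
  (range_not_killed _) hg.
rewrite size_place_range // => /(_ isT isT isT); apply: good_ext => p.
apply: graph_ideal_eq => [i j|i|i].
- rewrite /add_clique /edges_of /update !mem_place_range // !place_lt !andbT.
  case: (eqVneq (block_of i) m) => [->|_] /=; last by rewrite orbF.
  by rewrite stm andbF /= andbT eq_sym.
- rewrite /kx_of /update; case: eqP => //= ->; by rewrite stm.
- rewrite /ky_of /update; case: eqP => //= ->; by rewrite stm.
Qed.

Lemma good_step_zerox :
  good (state_ideal (update st m ZeroX)) r (kap * (1 - 'X) ^+ 10).
Proof.
have := good_kill_x cfg (place_range_uniq m 0%N 10%N) (range_isolated _)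
  (range_not_killed_x _) hg.
rewrite size_place_range // => /(_ isT isT); apply: good_ext => p.
apply: graph_ideal_eq => [i j|i|i].
- rewrite /edges_of /update; case: (eqVneq (block_of i) m) => //= ->.
  by rewrite stm.
- rewrite /kill /kx_of /update mem_place_range // place_lt andbT.
  by case: eqP; rewrite ?orbT ?orbF.
- rewrite /ky_of /update; case: eqP => //= ->; by rewrite stm.
Qed.

(** Killing x and y of vertex 0 costs nothing in the bound, and each of the three triangles adds
    1. *)
Lemma good_step_triangles :
  good (state_ideal (update st m TriangleBlock)) (r + 3) (kap * triangle_num).
Proof.
have v_lt : (10 * m < n)%N by lia.
pose v := Ordinal v_lt.
have bv : block_of v = m by rewrite /block_of /=; lia.
have pv : place v = 0%N by rewrite /place /=; lia.
have isov : {in [:: v], forall i, isolated (edges_of st) i}.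
  move=> i; rewrite inE => /eqP -> j; by rewrite /edges_of bv stm andbF.
have nkx : ~~ kx_of st v by rewrite /kx_of bv stm.
have nky : ~~ ky_of st v by rewrite /ky_of bv stm.
have gx := good_kill_x1 cfg nkx hg; have cx := kill_x_config cfg isov.
have gxy := good_kill_y1 cx nky gx; have cxy := kill_y_config cx isov.
have vin i : (i \in [:: v]) = (block_of i == m) && (place i == 0%N).
  rewrite inE -val_eqE /= /block_of /place; lia.
have nk a b : (0 < a)%N -> (a + b <= 10)%N -> {in place_range m a b, forall i,
    ~~ kill (kx_of st) [:: v] i && ~~ kill (ky_of st) [:: v] i}.
  move=> a0 h i hi; have /andP[h1 h2] := range_not_killed h hi.
  rewrite /kill !vin !negb_or h1 h2 /=; move: hi; rewrite mem_place_range //.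
  by case: (place i) => [|c]; rewrite ?andbF // leqNgt a0 andbF.
have iso1 a b c d : (a + b <= c)%N -> (c + d <= 10)%N -> forall e : rel 'I_n,
    {in place_range m c d, forall i, isolated e i} ->
    {in place_range m c d, forall i, isolated (add_clique e (place_range m a b)) i}.
  move=> h1 h2 e he i hi j; rewrite /add_clique negb_or he //= negb_and.
  have hab : (a + b <= 10)%N by lia.
  move: hi; rewrite !(mem_place_range _ _ hab) (mem_place_range _ _ h2).
  by move=> /andP[-> hi]; apply/orP; left; lia.
have R a b := @range_isolated a b.
have g1 := (good_clique cxy (place_range_uniq m 1 3) _ (R 1 3 isT) (nk 1 3 isT isT) gxy)%N.
have c1 := (add_clique_config cxy (R 1 3 isT) (nk 1 3 isT isT))%N.
have i2 := (iso1 1 3 4 3 isT isT _ (R 4 3 isT))%N.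
have i3 := (iso1 1 3 7 3 isT isT _ (R 7 3 isT))%N.
rewrite size_place_range // in g1; have {}g1 := g1 isT.
have g2 := (good_clique c1 (place_range_uniq m 4 3) _ i2 (nk 4 3 isT isT) g1)%N.
have c2 := (add_clique_config c1 i2 (nk 4 3 isT isT))%N.
have {}i3 := (iso1 4 3 7 3 isT isT _ i3)%N.
rewrite size_place_range // in g2; have {}g2 := g2 isT.
have := (good_clique c2 (place_range_uniq m 7 3) _ i3 (nk 7 3 isT isT) g2)%N.
rewrite size_place_range // => /(_ isT); rewrite -[r.+3]addn3.
have -> : kap * (1 - 'X) * (1 - 'X) * clique_num 3 * clique_num 3 * clique_num 3 =
    kap * triangle_num by rewrite /triangle_num !mulrA.
apply: good_ext => p; apply: graph_ideal_eq => [i j|i|i].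
- rewrite /add_clique /edges_of /update !mem_place_range //.
  case: (eqVneq (block_of i) m) => [->|_] /=; last by rewrite !orbF.
  rewrite stm andbF /= [block_of j == m]eq_sym.
  case: (m == block_of j) => /=; last by rewrite !andbF.
  apply/eqP; move: (place i) (place j) (place_lt i) (place_lt j).
  by apply: check_below.
- rewrite /kill vin /kx_of /update; case: eqP => [->|]; rewrite ?orbF //.
  by rewrite stm.
- rewrite /kill vin /ky_of /update; case: eqP => [->|]; rewrite ?orbF //.
  by rewrite stm.
Qed.

Lemma good_step s : ~~ is_cone s ->
  good (state_ideal (update st m s)) (r + state_reg s) (kap * state_num s).
Proof.
case: s => //= _; rewrite ?addn0 ?addn1 ?mulr1.
- apply: good_ext hg => p; apply: graph_ideal_eq => [i j|i|i];
    rewrite /edges_of /kx_of /ky_of /update;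
    by case: (eqVneq (block_of i) m) => // ->; rewrite stm.
- exact: good_step_complete.
- exact: good_step_zerox.
- exact: good_step_triangles.
Qed.

End Step.

Lemma state_ideal_eq st st' p : (forall m, (m < k)%N -> st m = st' m) ->
  state_ideal st p <-> state_ideal st' p.
Proof.
move=> h; apply: graph_ideal_eq => [i j|i|i];
  by rewrite /edges_of /kx_of /ky_of (h _ (block_lt i)).
Qed.

Lemma good_no_cone st : (forall m, ~~ is_cone (st m)) ->
  good (state_ideal st) (\sum_(m < k) state_reg (st m))
    (\prod_(m < k) state_num (st m)).
Proof.
(* The ideal grows from zero: the first [m] blocks have their final state, the others have no edge
   yet. *)
move=> hst; pose cut m := fun l => if (l < m)%N then st l else NoEdge.
suff key m : (m <= k)%N -> good (state_ideal (cut m))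
    (\sum_(j < m) state_reg (st j)) (\prod_(j < m) state_num (st j)).
  apply: good_ext (key k (leqnn k)) => p; apply: state_ideal_eq => m hm.
  by rewrite /cut hm.
elim: m => [|m IH] hm.
  rewrite !big_ord0; apply: good_ext (good_zero K _) => p.
  by apply: graph_ideal_empty => [i j|i|i]; rewrite /edges_of ?andbF.
rewrite !big_ord_recr /=.
have cutc (j : nat) : ~~ is_cone (cut m j) by rewrite /cut; case: ifP.
have cutm : cut m m = NoEdge by rewrite /cut ltnn.
apply: good_ext (good_step cutc cutm hm (IH (ltnW hm)) (hst m)) => p.
apply: state_ideal_eq => j _; rewrite /update /cut ltnS [(j <= m)%N]leq_eqVlt.
by case: eqP => [->|].
Qed.

Definition nzd (I : S -> Prop) f : Prop := forall p, I (p * f) -> I p.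

(** An element regular on both ends of a short exact sequence is regular on the middle term. *)
Lemma nzd_two_step (I J : S -> Prop) f z : homog_ideal I -> is_colon I f J ->
  nzd J z -> nzd (ideal_add I f) z -> nzd I z.
Proof.
move=> hI hJ h1 h2 p hp.
have [q hq] : ideal_add I f p by apply: h2; apply: ideal_addW.
rewrite -(subrK (q * f) p); apply: (idealD hI) => //; apply/hJ/h1/hJ.
have -> : q * z * f = p * z - (p - q * f) * z by ring.
by apply: (idealB hI) => //; apply: (idealMr hI).
Qed.

Lemma nzd_ext (I J : S -> Prop) z : (forall p, I p <-> J p) -> nzd I z -> nzd J z.
Proof. by move=> e h p /e/h/e. Qed.

Definition center m (hm : (m < k)%N) : 'I_n :=
  Ordinal (n := n) (m := 10 * m) (ltac:(by rewrite ltn_pmul2l)).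

Lemma center_block m (hm : (m < k)%N) : block_of (center hm) = m.
Proof. by rewrite /block_of /= mulKn. Qed.

Lemma center_place m (hm : (m < k)%N) : place (center hm) = 0%N.
Proof. by rewrite /place /= modnMr. Qed.

Lemma centerE m (hm : (m < k)%N) i :
  (i == center hm) = (block_of i == m) && (place i == 0%N).
Proof. by rewrite -val_eqE /= /block_of /place; lia. Qed.

Definition centers_nzd st : Prop := forall m (hm : (m < k)%N),
  (st m = CompleteBlock -> nzd (state_ideal st) (x (center hm))) /\
  (st m = ZeroX -> nzd (state_ideal st) (y (center hm))).

Lemma no_cone_nzd st : (forall m, ~~ is_cone (st m)) -> centers_nzd st.
Proof.
move=> hst m hm; have [h1 h2 h3] := state_config hst.
split=> sm p hp.
  apply/(graph_colon h1 h2 h3 (f := x (center hm))) => //.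
  by apply: param_x_neq0; rewrite /kx_of center_block sm.
apply/(graph_colon h1 h2 h3 (f := y (center hm))) => //.
by apply: param_y_neq0; rewrite /ky_of center_block sm.
Qed.

Section ConeStep.

Variables (st : nat -> block_state) (m : nat) (hm : (m < k)%N).
Hypothesis stm : st m = ConeBlock.

Local Notation v := (center hm).
Local Notation I := (state_ideal st).
Local Notation IC := (state_ideal (update st m CompleteBlock)).
Local Notation IX := (state_ideal (update st m ZeroX)).
Local Notation IT := (state_ideal (update st m TriangleBlock)).

Let hI : homog_ideal I := graph_ideal_homog K _ _ _.
Let hC : homog_ideal IC := graph_ideal_homog K _ _ _.
Let hX : homog_ideal IX := graph_ideal_homog K _ _ _.
Let hT : homog_ideal IT := graph_ideal_homog K _ _ _.
Let hB : homog_ideal (ideal_add I (x v)) := homog_ideal_add hI (xvar_homog K v).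

Lemma edges_update s i j : edges_of (update st m s) i j =
  if block_of i == m then (block_of j == m) && state_rel s (place i) (place j)
  else edges_of st i j.
Proof.
by rewrite /edges_of /update; case: (eqVneq (block_of i) m) => [->|_ //]; rewrite eq_sym.
Qed.

Lemma kx_update s i : kx_of (update st m s) i =
  if block_of i == m then state_kx s (place i) else kx_of st i.
Proof. by rewrite /kx_of /update; case: eqP. Qed.

Lemma ky_update s i : ky_of (update st m s) i =
  if block_of i == m then state_ky s (place i) else ky_of st i.
Proof. by rewrite /ky_of /update; case: eqP. Qed.

Lemma cone_edge j : block_of j = m -> I (edge_minor K v j).
Proof.
move=> bj; apply: graph_edge; rewrite /edges_of center_block bj eqxx stm.
by rewrite center_place.
Qed.

Lemma cone_kx i : kx_of st i -> block_of i != m.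
Proof. by apply: contraTneq => bi; rewrite /kx_of bi stm. Qed.

Lemma cone_ky i : ky_of st i -> block_of i != m.
Proof. by apply: contraTneq => bi; rewrite /ky_of bi stm. Qed.

Lemma cone_sub_complete p : I p -> IC p.
Proof.
apply: (graph_ideal_min hC) => [i j h|i h|i h].
- apply: graph_edge; rewrite edges_update; case: eqP => // bi.
  by move: h; rewrite /edges_of bi eq_sym => /andP[->].
- by apply: graph_x; rewrite kx_update (negbTE (cone_kx h)).
- by apply: graph_y; rewrite ky_update (negbTE (cone_ky h)).
Qed.

(** Every minor of the block times x_v is a combination of minors of edges at v, and v is joined to
    the whole block. The reverse inclusion is regularity of x_v modulo the larger ideal. *)
Lemma cone_colon_x : nzd IC (x v) -> is_colon I (x v) IC.
Proof.
move=> hz p; split; last by move/cone_sub_complete/hz.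
have hcol : homog_ideal (fun p => I (p * x v)).
  by apply: (homog_ideal_colon hI (xvar_homog K v)) => q; split.
apply: (graph_ideal_min hcol) => [i j|i|i].
- rewrite edges_update; case: eqP => [bi|_ h]; last first.
    by apply: (idealMr hI); apply: graph_edge.
  move=> /andP[/eqP bj _].
  have -> : edge_minor K i j * x v = x i * edge_minor K v j - x j * edge_minor K v i.
    by rewrite /edge_minor; ring.
  by apply: (idealB hI); apply: (idealMl hI); apply: cone_edge.
- by rewrite kx_update; case: ifP => // _ h; apply: (idealMr hI); apply: graph_x.
- by rewrite ky_update; case: ifP => // _ h; apply: (idealMr hI); apply: graph_y.
Qed.

Lemma cone_sub_zerox p : ideal_add I (x v) p -> IX p.
Proof.
have xX i : block_of i = m -> IX (x i).
  by move=> bi; apply: graph_x; rewrite kx_update bi eqxx.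
apply: (ideal_add_min hX) => [q|]; last by apply/xX/center_block.
apply: (graph_ideal_min hX) => [i j h|i h|i h].
- case: (eqVneq (block_of i) m) => bi.
    have bj : block_of j = m by move: h; rewrite /edges_of bi => /andP[/eqP].
    rewrite /edge_minor; apply: (idealB hX); [apply: (idealMr hX) | apply: (idealMl hX)];
      exact: xX.
  by apply: graph_edge; rewrite edges_update (negbTE bi).
- by apply: graph_x; rewrite kx_update (negbTE (cone_kx h)).
- by apply: graph_y; rewrite ky_update (negbTE (cone_ky h)).
Qed.

(** Modulo x_v the edge from v to i reads x_i y_v, so y_v carries every x_i of the block into the
    ideal. *)
Lemma cone_colon_y : nzd IX (y v) -> is_colon (ideal_add I (x v)) (y v) IX.
Proof.
move=> hz p; split; last by move/cone_sub_zerox/hz.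
have hcol : homog_ideal (fun p => ideal_add I (x v) (p * y v)).
  by apply: (homog_ideal_colon hB (yvar_homog K v)) => q; split.
apply: (graph_ideal_min hcol) => [i j|i|i].
- rewrite edges_update; case: eqP => [_|_ h]; first by rewrite andbF.
  by apply: (idealMr hB); apply/ideal_addW/graph_edge.
- rewrite kx_update; case: eqP => [bi _|_ h]; last first.
    by apply: (idealMr hB); apply/ideal_addW/graph_x.
  have -> : x i * y v = y i * x v - edge_minor K v i by rewrite /edge_minor; ring.
  apply: (idealB hB); first by apply: (idealMl hB); apply: ideal_add_self.
  exact/ideal_addW/cone_edge.
- rewrite ky_update; case: ifP => // _ h.
  by apply: (idealMr hB); apply/ideal_addW/graph_y.
Qed.

Lemma cone_add_xy p : ideal_add (ideal_add I (x v)) (y v) p <-> IT p.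
Proof.
have xv : IT (x v).
  by apply: graph_x; rewrite kx_update center_block eqxx center_place.
have yv : IT (y v).
  by apply: graph_y; rewrite ky_update center_block eqxx center_place.
have place0 i : block_of i = m -> place i = 0%N -> i = v.
  by move=> bi pi; apply/eqP; rewrite centerE bi pi !eqxx.
have hD := homog_ideal_add hB (yvar_homog K v).
have bW q : I q -> ideal_add (ideal_add I (x v)) (y v) q.
  by move=> h; apply/ideal_addW/ideal_addW.
split.
  apply: (ideal_add_min hT) => // q; apply: (ideal_add_min hT) => // {}q.
  apply: (graph_ideal_min hT) => [i j h|i h|i h].
  - case: (eqVneq (block_of i) m) => bi; last first.
      by apply: graph_edge; rewrite edges_update (negbTE bi).
    move: h; rewrite /edges_of bi stm => /andP[/eqP bj /or3P[]].
    + move=> /eqP/(place0 i bi) ->; rewrite /edge_minor.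
      by apply: (idealB hT); apply: (idealMr hT).
    + move=> /eqP/(place0 j (esym bj)) ->; rewrite /edge_minor.
      by apply: (idealB hT); apply: (idealMl hT).
    + by move=> h; apply: graph_edge; rewrite edges_update bi -bj eqxx.
  - by apply: graph_x; rewrite kx_update (negbTE (cone_kx h)).
  - by apply: graph_y; rewrite ky_update (negbTE (cone_ky h)).
apply: (graph_ideal_min hD) => [i j|i|i].
- rewrite edges_update; case: eqP => [bi|_ h]; last by apply/bW/graph_edge.
  move=> /andP[/eqP bj h]; apply/bW/graph_edge.
  have {}h : same_triangle (place i) (place j) by exact: h.
  by rewrite /edges_of bi bj eqxx stm /= h !orbT.
- rewrite kx_update; case: eqP => [bi /eqP/(place0 i bi) ->|_ h].
    exact/ideal_addW/ideal_add_self.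
  exact/bW/graph_x.
- rewrite ky_update; case: eqP => [bi /eqP/(place0 i bi) ->|_ h].
    exact: ideal_add_self.
  exact/bW/graph_y.
Qed.

Lemma cone_nzd z : nzd IC (x v) -> nzd IX (y v) ->
  nzd IC z -> nzd IX z -> nzd IT z -> nzd I z.
Proof.
move=> h1 h2 zC zX zT; apply: (nzd_two_step hI (cone_colon_x h1) zC).
apply: (nzd_two_step hB (cone_colon_y h2) zX).
by apply: (nzd_ext (I := IT)) => // p; split=> /cone_add_xy.
Qed.

Lemma good_cone_step r kap : nzd IC (x v) -> nzd IX (y v) ->
  good IC (r + 1) (kap * state_num CompleteBlock) ->
  good IX r (kap * state_num ZeroX) ->
  good IT (r + 3) (kap * state_num TriangleBlock) ->
  good I (r + 3) (kap * state_num ConeBlock).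
Proof.
move=> h1 h2 gC gX gT.
have gT' : good (ideal_add (ideal_add I (x v)) (y v)) (r + 3)
    (kap * state_num TriangleBlock).
  by apply: good_ext gT => p; split=> /cone_add_xy.
have gB := good_horseshoe hB (yvar_homog K v) (cone_colon_y h2) gT' gX.
have gI := good_horseshoe hI (xvar_homog K v) (cone_colon_x h1) gB gC.
have -> : kap * state_num ConeBlock = kap * state_num TriangleBlock +
    'X^1 * (kap * state_num ZeroX) + 'X^1 * (kap * state_num CompleteBlock).
  by rewrite /state_num !mulrDr ![kap * (_ * _)]mulrCA.
by apply: good_weaken gI; clear; lia.
Qed.

End ConeStep.

(** Regularity bound, numerator and regular centres are proved together, since each cone step uses
    the regular centres of the states with one cone fewer. *)
Lemma good_state st :
  good (state_ideal st) (\sum_(m < k) state_reg (st m))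
    (\prod_(m < k) state_num (st m)) /\ centers_nzd st.
Proof.
(* Cones are allowed only in blocks below [j]; the step replaces a cone in block [j] by the three
   other states. *)
suff key (j : nat) : forall st, (forall m, (j <= m)%N -> ~~ is_cone (st m)) ->
    good (state_ideal st) (\sum_(m < k) state_reg (st m))
      (\prod_(m < k) state_num (st m)) /\ centers_nzd st.
  (* The states from [k] on do not affect the ideal; resetting them makes [key] applicable even to
     the constant cone state. *)
  pose st' m := if (m < k)%N then st m else NoEdge.
  have [|g c] := key k st'; first by move=> m hm; rewrite /st' ltnNge hm.
  have e p : state_ideal st' p <-> state_ideal st p.
    by apply: state_ideal_eq => m hm; rewrite /st' hm.
  split.
    apply: good_ext e _; move: g; congr good.
      by apply: eq_bigr => m _; rewrite /st' ltn_ord.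
    by apply: eq_bigr => m _; rewrite /st' ltn_ord.
  move=> m hm; have := c m hm; rewrite {1 3}/st' hm => -[c1 c2].
  by split=> h; apply: nzd_ext e _; [apply: c1 | apply: c2].
elim: j => [|j IH] {}st hst.
  have hst' m : ~~ is_cone (st m) by apply: hst.
  by split; [apply: good_no_cone | apply: no_cone_nzd].
case: (ltnP j k) => hj; last first.
  have [|g c] := IH (update st j NoEdge).
    move=> m hm; rewrite /update; case: eqP => // ne; apply: hst; lia.
  have e p : state_ideal (update st j NoEdge) p <-> state_ideal st p.
    by apply: state_ideal_eq => m hm; rewrite /update ltn_eqF // (leq_trans hm).
  have eqs m : (m < k)%N -> update st j NoEdge m = st m.
    by move=> hm; rewrite /update ltn_eqF // (leq_trans hm).
  split.
    apply: good_ext e _; move: g; congr good.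
      by apply: eq_bigr => m _; rewrite eqs.
    by apply: eq_bigr => m _; rewrite eqs.
  move=> m hm; have := c m hm; rewrite (eqs m hm) => -[c1 c2].
  by split=> h; apply: nzd_ext e _; [apply: c1 | apply: c2].
have updc s : ~~ is_cone s -> forall m, (j <= m)%N -> ~~ is_cone (update st j s m).
  move=> hs m hm; rewrite /update; case: eqP => // ne; apply: hst; lia.
case cj : (is_cone (st j)); last first.
  apply: IH => m; rewrite leq_eqVlt => /orP[/eqP <-|]; first by rewrite cj.
  exact: hst.
have stj : st j = ConeBlock by case: (st j) cj.
have [gC cC] := IH _ (updc CompleteBlock isT).
have [gX cX] := IH _ (updc ZeroX isT).
have [gT cT] := IH _ (updc TriangleBlock isT).
pose j' := Ordinal hj.
have usum s : (\sum_(m < k) state_reg (update st j s m) =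
    \sum_(m < k | m != j') state_reg (st m) + state_reg s)%N.
  rewrite (bigD1 j') //= {1}/update eqxx addnC; congr (_ + _)%N.
  apply: eq_bigr => m ne; rewrite /update ifF //.
  by rewrite -[j]/(val j') val_eqE (negbTE ne).
have uprod s : \prod_(m < k) state_num (update st j s m) =
    \prod_(m < k | m != j') state_num (st m) * state_num s.
  rewrite (bigD1 j') //= {1}/update eqxx mulrC; congr (_ * _).
  apply: eq_bigr => m ne; rewrite /update ifF //.
  by rewrite -[j]/(val j') val_eqE (negbTE ne).
have updj s : update st j s j = s by rewrite /update eqxx.
have n1 : nzd (state_ideal (update st j CompleteBlock)) (x (center hj)).
  by have [h _] := cC j hj; apply: h.
have n2 : nzd (state_ideal (update st j ZeroX)) (y (center hj)).
  by have [_ h] := cX j hj; apply: h.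
split.
  move: gC gX gT; rewrite !usum !uprod /= addn0 => gC gX gT.
  have := good_cone_step stj n1 n2 gC gX gT; congr good.
    by rewrite [RHS](bigD1 j') //= stj addnC.
  by rewrite [RHS](bigD1 j') //= stj mulrC.
move=> m hm; split=> sm.
  have ne : m != j by apply/eqP => e; rewrite e stj in sm.
  have um s : update st j s m = CompleteBlock by rewrite /update (negbTE ne).
  by apply: (cone_nzd stj n1 n2); [have [h _] := cC m hm | have [h _] := cX m hm
    | have [h _] := cT m hm]; apply: h.
have ne : m != j by apply/eqP => e; rewrite e stj in sm.
have um s : update st j s m = ZeroX by rewrite /update (negbTE ne).
by apply: (cone_nzd stj n1 n2); [have [_ h] := cC m hm | have [_ h] := cX m hm
  | have [_ h] := cT m hm]; apply: h.
Qed.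

End Blocks.

(** * Detection of the extremal syzygy *)

Section KoszulDetection.

Variables (K : fieldType) (N : nat).
Local Notation S := {mpoly K[N]}.

Variables (n1 n2 : nat).
Variables (hd1 gd1 : 'I_n1 -> nat) (D1 : 'M[S]_n1) (g1 : 'cV[S]_n1).
Variables (hd2 gd2 : 'I_n2 -> nat) (D2 : 'M[S]_n2) (g2 : 'cV[S]_n2).
Variables (J I : S -> Prop) (ev : {rmorphism S -> S}).
Hypotheses (hJ : homog_ideal J) (hI : homog_ideal I) (IJ : forall p, I p -> J p).
Hypotheses (r1 : graded_res hd1 gd1 D1 g1 J) (r2 : graded_res hd2 gd2 D2 g2 I).
Hypothesis pure : forall a, gd2 a = (2 * hd2 a)%N.
Hypotheses (ev_homog : forall a b p, shift_homog a b p -> shift_homog a b (ev p))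
  (ev0 : forall p, (ev p)@_0%MM = p@_0%MM) (evJ : forall p, J p -> I (ev p))
  (evD : map_mx ev D2 = D2) (evg : map_mx ev g2 = g2).

(* The retraction [ev] maps a resolution of S / J to a complex admitting chain
   maps to and from the pure resolution of S / I; their composite is the
   identity because its entries are constants. *)
Lemma pure_strand_detected (a2 : 'I_n2) :
  exists a1, hd1 a1 = hd2 a2 /\ gd1 a1 = gd2 a2.
Proof.
have Dg n (D : 'M[S]_n) (g : 'cV[S]_n) a :
    (D *m g) a 0 = (delta_mx (0 : 'I_1) a *m D *m g) 0 0.
  by rewrite -mulmxA mul_row_delta [RHS]mxE.
have [A [A1 A2 A3 A4]] : exists A : 'M[S]_(n2, n1),
  [/\ forall a b, A a b != 0 -> hd2 a = (hd1 b + 0)%N,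
      forall a b, shift_homog (gd2 a) (gd1 b + 0) (A a b),
      A *m D1 = D2 *m A & forall a, J ((A *m g1) a 0 - g2 a 0)].
  apply: (lift_chain_map hJ r1) => [a b|a b||a|a|a].
  - exact: (res_hd r2).
  - exact: (res_gd r2).
  - exact: res_DD r2.
  - exact: (res_hd0 r2).
  - exact: (res_gd0 r2).
  - by apply: IJ; rewrite Dg; apply: (res_Dg _ r2).
have evnz p : ev p != 0 -> p != 0.
  by apply: contraNneq => ->; rewrite rmorph0.
have [B [B1 B2 B3 B4]] : exists B : 'M[S]_(n1, n2),
  [/\ forall a b, B a b != 0 -> hd1 a = (hd2 b + 0)%N,
      forall a b, shift_homog (gd1 a) (gd2 b + 0) (B a b),
      B *m D2 = map_mx ev D1 *m B
    & forall a, I ((B *m g2) a 0 - (map_mx ev g1) a 0)].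
  apply: (lift_chain_map hI r2) => [a b|a b||a|a|a].
  - by rewrite mxE => /evnz; apply: (res_hd r1).
  - by rewrite mxE; apply/ev_homog/(res_gd r1).
  - by rewrite -map_mxM (res_DD r1) map_mx0.
  - by rewrite mxE => /evnz; apply: (res_hd0 r1).
  - by rewrite mxE; apply/ev_homog/(res_gd0 r1).
  - by rewrite -map_mxM mxE; apply: evJ; rewrite Dg; apply: (res_Dg _ r1).
pose W := map_mx ev A *m B.
have WD : W *m D2 = D2 *m W.
  by rewrite -mulmxA B3 mulmxA -map_mxM A3 map_mxM evD mulmxA.
have Wg a : I ((W *m g2) a 0 - g2 a 0).
  have -> : (W *m g2) a 0 - g2 a 0 = (map_mx ev A *m (B *m g2 - map_mx ev g1)) a 0
      + ev ((A *m g1) a 0 - g2 a 0).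
    rewrite rmorphB mulmxBr mulmxA -map_mxM [(_ - map_mx _ _) a 0]mxE.
    rewrite [(- map_mx _ _) a 0]mxE [(map_mx ev (A *m g1)) a 0]mxE.
    have -> : ev (g2 a 0) = g2 a 0 by rewrite -[in RHS]evg mxE.
    by rewrite addrA subrK.
  apply: (idealD hI); last by apply: evJ.
  rewrite mxE; apply: (ideal_sum hI) => b _; apply: (idealMl hI).
  by rewrite mxBE.
have WE a b : W a b != 0 -> hd2 a = hd2 b.
  rewrite mxE => nz; have /existsP[c] : [exists c, map_mx ev A a c * B c b != 0].
    apply: contraNT nz; rewrite negb_exists => /forallP h.
    by rewrite big1 // => i _; apply/eqP; rewrite -[_ == _]negbK.
  rewrite mulf_eq0 negb_or mxE => /andP[/evnz/A1 + /B1].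
  by rewrite !addn0 => -> ->.
have Wh a b : shift_homog (gd2 a) (gd2 b) (W a b).
  rewrite mxE; apply: shift_homog_sum => c _; rewrite mxE.
  apply: (@shift_homogM _ _ _ (gd1 c)).
    by apply: ev_homog; have := A2 a c; rewrite addn0.
  by have := B2 c b; rewrite addn0.
have D0 c j : (D2 c j)@_0%MM = 0.
  apply/eqP; apply: contraT => nz; have nz' : D2 c j != 0.
    by apply: contraNneq nz => ->; rewrite mcoeff0.
  have := shift_homog_neq0 (res_gd r2 c j) nz.
  by rewrite !pure (res_hd r2 nz'); lia.
(* By induction on homological degree the row of [W - 1] is a cycle, hence a combination of rows of
   [D2] and without constant terms. By purity its entries are constants, so they vanish. *)
have W1 a : row a W = row a 1%:M.
  have [m] := ubnP (hd2 a); elim: m => // m IH in a *; rewrite ltnS => ha.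
  apply/eqP; rewrite -subr_eq0 -linearB /=; apply/eqP.
  have [w hw] : exists w, row a (W - 1%:M) = w *m D2.
    apply/(res_exact r2); split.
      rewrite -row_mul mulmxBl WD mul1mx -[X in _ - X]mulmx1 -mulmxBr.
      apply/rowP => j; rewrite !mxE big1 // => b _.
      have [->|nz] := eqVneq (D2 a b) 0; first by rewrite mul0r.
      have /IH/rowP/(_ j) : (hd2 b < m)%N by move: ha; rewrite (res_hd r2 nz).
      by rewrite !mxE => ->; rewrite subrr mulr0.
    by rewrite -row_mul mulmxBl mul1mx mxE mxBE.
  apply/rowP => j; rewrite [RHS]mxE; have [//|nz] := eqVneq (row a (W - 1%:M) 0 j) 0.
  have egd : gd2 a = gd2 j.
    have [->//|ne] := eqVneq a j; rewrite !pure; congr (2 * _)%N; apply: WE.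
    by move: nz; rewrite mxE mxBE [1%:M a j]mxE (negbTE ne) subr0.
  have hc : shift_homog (gd2 a) (gd2 j) (row a (W - 1%:M) 0 j).
    rewrite mxE mxBE; apply: shift_homogB => //.
    by rewrite egd mxE; case: eqP => _; [apply: shift_homog1 | apply: shift_homog0].
  rewrite (shift_homog_const egd hc) hw mxE raddf_sum big1 ?mpolyC0 // => c _.
  by rewrite /= mcoeff0M D0 mulr0.
(* The constant 1 on the diagonal factors through some basis vector [c] of the other resolution. An
   entry with nonzero constant term preserves internal degree, so [c] has the degrees of [a2]. *)
have : (W a2 a2)@_0%MM != 0.
  have /rowP/(_ a2) := W1 a2; rewrite mxE => ->.
  by rewrite !mxE eqxx mcoeff1 eqxx oner_eq0.
rewrite mxE raddf_sum /= => nz.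
have /existsP[c] : [exists c, (map_mx ev A a2 c * B c a2)@_0%MM != 0].
  apply: contraNT nz; rewrite negb_exists => /forallP h.
  by rewrite big1 // => i _; apply/eqP; rewrite -[_ == _]negbK.
rewrite mcoeff0M mulf_eq0 negb_or mxE ev0 => /andP[hA _]; exists c.
split.
  have /A1 : A a2 c != 0 by apply: contraNneq hA => ->; rewrite mcoeff0.
  by rewrite addn0.
have := shift_homog_neq0 (A2 a2 c) hA; by rewrite addn0.
Qed.

End KoszulDetection.

(** * The Koszul complex on one edge per triangle *)

Section Matching.

Variables (K : fieldType) (k : nat).
Local Notation n := (10 * k)%N.
Local Notation S := {mpoly K[n + n]}.
Implicit Types (i j : 'I_n) (c : nat).
Local Notation GI := (@graph_ideal K n).

(** At a centre the truncated subtraction yields the index of the first triangle of the block;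
    [matched] and the chain of primes treat centres separately. *)
Definition triangle_index i : nat := 3 * block_of i + (place i - 1) %/ 3.

(* From each triangle keep the edge between its first two vertices. *)
Definition matched i : bool := (place i != 0%N) && ((place i - 1) %% 3 != 2)%N.

Definition matching c : rel 'I_n := fun i j =>
  [&& matched i, matched j, triangle_index i == triangle_index j
    & triangle_index i < c]%N.

Definition matching_ideal c : S -> Prop := GI (matching c) pred0 pred0.

Lemma matching_config c : cliques_with_kills (matching c) pred0 pred0.
Proof.
split=> [i j|j i l|//]; rewrite /matching.
  rewrite andbCA [triangle_index i == _]eq_sym.
  by case: eqP => //= ->.
by move=> /and4P[-> _ /eqP -> _] /and4P[_ -> -> ->].
Qed.

Lemma matching_vertices c : (c < 3 * k)%N -> exists a b,
  [/\ a != b, matched a && matched b, triangle_index a = c, triangle_index b = c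
    & forall i, matched i -> triangle_index i = c -> i = a \/ i = b].
Proof.
move=> hc.
have ha : (10 * (c %/ 3) + (1 + 3 * (c %% 3)) < n)%N by lia.
have hb : (10 * (c %/ 3) + (2 + 3 * (c %% 3)) < n)%N by lia.
have c3 : (c %% 3 < 3)%N by rewrite ltn_pmod.
exists (Ordinal ha), (Ordinal hb).
have dv t : (t < 10)%N -> ((10 * (c %/ 3) + t) %/ 10 = c %/ 3)%N.
  by move=> ht; rewrite mulnC divnMDl // (divn_small ht) addn0.
have md t : (t < 10)%N -> ((10 * (c %/ 3) + t) %% 10 = t)%N.
  by move=> ht; rewrite mulnC modnMDl (modn_small ht).
have ta : (1 + 3 * (c %% 3) < 10)%N by lia.
have tb : (2 + 3 * (c %% 3) < 10)%N by lia.
rewrite /matched /triangle_index /block_of /place -val_eqE /= !dv // !md //.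
split; try lia.
move=> i /andP[i0 i2] hi.
have hi10 := ltn_pmod i (isT : (0 < 10)%N); have ei := divn_eq i 10.
suff [h|h] : (nat_of_ord i = 10 * (c %/ 3) + (1 + 3 * (c %% 3)) \/
    nat_of_ord i = 10 * (c %/ 3) + (2 + 3 * (c %% 3)))%N.
- by left; apply: val_inj.
- by right; apply: val_inj.
move: i0 i2 hi hi10 ei; clear.
move: (i %/ 10)%N (i %% 10)%N (nat_of_ord i) => q r w i0 i2 hi r10 ->.
lia.
Qed.

(** The next edge is regular modulo the previous ones, so the cone of f times the identity gives the
    next Koszul complex, where each homological step costs two internal degrees. Its entries are
    built from matched edges, hence fixed by [ev]. *)
Lemma matching_strand (ev : {rmorphism S -> S}) :
  (forall i j, matched i -> matched j -> ev (edge_minor K i j) = edge_minor K i j) ->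
  forall c, (c <= 3 * k)%N ->
  exists m (hd gd : 'I_m -> nat) D g,
  [/\ graded_res hd gd D g (matching_ideal c),
      forall a, gd a = (2 * hd a)%N, map_mx ev D = D, map_mx ev g = g
    & exists a, hd a = c].
Proof.
move=> hev; elim=> [|c IH] hc.
  exists 1%N, (fun=> 0%N), (fun=> 0%N), 0, (const_mx 1); split=> //.
  - apply: (graded_res_ext (I := fun p : S => p = 0)) => [p|].
      split=> [->|]; first exact: ideal_gen0.
      have h0 : homog_ideal (fun p : S => p = 0).
        split=> [//|a q q' -> ->|a b q ->]; first by rewrite mulr0 addr0.
        by rewrite raddf0.
      by apply: (graph_ideal_min h0) => // i j; rewrite /matching ltn0 !andbF.
    split.
    + by move=> a b; rewrite mxE eqxx.
    + by move=> a b; rewrite mxE; apply: shift_homog0.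
    + by [].
    + by move=> a; rewrite mxE; apply: shift_homog1.
    + by exists (const_mx 1); rewrite mxE big_ord1 !mxE mulr1 subrr.
    + move=> v; rewrite mulmx0; split=> [[_]|[w ->]]; last first.
        by rewrite mulmx0 mul0mx mxE.
      rewrite mxE big_ord1 [const_mx _ _ _]mxE mulr1 => v0; exists 0.
      by rewrite mulmx0; apply/rowP => i; rewrite ord1 v0 mxE.
  - by rewrite map_mx0.
  - by apply/matrixP => a b; rewrite !mxE rmorph1.
  - by exists 0.
have [m [hd [gd [D [g [r pure hD hg [a0 ha0]]]]]]] := IH (ltnW hc).
have [a [b [ab /andP[ma mb] ta tb tri]]] := matching_vertices hc.
have [h1 h2 h3] := matching_config c.
have hI : homog_ideal (matching_ideal c) := graph_ideal_homog K _ _ _.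
set f := edge_minor K a b.
have hcol : is_colon (matching_ideal c) f (matching_ideal c).
  apply: graph_colon => //; apply: param_edge_neq0 => //.
  by rewrite /matching ta ltnn !andbF.
have hf : shift_homog 2 0 f by exact: edge_minor_homog.
have r' := cone_res_map (M := f%:M) hI hf hcol r r.
exists (m + m)%N; do 4!eexists; split; first apply: (graded_res_ext _ (r' _ _ _ _)).
- move=> p; split.
    apply: ideal_add_min; first exact: graph_ideal_homog.
      move=> q; apply: graph_ideal_min => //; first exact: graph_ideal_homog.
      move=> i j /and4P[mi mj eij lt]; apply: graph_edge.
      by rewrite /matching mi mj eij ltnW.
    by apply: graph_edge; rewrite /matching ma mb ta tb eqxx ltnSn.
  have hIf := homog_ideal_add hI hf.
  apply: (graph_ideal_min hIf) => // i j /and4P[mi mj eij].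
  rewrite ltnS leq_eqVlt => /orP[/eqP ei|lt]; last first.
    by apply/ideal_addW/graph_edge; rewrite /matching mi mj eij.
  have hff : ideal_add (matching_ideal c) f f by exact: ideal_add_self.
  have ej : triangle_index j = c by rewrite -(eqP eij).
  case: (tri i mi ei) (tri j mj ej) => -> [] ->.
  + by rewrite edge_minor_diag; apply: (ideal0 hIf).
  + by [].
  + by rewrite edge_minor_sym; apply: (idealN hIf).
  + by rewrite edge_minor_diag; apply: (ideal0 hIf).
- by move=> u v; rewrite mxE; have [->|_] := eqVneq u v; rewrite ?mulr0n ?eqxx.
- move=> u v; rewrite mxE; have [->|_] := eqVneq u v.
    rewrite mulr1n -{2}[gd v]add0n addnC; exact: shift_homog_add.
  by rewrite mulr0n; apply: shift_homog0.
- by rewrite scalar_mxC.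
- by move=> u; rewrite mul_scalar_mx subrr; apply: (ideal0 hI).
- move=> u; case: (split_ordP u) => u' ->; rewrite !joinE pure //.
  by rewrite mulnS addnC.
- rewrite map_block_mx hD map_mx0 raddfN /= hD; congr block_mx.
  by rewrite map_scalar_mx /= hev.
- by rewrite map_col_mx hg map_mx0.
- by exists (rshift m a0); rewrite joinE ha0.
Qed.

Definition keep_matched : S -> S := mmap (@mpolyC _ K)
  (fun v => if join matched matched v then 'X_v else 0).

HB.instance Definition _ := GRing.RMorphism.on keep_matched.

Lemma keep_matched_x i : keep_matched (xvar K i) = if matched i then xvar K i else 0.
Proof. by rewrite /keep_matched /xvar mmapX mmap1U joinE. Qed.

Lemma keep_matched_y i : keep_matched (yvar K i) = if matched i then yvar K i else 0.
Proof. by rewrite /keep_matched /yvar mmapX mmap1U joinE. Qed.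

Lemma keep_matched_edge i j : keep_matched (edge_minor K i j) =
  if matched i && matched j then edge_minor K i j else 0.
Proof.
rewrite /edge_minor rmorphB !rmorphM /= !keep_matched_x !keep_matched_y.
by case: matched; case: matched; rewrite ?mulr0 ?mul0r ?subrr.
Qed.

Lemma keep_matched_X m : keep_matched 'X_[m] =
  if [forall v, join matched matched v || (m v == 0%N)] then 'X_[m] else 0.
Proof.
rewrite /keep_matched mmapX /mmap1; case: ifP => [/forallP h|/negbT].
  rewrite [RHS]mpolyXE_id; apply: eq_bigr => v _.
  by have := h v; case: ifP => //= _ /eqP ->; rewrite !expr0.
rewrite negb_forall => /existsP[v]; rewrite negb_or => /andP[/negbTE hv nz].
by rewrite (bigD1 v) //= hv expr0n (negbTE nz) mul0r.
Qed.

Lemma keep_matchedE p : keep_matched p =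
  \sum_(m <- msupp p) p@_m *: keep_matched 'X_[m].
Proof.
rewrite [in LHS](mpolyE p) rmorph_sum; apply: eq_bigr => m _ /=.
by rewrite -mul_mpolyC rmorphM /= {1}/keep_matched mmapC mul_mpolyC.
Qed.

Lemma keep_matched_homog a b p :
  shift_homog a b p -> shift_homog a b (keep_matched p).
Proof.
move=> /shift_homogP hp; rewrite keep_matchedE big_seq.
apply: shift_homog_sum => m /hp <-; rewrite keep_matched_X.
case: ifP => _; last by rewrite scaler0; apply: shift_homog0.
by apply/shift_homogP => m' /msuppZ_le; rewrite msuppX inE => /eqP ->.
Qed.

Lemma keep_matched0 p : (keep_matched p)@_0%MM = p@_0%MM.
Proof.
rewrite keep_matchedE raddf_sum [in RHS](mpolyE p) raddf_sum.
apply: eq_bigr => m _; rewrite /= !mcoeffZ; congr (_ * _); rewrite keep_matched_X.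
case: ifP => // /negbT; rewrite negb_forall => /existsP[v].
rewrite negb_or mcoeff0 mcoeffX => /andP[_ nz].
by case: eqP => // m0; rewrite m0 mnm0E eqxx in nz.
Qed.

(** The retraction killing unmatched variables sends the graph ideal into the matching ideal:
    centres are unmatched, and two matched vertices joined by an edge lie in the same triangle. The
    Koszul basis vector in degrees (3k, 6k) is thereby found in any resolution. *)
Lemma cone_res_detects m (hd gd : 'I_m -> nat) D g :
  graded_res hd gd D g (@state_ideal K k (fun=> ConeBlock)) ->
  exists a, hd a = (3 * k)%N /\ gd a = (6 * k)%N.
Proof.
move=> r.
have hev i j : matched i -> matched j ->
    keep_matched (edge_minor K i j) = edge_minor K i j.
  by rewrite keep_matched_edge => -> ->.
have [m2 [hd2 [gd2 [D2 [g2 [r2 pure hD hg [a2 ha2]]]]]]] :=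
  matching_strand (ev := keep_matched) hev (leqnn _).
have hJ : homog_ideal (@state_ideal K k (fun=> ConeBlock)).
  exact: graph_ideal_homog.
have hI : homog_ideal (matching_ideal (3 * k)) by exact: graph_ideal_homog.
have tri_lt i : (triangle_index i < 3 * k)%N.
  have := place_lt i; have := block_lt i; rewrite /triangle_index.
  move: (block_of i) (place i) => u v; lia.
have [|p|a1 [h1 h2]] := pure_strand_detected (ev := keep_matched) hJ hI _ r r2 pure
  keep_matched_homog keep_matched0 _ hD hg a2.
- move=> p; apply: (graph_ideal_min hJ) => // i j /and4P[mi mj /eqP eij _].
  apply: graph_edge; move: mi mj eij; rewrite /matched /triangle_index /edges_of.
  move=> /andP[pi _] /andP[pj _] e; have li := place_lt i; have lj := place_lt j.
  have eb : block_of i = block_of j.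
    by move: e pi pj li lj; move: (block_of i) (block_of j) (place i) (place j); lia.
  rewrite eb eqxx /= /same_triangle pi pj /=; apply/or3P; constructor 3.
  by apply/eqP; move: e; rewrite eb => /addnI.
- elim=> [|a q p' hq _ IH]; first by rewrite rmorph0; apply: (ideal0 hI).
  rewrite rmorphD rmorphM /=; apply: (idealD hI) => //; apply: (idealMl hI).
  case: hq => [[i [j [eij ->]]]|[i hi //]|[i hi //]].
  rewrite keep_matched_edge; case: ifP => [/andP[mi mj]|_]; last exact: (ideal0 hI).
  apply: graph_edge; rewrite /matching mi mj tri_lt andbT /=.
  move: eij; rewrite /edges_of => /andP[/eqP eb] /=.
  have /andP[/negbTE -> _] := mi; have /andP[/negbTE -> _] := mj => /=.
  by rewrite /triangle_index eb => /and3P[_ _ /eqP ->].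
- by exists a1; rewrite h1 h2 pure ha2 mulnA.
Qed.

End Matching.

(** * Growth of the Hilbert function and Krull dimension *)

Section Growth.

Import Num.Theory.

Implicit Types (a : nat -> int) (p h : {poly int}).

Lemma conv_sum a m : conv a (1 - 'X) m =
  a m - (if m is m'.+1 then a m' else 0).
Proof.
rewrite convB conv1 -['X]mulr1 -['X]expr1 convXn; case: m => [|m] //=.
by rewrite conv1 subn1.
Qed.

(** Dividing a series by 1 - t is partial summation. *)
Lemma conv_inv a m : a m = \sum_(i < m.+1) conv a (1 - 'X) i.
Proof.
elim: m => [|m IH]; first by rewrite big_ord1 conv_sum subr0.
by rewrite big_ord_recr /= -IH conv_sum addrC subrK.
Qed.

Lemma absz_sum_le l (F : 'I_l -> int) :
  (`|(\sum_(i < l) F i)%R| <= \sum_(i < l) `|F i|)%N.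
Proof.
elim/big_rec2: _ => // i u v _ h; apply: (@leq_trans (absz (F i) + absz v)); first by lia.
by rewrite leq_add2l.
Qed.

(** The partial sums [T] of [H] satisfy T (1 - t)^(d+1) = h. Undoing one factor gives a sequence
    bounded by the sum of the absolute coefficients of h, and each of the other d partial summations
    raises the power of m + 1 by one. *)
Lemma sum_growth (H : nat -> nat) h d :
  (forall m, conv (fun i => (H i)%:Z) ((1 - 'X) ^+ d) m = h`_m) ->
  exists A, forall M, (\sum_(i < M.+1) H i <= A * M.+1 ^ d)%N.
Proof.
move=> hH; pose T m : int := \sum_(i < m.+1) (H i)%:Z.
have TH m : conv T (1 - 'X) m = (H m)%:Z.
  rewrite conv_sum; case: m => [|m]; first by rewrite subr0 /T big_ord1.
  by rewrite /T [X in X - _]big_ord_recr /= addrAC subrr add0r.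
pose U j := conv T ((1 - 'X) ^+ j).
have UU j m : U j m = \sum_(i < m.+1) U j.+1 i.
  rewrite [LHS]conv_inv; apply: eq_bigr => i _.
  by rewrite /U exprSr convM.
have Uh m : U d.+1 m = h`_m.
  by rewrite /U exprS convM -hH; apply: eq_conv => i; apply: TH.
pose A := (\sum_(i < size h) `|(h`_i)%R|)%N.
have bd m : (`|U d m| <= A)%N.
  rewrite UU; apply: (leq_trans (absz_sum_le (fun i : 'I_m.+1 => U d.+1 i))).
  rewrite (eq_bigr (fun i : 'I_m.+1 => `|(h`_i)%R|%N)) => [|i _]; last by rewrite Uh.
  rewrite /A -(big_mkord xpredT (fun i => `|(h`_i)%R|%N)).
  rewrite -(big_mkord xpredT (fun i => `|(h`_i)%R|%N)).
  have [le|lt] := leqP m.+1 (size h).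
    by rewrite [X in (_ <= X)%N](big_cat_nat (n := m.+1)) //= leq_addr.
  rewrite (big_cat_nat (n := size h)) //=; last exact: ltnW.
  rewrite [X in (_ + X)%N](_ : _ = 0%N) ?addn0 // big_nat_cond big1 // => i.
  by move=> /andP[/andP[le _] _]; rewrite nth_default.
have bdj j m : (j <= d)%N -> (`|U (d - j)%N m| <= A * m.+1 ^ j)%N.
  elim: j m => [|j IH] m hj; first by rewrite subn0 expn0 muln1.
  rewrite UU; have -> : (d - j.+1).+1 = (d - j)%N by rewrite -subSn.
  apply: (leq_trans (absz_sum_le (fun i : 'I_m.+1 => U (d - j)%N i))).
  apply: leq_trans (_ : (\sum_(i < m.+1) A * m.+1 ^ j <= _)%N); last first.
    by rewrite sum_nat_const card_ord expnS mulnCA.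
  apply: leq_sum => i _; apply: leq_trans (IH i (ltnW hj)) _.
  by rewrite leq_mul2l; case: (j) => [|j']; rewrite ?expn0 ?leqnn ?leq_exp2r ?ltn_ord ?orbT.
exists A => M; have := bdj d M (leqnn d).
rewrite subnn /U expr0 conv1 /T.
suff -> : \sum_(i < M.+1) (H i)%:Z = (\sum_(i < M.+1) H i)%N%:Z by [].
by rewrite (big_morph Posz PoszD (erefl _)).
Qed.

End Growth.

(** * Chains of primes bounded by the growth of the Hilbert function *)

Section ChainBound.

Variables (K : fieldType) (N : nat).
Local Notation S := {mpoly K[N]}.
Implicit Types (p q f : S) (I J P : S -> Prop).

(** As f lies in P', the term of exponent 0 lies in P' and so is zero by hypothesis. The remaining
    sum is divisible by f, which P, being prime and without f, allows to cancel. *)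
Lemma power_free P P' f : prime_ideal P -> prime_ideal P' ->
  (forall p, P p -> P' p) -> P' f -> ~ P f ->
  forall l (s : 'I_l -> S), (forall i, P' (s i) -> s i = 0) ->
  P (\sum_(i < l) f ^+ i * s i) -> forall i, s i = 0.
Proof.
move=> hP hP' sub hf nf; elim=> [s _ _ []|l IH s hs] //.
have [h0 hl _ hpr] := hP; have [h0' hl' _ _] := hP'.
rewrite big_ord_recl expr0 mul1r.
have -> : \sum_(i < l) f ^+ lift ord0 i * s (lift ord0 i) =
    f * \sum_(i < l) f ^+ i * s (lift ord0 i).
  by rewrite mulr_sumr; apply: eq_bigr => i _; rewrite exprS mulrA.
set t := \sum_(i < l) _ => h.
have s0 : s ord0 = 0.
  apply: hs; rewrite -[s ord0](addrK (f * t)) addrC [f * t]mulrC -mulNr.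
  by apply: hl' => //; rewrite mulrC; apply: sub.
move: h; rewrite s0 add0r => /hpr[/nf //|/IH{}IH] i.
case: (unliftP ord0 i) => [j ->|-> //]; apply: IH => j'; exact: hs.
Qed.

Lemma msizeM_le p q a b : (msize p <= a.+1)%N -> (msize q <= b.+1)%N ->
  (msize (p * q) <= (a + b).+1)%N.
Proof.
have [->|p0] := eqVneq p 0; first by rewrite mul0r msize0.
have [->|q0] := eqVneq q 0; first by rewrite mulr0 msize0.
rewrite msizeM //; move: (msize p) (msize q) => u v; clear; lia.
Qed.

Lemma msize_exp_le f i : (msize (f ^+ i) <= (i * msize f).+1)%N.
Proof.
elim: i => [|i IH]; first by rewrite expr0 msize1.
by rewrite exprS mulSn; apply: msizeM_le.
Qed.

(** Take f in P_1 outside P_0. Multiplying a family free modulo P_1 by f^i for i < l makes it l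
    times as large and free modulo P_0. Degrees stay linear in l, with slope [e] independent of
    l. *)
Lemma chain_free d (P : nat -> S -> Prop) :
  (forall i, (i <= d)%N -> prime_ideal (P i)) ->
  (forall i, (i < d)%N -> (forall p, P i p -> P i.+1 p) /\
     exists2 p, P i.+1 p & ~ P i p) ->
  exists e, forall l, exists (X : finType) (b : X -> S),
    [/\ #|X| = (l ^ d)%N, mod_free b (P 0%N) & forall x, (msize (b x) <= (e * l).+1)%N].
Proof.
elim: d P => [|d IH] P hP hs.
  exists 0%N => l; exists unit, (fun=> 1); split=> [|c|x].
  - by rewrite card_unit.
  - rewrite (big_pred1 tt) => [h [] |[] //]; apply/eqP; apply/negP => /negP nz.
    have [h0 hl h1 _] := hP 0%N isT; apply: h1.
    have := hl ((c tt)^-1)%:MP _ _ h h0.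
    by rewrite addr0 -mul_mpolyC mulr1 -mpolyCM mulVf.
  - by rewrite msize1.
have [sub [f hf nf]] := hs 0%N isT.
have [|i|e he] := IH (fun i => P i.+1); [by move=> i hi; apply: hP | by move=> hi; apply: (hs i.+1) |].
exists (e + (msize f))%N => l; have [X [b [h1 h2 h3]]] := he l.
exists ('I_l * X)%type, (fun u : 'I_l * X => f ^+ u.1 * b u.2); split.
- by rewrite card_prod card_ord h1 expnS.
- move=> c hc [i x]; apply: (h2 (fun x => c (i, x))).
  (* The coefficient of each power of f is a combination of the [b x]; if it lies in P_1 it is zero,
     by freeness modulo P_1. *)
  rewrite (power_free (hP 0%N isT) (hP 1%N isT) sub hf nf
    (s := fun i => \sum_x c (i, x) *: b x)).
  + by have [] := hP 1%N isT.
  + by move=> j hj; rewrite big1 // => z _; rewrite (h2 (fun x => c (j, x)) hj) scale0r.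
  + move: hc; congr (P 0%N).
    rewrite (eq_bigr (fun u : 'I_l * X => c (u.1, u.2) *: (f ^+ u.1 * b u.2))) => [|[] //].
    rewrite -(pair_bigA _ (fun i x => c (i, x) *: (f ^+ i * b x))) /=.
    by apply: eq_bigr => j _; rewrite mulr_sumr; apply: eq_bigr => z _; rewrite scalerAr.
- move=> [i x] /=; apply: leq_trans (msizeM_le (msize_exp_le f i) (h3 x)) _.
  by rewrite ltnS addnC mulnDl leq_add2l mulnC leq_mul2l [(i <= l)%N]ltnW ?orbT.
Qed.

Lemma span_bounded J (H : nat -> nat) : homog_ideal J ->
  (forall m, quotient_dim J m (H m)) -> forall M, exists (Q : finType) (s : Q -> S),
  #|Q| = (\sum_(i < M.+1) H i)%N /\
  forall p, (msize p <= M.+1)%N -> mod_span s J p.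
Proof.
move=> hJ hH M.
have /fin_all_exists[b hb] : forall i : 'I_M.+1, exists b : 'I_(H i) -> S,
    forall p, p \is i.-homog -> mod_span b J p.
  by move=> i; have [b [_ b2 _]] := hH i; exists b.
exists {i : 'I_M.+1 & 'I_(H i)}, (fun u => b (tag u) (tagged u)); split.
  rewrite card_tagged sumnE big_map big_enum /=; apply: eq_bigr => i _.
  by rewrite card_ord.
move=> p hp; rewrite (pihomog_partitionE hp).
rewrite (eq_bigr (fun i : 'I_M.+1 => 1 *: pihomog mdeg i p)) => [|i _]; last first.
  by rewrite scale1r.
apply: (mod_span_sum hJ) => i _.
have [c hc] := hb i _ (pihomogP mdeg i p).
rewrite -(subrK (\sum_x c x *: b i x) (pihomog _ _ _)) -[X in mod_span _ _ (X + _)]scale1r.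
apply: (mod_span_lin hJ); first exact: mod_span0.
apply: (mod_span_sum hJ) => x _.
exact: (mod_span_id hJ (fun u => b (tag u) (tagged u)) (existT _ i x)).
Qed.

(** A chain of length d' gives l^d' independent elements of degree at most e l, while the space they
    span modulo J has dimension of order l^d. *)
Lemma chain_length_le J (H : nat -> nat) A d d' : homog_ideal J ->
  (forall m, quotient_dim J m (H m)) ->
  (forall M, \sum_(i < M.+1) H i <= A * M.+1 ^ d)%N ->
  prime_chain J d' -> (d' <= d)%N.
Proof.
move=> hJ hH hA [P [h1 h2]]; rewrite leqNgt; apply/negP => lt.
have [|e he] := chain_free (P := P) _ h2; first by move=> i /h1[].
(* Chosen so that A (e l + 1)^d is at most A ((e + 1) l)^d, which is less than l^(d + 1). *)
pose l := (A * e.+1 ^ d).+1.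
have [X [b [b1 b2 b3]]] := he l.
have [Q [s [s1 s2]]] := span_bounded hJ hH (e * l).
have : (#|X| <= #|Q|)%N.
  apply: (mod_free_le_span hJ (b := b) (s := s)) => [c hc|x]; last exact: s2.
  by apply: b2; have [_] := h1 0%N isT; apply.
rewrite b1 s1 => le; have := leq_trans le (hA _); rewrite leqNgt => /negP; apply.
apply: leq_ltn_trans (_ : (A * (e.+1 * l) ^ d < _)%N).
  by rewrite leq_mul2l; case: (d) => [|j]; rewrite ?expn0 ?orbT // leq_exp2r // mulSn -add1n leq_add2r orbT.
rewrite expnMn mulnA; apply: leq_trans (_ : (l * l ^ d <= _)%N).
  by rewrite ltn_pmul2r // expn_gt0.
by rewrite -expnS; apply: leq_pexp2l.
Qed.

End ChainBound.

(** * Hilbert series of the polynomial ring, from its irrelevant ideal *)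

Section PolynomialRing.

Variables (K : fieldType) (n : nat).
Local Notation S := {mpoly K[n + n]}.
Local Notation m0 := (@graph_ideal K n (fun _ _ => false) (mem (enum 'I_n)) (mem (enum 'I_n))).

Lemma mem_irrelevant m : m != 0%MM -> m0 'X_[m].
Proof.
have hI : homog_ideal m0 := graph_ideal_homog K _ _ _.
move=> nz; have [v hv] : exists v, m v != 0%N.
  apply/existsP; rewrite -negb_forall; apply: contraNN nz => /forallP h.
  by apply/eqP/mnmP => v; rewrite mnmE; apply/eqP.
rewrite (_ : m = (m - U_(v)) + U_(v))%MM; last first.
  by rewrite submK // lep1mP.
rewrite mpolyXD; apply: (idealMl hI).
case: (split_ordP v) => i ->; first by apply: graph_x; rewrite /= mem_enum.
by apply: graph_y; rewrite /= mem_enum.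
Qed.

Lemma irrelevant_dim m : quotient_dim m0 m (m == 0%N).
Proof.
have hI : homog_ideal m0 := graph_ideal_homog K _ _ _.
have [_ _ h1 _] : prime_ideal m0 by apply: graph_prime.
exists (fun=> 1); case: m => [|m]; split=> //=.
- by move=> i; rewrite dhomog1.
- move=> p hp; exists (fun=> p@_0%MM); rewrite big_ord1 -mul_mpolyC mulr1.
  suff -> : p = (p@_0%MM)%:MP by rewrite mcoeffC eqxx mulr1 subrr; apply: ideal0.
  apply/mpolyP => k; rewrite mcoeffC; case: eqVneq => [->|nz]; first by rewrite mulr1.
  by rewrite mulr0; apply: (dhomog_nemf_coeff hp); rewrite mdeg_eq0 // eq_sym.
- move=> c hc i; rewrite ord1; apply/eqP; apply/negP => /negP nz; apply: h1.
  move: hc; rewrite big_ord1 => /(idealZ hI (c ord0)^-1).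
  by rewrite scalerA mulVf // scale1r.
- by case.
- move=> p hp; exists (fun=> 0); rewrite big_ord0 subr0 (homog_monomials hp).
  rewrite big_seq; apply: (ideal_sum hI) => k.
  rewrite mem_monomials => /eqP hk; apply: (idealZ hI); apply: mem_irrelevant.
  by rewrite -mdeg_eq0 hk.
- by move=> c _ [].
Qed.

(** Killing all 2n variables multiplies the series by (1 - t)^(2n) and leaves the series 1 of K, so
    no counting of monomials is needed. *)
Lemma conv_monomials m :
  conv (fun i => (size (monomials (n + n) i))%:Z) ((1 - 'X) ^+ (n + n)) m = (m == 0%N)%:Z.
Proof.
have [_ [H h1 h2]] := good_isolated K (enum_uniq 'I_n) (enum_uniq 'I_n).
rewrite size_enum_ord in h2; rewrite -h2; congr Posz.
apply: (quotient_dim_uniq (graph_ideal_homog K _ _ _) (h1 m)).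
exact: irrelevant_dim.
Qed.

End PolynomialRing.

Lemma conv_delta (p : {poly int}) m : conv (fun i => (i == 0%N)%:Z) p m = p`_m.
Proof.
rewrite /conv big_ord_recl /= mul1r subn0 big1 ?addr0 // => i _.
by rewrite mul0r.
Qed.

(** * Hilbert series and Krull dimension of the graph ideal *)

Section Krull.

Variables (K : fieldType) (k : nat).
Local Notation n := (10 * k)%N.
Local Notation S := {mpoly K[n + n]}.
Local Notation J := (@state_ideal K k (fun=> ConeBlock)).

Definition block_h : {poly int} := 1 + 'X *+ 8 + 'X ^+ 2 *+ 18.

(** Divided by (1 - z)^8 the left side is (1 + 2 z)^3 + z (1 - z)^2 + z (1 - z) (1 + 9 z), where the
    cubic terms 8 + 1 - 9 cancel. *)
Lemma cone_num_identity (R : comNzRingType) (z : R) :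
  let c m := (1 - z) ^+ m.-1 * (1 + z *+ m.-1) in
  (1 - z) * (1 - z) * c 3%N * c 3%N * c 3%N + z ^+ 1 * (1 - z) ^+ 10 + z ^+ 1 * c 10%N =
  (1 - z) ^+ 8 * (1 + z *+ 8 + z ^+ 2 *+ 18).
Proof. by rewrite /=; ring. Qed.

Lemma cone_num : state_num ConeBlock = (1 - 'X) ^+ 8 * block_h.
Proof. exact: cone_num_identity. Qed.

Lemma cone_hilbert : exists2 H : nat -> nat,
  forall m, quotient_dim J m (H m)
  & forall m, conv (fun i => (H i)%:Z) ((1 - 'X) ^+ (12 * k)) m = (block_h ^+ k)`_m.
Proof.
have [[_ [H h1 h2]] _] := good_state K k (fun=> ConeBlock).
exists H => // m; rewrite (eq_conv _ _ h2) -convM big_const_ord iter_mulr_1 cone_num.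
rewrite exprMn -exprM mulrAC -exprD.
rewrite (_ : (8 * k + 12 * k = n + n)%N); last by lia.
by rewrite convM (eq_conv _ _ (@conv_monomials K n)) conv_delta.
Qed.

(** Each triangle takes four steps of the chain, one more than it has vertices, because [chain_ky]
    delays the y of its third vertex by one. *)
Definition chain_pos (i : 'I_n) : nat := 4 * triangle_index i + (place i - 1) %% 3.
Definition chain_kx c : pred 'I_n := fun i => (place i == 0%N) || (chain_pos i < c)%N.
Definition chain_ky c : pred 'I_n := fun i =>
  (place i == 0%N) || (chain_pos i + ((place i - 1) %% 3 == 2) < c)%N.

(* Inside each triangle the variables are killed in the order
   x_1 and y_1, x_2 and y_2, x_3, y_3, which keeps the ideal prime. *)
Definition chain_ideal c : S -> Prop :=
  graph_ideal (edges_of (fun=> TriangleBlock)) (chain_kx c) (chain_ky c).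

Lemma same_triangle_index (i j : 'I_n) : edges_of (fun=> TriangleBlock) i j ->
  [/\ place i != 0%N, place j != 0%N & triangle_index i = triangle_index j].
Proof.
by move=> /andP[/eqP e1 /and3P[h1 h2 /eqP e2]]; rewrite /triangle_index e1 e2.
Qed.

(** Killing x and y of a vertex together respects the edge condition. When the third vertex has lost
    x but not y, the two others are already killed completely, so both terms of each edge are
    killed. *)
Lemma chain_config c :
  cliques_with_kills (edges_of (fun=> TriangleBlock)) (chain_kx c) (chain_ky c).
Proof.
have [h1 h2 _] := @state_config k (fun=> TriangleBlock) (fun=> isT).
split=> // i j /same_triangle_index[hi hj e].
rewrite /chain_kx /chain_ky /chain_pos (negbTE hi) (negbTE hj) e /=.
have := ltn_pmod (place i - 1) (isT : (0 < 3)%N).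
have := ltn_pmod (place j - 1) (isT : (0 < 3)%N).
move: (_ %% 3)%N (_ %% 3)%N (triangle_index j) => a b t; clear.
case: a => [|[|[|a]]] //; case: b => [|[|[|b]]] //= _ _; rewrite ?addn0; lia.
Qed.

Lemma chain_vertex t b : (t < 3 * k)%N -> (b < 3)%N -> exists i : 'I_n,
  [/\ place i != 0%N, triangle_index i = t & ((place i - 1) %% 3 = b)%N].
Proof.
move=> ht hb.
have lt : (10 * (t %/ 3) + (1 + 3 * (t %% 3) + b) < n)%N by lia.
exists (Ordinal lt); rewrite /triangle_index /block_of /place /=; split; lia.
Qed.

(** The chain starts at the prime where all centres are killed and only disjoint triangles remain,
    and takes 4 steps in each of the 3k triangles. *)
Lemma cone_chain : prime_chain J (12 * k).
Proof.
exists chain_ideal; split=> i hi; split.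
- by have [h1 h2 h3] := chain_config i; apply: graph_prime.
- have hP : homog_ideal (chain_ideal i) := graph_ideal_homog K _ _ _.
  move=> p; apply: (graph_ideal_min hP) => // a b.
  have [a0|a0] := eqVneq (place a) 0%N.
    move=> _; apply: (idealB hP); apply: (idealMr hP).
      by apply: graph_x; rewrite /chain_kx a0.
    by apply: graph_y; rewrite /chain_ky a0.
  have [b0|b0] := eqVneq (place b) 0%N.
    move=> _; apply: (idealB hP); apply: (idealMl hP).
      by apply: graph_y; rewrite /chain_ky b0.
    by apply: graph_x; rewrite /chain_kx b0.
  move=> h; apply: graph_edge; move: h.
  by rewrite /edges_of /= (negbTE a0) (negbTE b0).
- have hP : homog_ideal (chain_ideal i.+1) := graph_ideal_homog K _ _ _.
  move=> p; apply: (graph_ideal_min hP) => [a b|a h|a h].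
  + exact: graph_edge.
  + apply: graph_x; move: h; rewrite /chain_kx => /orP[->//|h].
    by rewrite [(_ < i.+1)%N]ltnW ?orbT // ltnS.
  + apply: graph_y; move: h; rewrite /chain_ky => /orP[->//|h].
    by rewrite [(_ < i.+1)%N]ltnW ?orbT // ltnS.
- have [h1 h2 h3] := chain_config i.
  have ht : (i %/ 4 < 3 * k)%N by lia.
  have hpos := divn_eq i 4.
  have [lt|ge] := ltnP (i %% 4) 3.
    have [v [v1 v2 v3]] := chain_vertex ht lt.
    have vi : chain_pos v = i by rewrite /chain_pos v2 v3 mulnC.
    exists (xvar K v); first by apply: graph_x; rewrite /chain_kx vi leqnn orbT.
    move=> /(graph_idealE h1 h2 h3)/eqP; apply/negP; apply: param_x_neq0.
    by rewrite /chain_kx vi ltnn orbF.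
  have [v [v1 v2 v3]] := chain_vertex ht (isT : (2 < 3)%N).
  have vi : (chain_pos v + ((place v - 1) %% 3 == 2) = i)%N.
    by rewrite /chain_pos v2 v3 /=; lia.
  exists (yvar K v); first by apply: graph_y; rewrite /chain_ky vi leqnn orbT.
  move=> /(graph_idealE h1 h2 h3)/eqP; apply/negP; apply: param_y_neq0.
  by rewrite /chain_ky vi ltnn orbF.
Qed.

Lemma cone_krull_dim : krull_dim J (12 * k).
Proof.
split=> [|d]; first exact: cone_chain.
have [H h1 h2] := cone_hilbert; have [A hA] := sum_growth h2.
exact: chain_length_le (graph_ideal_homog K _ _ _) h1 hA.
Qed.

Lemma cone_h_polynomial : h_polynomial J (block_h ^+ k).
Proof.
have [H h1 h2] := cone_hilbert.
by exists (12 * k)%N, H; split=> //; apply: cone_krull_dim.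
Qed.

Lemma deg_block_h : (size (block_h ^+ k)).-1 = (2 * k)%N.
Proof.
suff sb : size block_h = 3%N by rewrite size_exp sb.
rewrite /block_h addrC -!scaler_nat.
have sz (c : int) i : c != 0 -> size (c *: ('X ^+ i : {poly int})) = i.+1.
  by move=> c0; rewrite size_scale // size_polyXn.
have := sz 8%:R 1%N isT; rewrite expr1 => s1.
rewrite size_polyDl ?sz //; apply: leq_ltn_trans (size_polyD _ _) _.
by rewrite s1 size_poly1.
Qed.

End Krull.

(** * Conversion to graded free complexes *)

Section Conversion.

Variables (K : fieldType) (N : nat).
Local Notation S := {mpoly K[N]}.
Implicit Types (p : S) (I J : S -> Prop).

Lemma shift_homog_dhomog a b p : shift_homog a b p ->
  p \is (a - b)%N.-homog /\ ((a < b)%N -> p = 0).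
Proof.
move=> /shift_homogP h; split; first by apply/dhomogP => m /h <-; rewrite addnK.
move=> lt; apply/eqP; rewrite -msupp_eq0; case: (msupp p) h => // m s h.
by have := h m (mem_head _ _); move: (mdeg m) lt => u; clear; lia.
Qed.

Section Complex.

Variables (n : nat) (hd gd : 'I_n -> nat) (D : 'M[S]_n) (g : 'cV[S]_n).
Variable I : S -> Prop.
Hypothesis res : graded_res hd gd D g I.

Let A i := [set a | hd a == i].
Local Notation E i := (selmx {mpoly K[N]} (A i)).

(** Recovers the separate terms of the complex by sorting the basis vectors by homological degree;
    all terms of large degree are zero. *)
Definition split_complex : graded_free_complex K N :=
  @GradedFreeComplex K N (fun i => #|A i|) (fun i c => gd (enum_val c))
    (fun i => E i.+1 *m D *m (E i)^T) (E 0 *m g).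

Lemma split_diffE i : E i.+1 *m D = gdiff split_complex i *m E i.
Proof.
rewrite [RHS]selTK // => a b; rewrite inE sel_mulE => hb.
apply/eqP; apply: contraNT hb => /(res_hd res).
by have := enum_valP a; rewrite inE => /eqP -> [->].
Qed.

Lemma split_diffTE i : D *m (E i)^T = (E i.+1)^T *m gdiff split_complex i.
Proof.
rewrite /= -[E i.+1 *m D *m _]mulmxA mulmxA; apply: trmx_inj; rewrite !trmx_mul !trmxK.
rewrite mulmxA selTK // => a b; rewrite inE => hb.
rewrite sel_mulE mxE; apply/eqP; apply: contraNT hb => /(res_hd res) ->.
by have := enum_valP a; rewrite inE => /eqP ->.
Qed.

Lemma split_augE i : E i.+1 *m g = 0.
Proof.
apply/colP => a; rewrite sel_mulE [RHS]mxE; apply/eqP/negPn/negP => /(res_hd0 res).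
by have := enum_valP a; rewrite inE => /eqP ->.
Qed.

Lemma split_augTE : g = (E 0)^T *m gaug split_complex.
Proof.
apply: trmx_inj; rewrite !trmx_mul trmxK selTK // => a b; rewrite inE mxE => hb.
by apply/eqP; apply: contraNT hb; rewrite ord1 => /(res_hd0 res)/eqP.
Qed.

Lemma split_row0 : E 0 *m D = 0.
Proof.
apply/matrixP => a b; rewrite sel_mulE [RHS]mxE; apply/eqP/negPn/negP => /(res_hd res).
by have := enum_valP a; rewrite inE => /eqP ->.
Qed.

Lemma split_resolution : graded_free_resolution I split_complex.
Proof.
have aug i (w : 'rV[S]_#|A i.+1|) : I ((w *m E i.+1 *m g) 0 0).
  rewrite -mulmxA split_augE mulmx0 mxE.
  by have := res_Dg 0 res; rewrite !mul0mx mxE.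
split.
- by move=> c; rewrite sel_mulE homogE; apply: (res_gd0 res).
- by move=> i a c; rewrite mul_selTE sel_mulE; apply/shift_homog_dhomog/(res_gd res).
- have [v hv] := res_gen res; exists (v *m (E 0)^T).
  by rewrite -mulmxA -split_augTE.
- move=> v; split=> [hv|[w ->]].
    have [|w hw] := (res_exact res (v *m E 0)).1.
      by rewrite -!mulmxA split_row0 mulmx0.
    by exists (w *m (E 1)^T); rewrite -mulmxA -split_diffTE mulmxA -hw selK.
  rewrite mulmxA -[w *m _ *m _]mulmxA -split_diffE mulmxA.
  exact: res_Dg res.
- move=> i v; split=> [hv|[w ->]].
    have [|w hw] := (res_exact res (v *m E i.+1)).1.
      split; last exact: aug.
      by rewrite -mulmxA split_diffE mulmxA hv mul0mx.
    by exists (w *m (E i.+2)^T); rewrite -mulmxA -split_diffTE mulmxA -hw selK.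
  rewrite -mulmxA; suff -> : gdiff split_complex i.+1 *m gdiff split_complex i = 0.
    by rewrite mulmx0.
  rewrite [gdiff _ i]/= !mulmxA -split_diffE -[E i.+2 *m D *m D]mulmxA.
  by rewrite (res_DD res) mulmx0 mul0mx.
Qed.

Hypothesis minD : minimal D.

(** Minimality makes the differential vanish after tensoring with K, so the Betti number counts
    basis vectors with the given degrees. *)
Lemma split_tor_dim i j :
  (tor_dim split_complex i j != 0%N) = [exists a, (hd a == i) && (gd a == j)].
Proof.
have d0 l : tensor_diff split_complex l = 0.
  by apply/matrixP => a b; rewrite mxE [RHS]mxE mul_selTE sel_mulE minD.
rewrite /tor_dim /tensor_boundaries d0 mulmx0 mxrank0 subn0.
have -> : \rank (tensor_cycles split_complex i j) = \rank (tensor_comp split_complex i j).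
  case: i => //= i; apply/eqmx_rank/eqmxP/capmx_idPl.
  by rewrite d0; apply/sub_kermxP; rewrite mulmx0.
rewrite mxrank_eq0; apply/idP/existsP => [nz|[a /andP[ha /eqP ga]]].
  have [c hc] : exists c : 'I_#|A i|, gd (enum_val c) == j.
    apply/existsP; apply: contraNT nz => /existsPn h; apply/eqP/matrixP => a b.
    by rewrite !mxE /= (negbTE (h a)) mul0rn.
  by exists (enum_val c); rewrite hc andbT; have := enum_valP c; rewrite inE.
have aA : a \in A i by rewrite inE.
apply/eqP => /matrixP/(_ (enum_rank_in aA a) (enum_rank_in aA a)).
by rewrite !mxE eqxx /= enum_rankK_in // ga eqxx => /eqP; rewrite oner_eq0.
Qed.

End Complex.

End Conversion.

Lemma h_polynomial_ext (K : fieldType) (N : nat) (I J : {mpoly K[N]} -> Prop) h :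
  (forall p, I p <-> J p) -> h_polynomial I h -> h_polynomial J h.
Proof.
move=> e [d [H [[[P [c1 c2]] mx] hH hh]]]; exists d, H; split=> //.
  split=> [|d' [Q [q1 q2]]].
    by exists P; split=> // i /c1[c3 c4]; split=> // p /e/c4.
  by apply: mx; exists Q; split=> // i /q1[q3 q4]; split=> // p /e/q4.
move=> m; have [b [b1 b2 b3]] := hH m; exists b; split=> //.
  by move=> p /b2[c /e hc]; exists c.
by move=> c /e/b3.
Qed.

(** * The simple graph and its regularity *)

Section Graph.

Variables (K : fieldType) (k : nat).
Local Notation n := (10 * k)%N.
Local Notation S := {mpoly K[n + n]}.
Local Notation J := (@state_ideal K k (fun=> ConeBlock)).

(** The relation [edges_of] has loops in a cone block. They are removed here, which does not change
    the ideal because the minor of a loop is 0. *)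
Definition cone_graph : rel 'I_n := fun i j =>
  (i != j) && edges_of (fun=> ConeBlock) i j.

Lemma cone_graph_simple : simple_graph cone_graph.
Proof.
split=> [i j|i]; last by rewrite /cone_graph eqxx.
rewrite /cone_graph /edges_of eq_sym [block_of i == _]eq_sym /=.
by rewrite orbCA same_triangle_sym.
Qed.

Lemma cone_idealE p : J p <-> binomial_edge_ideal K cone_graph p.
Proof.
have hJ : homog_ideal J := graph_ideal_homog K _ _ _.
split=> [|[c ->]]; last first.
  apply: (ideal_sum hJ) => i _; apply: (ideal_sum hJ) => j /andP[_ h].
  by apply: (idealMl hJ); apply: graph_edge.
elim=> [|a q p' hq _ [c ->]].
  by exists (fun _ _ => 0); rewrite !big1 // => i _; rewrite big1 // => j _; rewrite mul0r.
case: hq => [[i [j [eij ->]]]|[i []//]|[i []//]].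
have [->|ne] := eqVneq i j; first by exists c; rewrite edge_minor_diag mulr0 add0r.
exists (fun i' j' => (if (i' == i) && (j' == j) then a else 0) + c i' j').
under [RHS]eq_bigr do under eq_bigr do rewrite mulrDl.
under [RHS]eq_bigr do rewrite big_split.
rewrite big_split /=; congr (_ + _).
rewrite (bigD1 i) //= (bigD1 j) /=; last by rewrite /cone_graph ne.
rewrite !eqxx !big1 ?addr0 // => i' h; last by rewrite (negbTE (andP h).2) andbF mul0r.
by rewrite big1 // => j' _; rewrite (negbTE h) mul0r.
Qed.

Lemma cone_regularity : regularity (binomial_edge_ideal K cone_graph) (3 * k).
Proof.
have [[[m [hd [gd [D [g [r hr]]]]]] _] _] := good_state K k (fun=> ConeBlock).
have [m' [i [D' [g' [r' mD]]]]] := minimal_res (graph_ideal_homog K _ _ _) r.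
have F := graded_res_ext cone_idealE r'.
exists (tor_dim (split_complex (hd \o i) (gd \o i) D' g')); split.
- by exists (split_complex (hd \o i) (gd \o i) D' g') => //; apply: split_resolution.
- have [a [ha ga]] := cone_res_detects r'; exists (3 * k)%N.
  rewrite (split_tor_dim _ _ _ mD); apply/existsP; exists a; rewrite ha ga eqxx /=.
  by apply/eqP; lia.
- move=> l j; rewrite (split_tor_dim _ _ _ mD) => /existsP[a /andP[/eqP <- /eqP <-]].
  by apply: leq_trans (hr _) _; rewrite sum_nat_const card_ord mulnC.
Qed.

End Graph.

Theorem theorem3p4 (K : fieldType) (k : nat) (hk : (0 < k)%N) :
  exists (n : nat) (e : rel 'I_n) (r : nat) (h : {poly int}),
    [/\ (0 < n)%N /\ simple_graph e,
        regularity (binomial_edge_ideal K e) r,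
        h_polynomial (binomial_edge_ideal K e) h
      & r = ((size h).-1 + k)%N].
Proof.
exists (10 * k)%N, (@cone_graph k), (3 * k)%N, (block_h ^+ k); split.
- by rewrite muln_gt0 hk; split=> //; apply: cone_graph_simple.
- exact: cone_regularity.
- exact: h_polynomial_ext (@cone_idealE K k) (cone_h_polynomial K k).
- by rewrite deg_block_h; lia.
Qed.
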